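(* Let $u$ be the solution of the parabolic problem (P) described in the context and assume $\varepsilon(t)>0$ for $t\in[0,T]$. Let $u_h\in C^1([0,T];\mathcal S_h)$ be its semidiscrete approximation, i.e. $u_h(0,\cdot)=R_h^\star u_0$ and, for all $\chi\in\mathcal S_h$ and $t\in[0,T]$, \begin{align*} \mathcal B(\partial_tu_h(t,\cdot),\chi)=&\Big\{\tfrac{a(t)}{\varepsilon(t)}\,\partial_xu_h(t,1)-\Big[\tfrac{\delta(t)}{\varepsilon(t)}+\beta(t,1)\Big]u_h(t,1)-\Big[\tfrac{g(t)}{\varepsilon(t)}+f(t,1)\Big]\Big\}\chi'(1)\\ &+f(t,0)\,\chi'(0)-a(t)\,\mathcal B^\star(u_h(t,\cdot),\chi)+\mathcal B(\beta(t,\cdot)u_h(t,\cdot),\chi)+\mathcal B(f(t,\cdot),\chi). \end{align*} Then there is a constant $C$, independent of $h$ and $t$, such that $$\|u_h(t,\cdot)-u(t,\cdot)\|_1\le C\,h^r\Big[\|u(t,\cdot)\|_{r+1}+\Big(\int_0^t\Gamma_D(\tau)\,d\tau\Big)^{1/2}\Big]\qquad\forall\,t\in[0,T],\ \forall\,h\in(0,h_\star],$$ where $\Gamma_D(\tau):=\|u(\tau,\cdot)\|_{r+1}^2+\|\partial_tu(\tau,\cdot)\|_{r+1}^2$.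
   Context: Function spaces: $D=(0,1)$; functions are real-valued; $(f_1,f_2)=\int_Df_1f_2\,dx$ and $\|\cdot\|$ is the $L^2(D)$ norm; $\|f\|_s=\big(\sum_{\ell=0}^s\|\partial_x^\ell f\|^2\big)^{1/2}$ is the norm of $H^s(D)$; $\mathbb H^1(D)=\{v\in H^1(D):v(0)=0\}$, $\mathbb H^s(D)=H^s(D)\cap\mathbb H^1(D)$ for $s\ge2$; $\mathcal B(v,w)=(v',w')$, $\mathcal B^\star(v,w)=(v'',w'')$, $\gamma^\star(v,w)=(v'',w'')+(v',w')$. Finite elements: $r\in\mathbb N$ with $r\ge3$, $h_\star>0$ are fixed. For each $h\in(0,h_\star]$, $\mathcal S_h$ is a finite-dimensional subspace of $\mathbb H^2(D)$ consisting of $C^1$ functions that are polynomials of degree at most $r$ on each interval of a (non-uniform) partition of $D$ with maximum length $h$ (in particular the function $x\mapsto x^3$ is in $\mathcal S_h$). With a constant independent of $h$, $\inf_{\chi\in\mathcal S_h}\|v-\chi\|_2\le C h^{s-1}\|v\|_{s+1}$ for $v\in\mathbb H^{s+1}(D)$, $s=1,\dots,r$. The elliptic projection $R_h^\star:H^2(D)\to\mathcal S_h$ is defined by $\gamma^\star(R_h^\star v,\chi)=\gamma^\star(v,\chi)$ for all $\chi\in\mathcal S_h$. Problem (P): $T>0$; $\beta,f:[0,T]\times[0,1]\to\mathbb R$, $\delta,g,\varepsilon:[0,T]\to\mathbb R$, $a:[0,T]\to(0,\infty)$ with $\inf_{[0,T]}a>0$, $u_0:[0,1]\to\mathbb R$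 are given smooth functions; $u:[0,T]\times[0,1]\to\mathbb R$ satisfies $u_t=a(t)u_{xx}+\beta(t,x)u+f(t,x)$ on $[0,T]\times[0,1]$; $u(t,0)=0$ and $a(t)u_x(t,1)=\varepsilon(t)u_t(t,1)+\delta(t)u(t,1)+g(t)$ for $t\in[0,T]$; $u(0,x)=u_0(x)$ for $x\in[0,1]$. The solution $u$ is assumed sufficiently smooth. *)

(* Defs.v *)
From HB Require Import structures.
From mathcomp Require Import all_boot all_order all_algebra.
From mathcomp Require Import all_classical all_reals all_analysis.

Set Implicit Arguments.
Unset Strict Implicit.
Unset Printing Implicit Defensive.

Import Order.TTheory GRing.Theory Num.Theory.
Import numFieldNormedType.Exports.

Local Open Scope classical_set_scope.
Local Open Scope ring_scope.

(* A function on [0, 1] (resp. [0, T] x [0, 1]) is represented by a function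
   R -> R (resp. R -> R -> R, time first), of which only the values on that set
   matter. *)

Section OneSidedCalculus.
Variable R : realType.
Implicit Types (A : set R) (f : R -> R) (F : R -> R -> R).

(* Differentiation relative to A: at an endpoint of a closed interval A this is
   the one-sided derivative, at an interior point the usual one. *)
Definition derivable_in A f (x : R) : Prop :=
  cvg ((f y - f x) / (y - x) @[y --> within A x^']).

Definition deriv_in A f : R -> R :=
  fun x => lim ((f y - f x) / (y - x) @[y --> within A x^']).

Definition smooth_in A f : Prop :=
  forall k x, A x -> derivable_in A (iter k (deriv_in A) f) x.

Definition I01 : set R := `[0, 1].

Definition rect (T : R) : set (R * R) := `[0, T] `*` I01.

Definition dt (T : R) F : R -> R -> R :=
  fun t x => deriv_in `[0, T] (fun tau => F tau x) t.

Definition dx F : R -> R -> R := fun t => deriv_in I01 (F t).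

Definition continuous_rect (T : R) F : Prop :=
  {within rect T, continuous (fun p : R * R => F p.1 p.2)}.

Fixpoint Ck_rect (T : R) (k : nat) F : Prop :=
  continuous_rect T F /\
  if k is k'.+1 then
    [/\ forall t x, rect T (t, x) ->
          derivable_in `[0, T] (fun tau => F tau x) t /\
          derivable_in I01 (F t) x,
        Ck_rect T k' (dt T F)
      & Ck_rect T k' (dx F)]
  else True.

Definition smooth_rect (T : R) F : Prop := forall k, Ck_rect T k F.

(* The partial derivatives of order i <= 1 in t and j <= n in x exist and are
   continuous up to the boundary. *)
Definition C1n_rect (T : R) (n : nat) F : Prop :=
  let p i j := iter j dx (iter i (dt T) F) in
  [/\ forall t x, rect T (t, x) -> derivable_in `[0, T] (fun tau => F tau x) t,
      forall i j t x, (i <= 1)%N -> (j < n)%N -> rect T (t, x) ->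
        derivable_in I01 (p i j t) x
    & forall i j, (i <= 1)%N -> (j <= n)%N -> continuous_rect T (p i j)].

Definition C1_I01 f : Prop :=
  (forall x, I01 x -> derivable_in I01 f x) /\
  {within I01, continuous (deriv_in I01 f)}.

End OneSidedCalculus.

Section Sobolev.
Variable R : realType.
Implicit Types (v w phi : R -> R).

Definition D : set R := `]0, 1[.

Definition ip v w : R := \int[@lebesgue_measure R]_(x in D) (v x * w x).

Definition L2norm v : R := Num.sqrt (ip v v).

Definition L2 v : Prop :=
  measurable_fun D v /\
  (@lebesgue_measure R).-integrable D (EFin \o (fun x => v x ^+ 2)).

(* The space C^1_c(D) *)
Definition test_function phi : Prop :=
  [/\ forall x, derivable phi x 1,
      continuous (derive1 phi)
    & closure [set x | phi x != 0] `<=` D].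

Definition is_weak_deriv v w : Prop :=
  forall phi, test_function phi -> ip v (derive1 phi) = - ip w phi.

(* A square-integrable weak derivative if there is one (it is then unique up to
   a null set), and 0 otherwise. *)
Definition wderiv v : R -> R :=
  xget (fun=> 0) [set w | L2 w /\ is_weak_deriv v w].

Definition Hs (s : nat) v : Prop :=
  L2 v /\
  forall l, (l < s)%N ->
    L2 (iter l.+1 wderiv v) /\
    is_weak_deriv (iter l wderiv v) (iter l.+1 wderiv v).

Definition Hnorm (s : nat) v : R :=
  Num.sqrt (\sum_(l < s.+1) L2norm (iter l wderiv v) ^+ 2).

(* For s >= 1: the elements of H^s(D) vanishing at 0. Continuity on [0, 1]
   selects the representative for which the value at 0 makes sense. *)
Definition HH (s : nat) v : Prop :=
  [/\ Hs s v, {within @I01 R, continuous v} & v 0 = 0].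

Definition B v w : R := ip (wderiv v) (wderiv w).

Definition Bstar v w : R := ip (iter 2 wderiv v) (iter 2 wderiv w).

Definition gammastar v w : R := Bstar v w + B v w.

End Sobolev.

Section FiniteElements.
Variable R : realType.
Implicit Types (S : set (R -> R)) (v w : R -> R).

(* The set of all functions whose restriction to [0, 1] belongs to a fixed
   finite-dimensional space of functions on [0, 1]. *)
Definition finite_dim_space S : Prop :=
  exists (n : nat) (phi : 'I_n -> R -> R), forall v,
    S v <-> exists c : 'I_n -> R,
      forall x, I01 x -> v x = \sum_(i < n) c i * phi i x.

(* The nodes are 0 :: s; the i-th interval is [(0 :: s)_i, s_i]. *)
Definition mesh_size (s : seq R) : R :=
  \big[Num.max/0]_(i < size s) (nth 1 s i - nth 1 (0 :: s) i).

Definition piecewise_poly (r : nat) (s : seq R) v : Prop :=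
  forall i, (i < size s)%N ->
    exists2 p : {poly R}, (size p <= r.+1)%N &
      forall x, nth 1 (0 :: s) i <= x <= nth 1 s i -> v x = p.[x].

Definition fe_space (r : nat) (h : R) S : Prop :=
  [/\ finite_dim_space S,
      forall chi, S chi -> HH 2 chi /\ C1_I01 chi,
      exists s : seq R, [/\ itv_partition 0 1 s, mesh_size s = h
        & forall chi, S chi -> piecewise_poly r s chi]
    & S (fun x => x ^+ 3)].

Definition approximation_property (r : nat) (hstar : R)
    (S : R -> set (R -> R)) : Prop :=
  exists C : R, forall (h : R) (s : nat) v,
    0 < h <= hstar -> (1 <= s <= r)%N -> HH s.+1 v ->
    inf [set Hnorm 2 (v \- chi) | chi in S h] <= C * h ^+ s.-1 * Hnorm s.+1 v.

(* w = R_h^* v on [0, 1]; gammastar is positive definite on S, so this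
   determines w there. *)
Definition is_elliptic_projection S v w : Prop :=
  S w /\ forall chi, S chi -> gammastar w chi = gammastar v chi.

(* U is in C^1([0, T]; S), S being normed by the H^2 norm. *)
Definition C1_time (T : R) S (U : R -> R -> R) : Prop :=
  forall t, 0 <= t <= T ->
    [/\ S (U t),
        S (dt T U t),
        Hnorm 2 (fun x => (U tau x - U t x) / (tau - t) - dt T U t x)
          @[tau --> within `[0, T] t^'] --> (0 : R)
      & Hnorm 2 (dt T U tau \- dt T U t)
          @[tau --> within `[0, T] (nbhs t)] --> (0 : R)].

End FiniteElements.

Section Problem.
Variable R : realType.

Definition smooth_data (T : R) (beta f : R -> R -> R) (delta g eps a u0 : R -> R)
    : Prop :=
  [/\ smooth_rect T beta /\ smooth_rect T f,
      smooth_in `[0, T] delta /\ smooth_in `[0, T] g,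
      smooth_in `[0, T] eps /\ smooth_in `[0, T] a
    & smooth_in (@I01 R) u0].

Definition solution_P (T : R) (beta f : R -> R -> R)
    (delta g eps a u0 : R -> R) (u : R -> R -> R) : Prop :=
  [/\ forall t x, rect T (t, x) ->
        dt T u t x = a t * iter 2 (@dx R) u t x + beta t x * u t x + f t x,
      forall t, 0 <= t <= T -> u t 0 = 0,
      forall t, 0 <= t <= T ->
        a t * dx u t 1 = eps t * dt T u t 1 + delta t * u t 1 + g t
    & forall x, I01 x -> u 0 x = u0 x].

Definition semidiscrete (T : R) (beta f : R -> R -> R)
    (delta g eps a u0 : R -> R) (S : set (R -> R)) (uh : R -> R -> R) : Prop :=
  [/\ C1_time T S uh,
      is_elliptic_projection S u0 (uh 0)
    & forall chi t, S chi -> 0 <= t <= T ->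
        B (dt T uh t) chi =
          (a t / eps t * dx uh t 1
           - (delta t / eps t + beta t 1) * uh t 1
           - (g t / eps t + f t 1)) * deriv_in (@I01 R) chi 1
          + f t 0 * deriv_in (@I01 R) chi 0
          - a t * Bstar (uh t) chi
          + B (fun x => beta t x * uh t x) chi
          + B (f t) chi].

Definition Gamma_D (T : R) (r : nat) (u : R -> R -> R) (tau : R) : R :=
  Hnorm r.+1 (u tau) ^+ 2 + Hnorm r.+1 (dt T u tau) ^+ 2.

End Problem.

(* Main.v *)
Require Import Defs.
From mathcomp Require Import all_boot all_order all_algebra.
From mathcomp Require Import all_classical all_reals all_analysis.
From mathcomp Require Import measurable_realfun lebesgue_integral_differentiation.
From mathcomp Require Import ring lra.

Set Implicit Arguments.
Unset Strict Implicit.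
Unset Printing Implicit Defensive.

Import Order.TTheory GRing.Theory Num.Theory.
Import numFieldNormedType.Exports.

Local Open Scope classical_set_scope.
Local Open Scope ring_scope.

(** Let [w] be the elliptic projection of [u] to the finite element space, and
    split the error as [uh - u = th + rho] with [th = uh - w] in the space and
    [rho = w - u].

    Differentiating the parabolic equation in [x] and testing it with [th'] shows
    that [u] satisfies the semidiscrete equations; at the two ends the equation
    itself replaces [u''] by data, at [x = 1] with the help of the dynamical
    boundary condition. The difference with the equations for [uh] reads

      [(th_t', th') + a |th''|^2 = - (rho_t', th') - a (rho'', th'')
         + ((beta (th + rho))', th')
         + (al (th' + rho')(1) - ka (th + rho)(1)) th'(1)].

    Three observations make this a Gronwall inequality for [|th'|^2] with a right
    hand side of order [h ^ (2 r)] ([energy_inequality], [gronwall]). The term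
    [(rho'', th'')] equals [- (rho', th')] because [rho] is orthogonal to the
    space, so [rho''], which is one order worse, does not enter. The boundary term
    [th'(1) ^ 2] is absorbed by [a |th''|^2] thanks to a trace inequality
    ([AC_trace]). And [rho'(1)] is bounded by [|rho'|], because the cube belongs to
    the space: testing with it expresses [rho'(1)] by an integral of [rho']
    ([orthogonal_cube_flux]).

    The rate [|rho'| = O(h ^ r)] comes from quasi-optimality of the projection,
    which gives [h ^ (r - 1)] in the energy norm, and a duality argument for the
    missing power ([galerkin_bound], [aubin_nitsche], [projection_rate]).

    That [|th'|^2] can be differentiated in time rests on two facts: the difference
    quotients in time of [u] converge in H^2, because derivatives in time and space
    may be exchanged, uniformly in [x] ([uniform_quotient_dx]); and the projection
    is linear and a contraction for the energy ([projection_contraction]), so the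
    difference quotients of [w] converge to the projection of [u_t].

    The norms and forms of the statement involve a weak derivative picked by a
    choice operator. The first half of the file shows that it is computed by
    densities of absolutely continuous functions: these satisfy the product rule
    ([AC_mul], by Fubini), are weak derivatives ([AC_weak]), and conversely a
    continuous function with a square-integrable weak derivative is absolutely
    continuous ([weak_AC], the lemma of du Bois-Reymond). *)

(** * Square-integrable functions on the unit interval *)

Section SquareIntegrable.
Variable R : realType.
Implicit Types (u v w : R -> R) (a b c x : R).

Local Notation mu := (@lebesgue_measure R).
Local Notation D := (@D R).

(** Integrability is kept apart from [L2]: a product of two [L2] functions is a
    legitimate density, although it need not be square integrable. *)
Definition L1 v : Prop := mu.-integrable D (EFin \o v).

Lemma measurable_D : measurable (D : set (measurableTypeR R)). Proof. exact: measurable_itv. Qed.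

Lemma measure_D : mu D = 1%:E.
Proof. by rewrite lebesgue_measure_itv /= lte_fin ltr01 -EFinB subr0. Qed.

Lemma L1_measurable v : L1 v -> measurable_fun D v.
Proof. by move=> /integrableP[/measurable_EFinP]. Qed.

Lemma L2_mul_integrable v w : L2 v -> L2 w -> L1 (fun x => v x * w x).
Proof.
move=> [mv iv] [mw iw]; rewrite /L1.
apply: (le_integrable measurable_D (f := EFin \o (fun x => v x * w x))
  (g := EFin \o (fun x => v x ^+ 2 + w x ^+ 2))).
- by apply/measurable_EFinP; exact: measurable_funM.
- move=> x _ /=; rewrite lee_fin [leRHS]ger0_norm; last by rewrite addr_ge0 ?sqr_ge0.
  have p := sqr_ge0 (v x + w x); have m := sqr_ge0 (v x - w x).
  by rewrite ler_norml; apply/andP; split; nra.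
- by have := integrableD measurable_D iv iw.
Qed.

Lemma L2_cst c : L2 (fun=> c).
Proof.
split; first exact: measurable_cst.
apply/integrableP; split; first by apply/measurable_EFinP; exact: measurable_cst.
rewrite integral_cst//; last exact: measurable_D.
rewrite [X in (_ * X)%E](_ : _ = 1%:E); last exact: measure_D.
by rewrite mule1 ltry.
Qed.

Lemma L2_L1 v : L2 v -> L1 v.
Proof.
move=> /L2_mul_integrable/(_ (L2_cst 1)).
by congr integrable; apply/funext => x /=; rewrite mulr1.
Qed.

Lemma L1_lin a b v w : L1 v -> L1 w -> L1 (fun x => a * v x + b * w x).
Proof.
move=> iv iw.
by have := integrableD measurable_D (integrableZl measurable_D a iv)
  (integrableZl measurable_D b iw).
Qed.

Lemma L2_lin a b v w : L2 v -> L2 w -> L2 (fun x => a * v x + b * w x).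
Proof.
move=> Lv Lw; have [mv iv] := Lv; have [mw iw] := Lw; split.
  by apply: measurable_funD; apply: measurable_funM => //; exact: measurable_cst.
have := L1_lin 1 1 (L1_lin (a ^+ 2) (b ^+ 2) iv iw)
  (L1_lin (2 * a * b) 0 (L2_mul_integrable Lv Lw) iv).
by congr integrable; apply/funext => x /=; congr EFin; ring.
Qed.

Lemma L2Z c v : L2 v -> L2 (fun x => c * v x).
Proof.
move=> Lv; have := L2_lin c 0 Lv Lv.
by congr L2; apply/funext => x; rewrite mul0r addr0.
Qed.

Lemma L2D v w : L2 v -> L2 w -> L2 (fun x => v x + w x).
Proof.
move=> Lv Lw; have := L2_lin 1 1 Lv Lw.
by congr L2; apply/funext => x; rewrite !mul1r.
Qed.

Lemma L2B v w : L2 v -> L2 w -> L2 (fun x => v x - w x).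
Proof.
move=> Lv Lw; have := L2_lin 1 (-1) Lv Lw.
by congr L2; apply/funext => x; rewrite mul1r mulN1r.
Qed.

Lemma ipC v w : ip v w = ip w v.
Proof. by rewrite /ip; apply: eq_Rintegral => x _; rewrite mulrC. Qed.

Lemma ip_linl a b u v w : L2 u -> L2 v -> L2 w ->
  ip (fun x => a * u x + b * v x) w = a * ip u w + b * ip v w.
Proof.
move=> Lu Lv Lw; have iu := L2_mul_integrable Lu Lw.
have iv := L2_mul_integrable Lv Lw; rewrite /ip.
have mD := measurable_D.
rewrite -(RintegralZl _ mD iu) -(RintegralZl _ mD iv).
rewrite -RintegralD//; last 2 first.
  exact: (integrableZl mD a iu).
  exact: (integrableZl mD b iv).
by apply: eq_Rintegral => x _; ring.
Qed.

Lemma ip_linr a b u v w : L2 u -> L2 v -> L2 w ->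
  ip w (fun x => a * u x + b * v x) = a * ip w u + b * ip w v.
Proof. by move=> Lu Lv Lw; rewrite ipC ip_linl// !(ipC _ w). Qed.

Lemma ipDl u v w : L2 u -> L2 v -> L2 w ->
  ip (fun x => u x + v x) w = ip u w + ip v w.
Proof.
move=> Lu Lv Lw; transitivity (1 * ip u w + 1 * ip v w); last by rewrite !mul1r.
by rewrite -ip_linl//; congr ip; apply/funext => x; rewrite !mul1r.
Qed.

Lemma ipBl u v w : L2 u -> L2 v -> L2 w ->
  ip (fun x => u x - v x) w = ip u w - ip v w.
Proof.
move=> Lu Lv Lw; transitivity (1 * ip u w + (-1) * ip v w); last by rewrite mul1r mulN1r.
by rewrite -ip_linl//; congr ip; apply/funext => x; rewrite mul1r mulN1r.
Qed.

Lemma ipZl c v w : L2 v -> L2 w -> ip (fun x => c * v x) w = c * ip v w.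
Proof.
move=> Lv Lw; transitivity (c * ip v w + 0 * ip v w); last by rewrite mul0r addr0.
by rewrite -ip_linl//; congr ip; apply/funext => x; rewrite mul0r addr0.
Qed.

Lemma ip_ge0 v : 0 <= ip v v.
Proof. by rewrite /ip; apply: Rintegral_ge0 => x _; rewrite -expr2 sqr_ge0. Qed.

Lemma ip_sqr_lin a b v w : L2 v -> L2 w ->
  let z x := a * v x + b * w x in
  ip z z = a ^+ 2 * ip v v + 2 * a * b * ip v w + b ^+ 2 * ip w w.
Proof.
move=> Lv Lw z; rewrite /z ip_linl//; last exact: L2_lin.
by rewrite !ip_linr// (ipC w v); ring.
Qed.

(** Both signs of [ip v w] are covered by [0 <= |k v + w|^2] and
    [0 <= |k v - w|^2]. *)
Lemma ip_young (k : R) v w : 0 < k -> L2 v -> L2 w ->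
  2 * `|ip v w| <= k * ip v v + k^-1 * ip w w.
Proof.
move=> k0 Lv Lw.
have P := ip_ge0 (fun x => k * v x + 1 * w x).
have N := ip_ge0 (fun x => k * v x + (-1) * w x).
rewrite !ip_sqr_lin// in P N.
have kk : k * k^-1 = 1 by rewrite mulfV// gt_eqF.
have : k * (2 * `|ip v w|) <= k * (k * ip v v + k^-1 * ip w w).
  rewrite mulrDr (mulrA k k^-1) kk mul1r.
  by case: (ger0P (ip v w)) => _; nra.
by rewrite ler_pM2l.
Qed.

(** The quadratic polynomial [|k v + w|^2] in [k] is nonnegative; it is evaluated
    at its minimum when [v] has positive norm, and far out otherwise. *)
Lemma ip_CauchySchwarz v w : L2 v -> L2 w ->
  ip v w ^+ 2 <= ip v v * ip w w.
Proof.
move=> Lv Lw.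
have P (k : R) := ip_ge0 (fun x => k * v x + 1 * w x).
have Q (k : R) : 0 <= k ^+ 2 * ip v v + 2 * k * ip v w + ip w w.
  by have := P k; rewrite ip_sqr_lin// !mulr1 expr1n mul1r.
have v0 := ip_ge0 v; have w0 := ip_ge0 w.
have [vz|vp] := eqVneq (ip v v) 0.
  rewrite vz mul0r; have [->|vw] := eqVneq (ip v w) 0; first by rewrite expr0n.
  have := Q (- (ip w w + 1) / (2 * ip v w)); rewrite vz mulr0 add0r.
  have -> : 2 * (- (ip w w + 1) / (2 * ip v w)) * ip v w = - (ip w w + 1).
    by field.
  by lra.
have {vp}v0 : 0 < ip v v by rewrite lt_neqAle eq_sym vp.
have := Q (- ip v w / ip v v).
have -> : (- ip v w / ip v v) ^+ 2 * ip v v + 2 * (- ip v w / ip v v) * ip v w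
    + ip w w = (ip v v * ip w w - ip v w ^+ 2) / ip v v.
  by field; rewrite gt_eqF.
by rewrite pmulr_lge0 ?invr_gt0// subr_ge0.
Qed.

Lemma L2norm_sqr v : L2norm v ^+ 2 = ip v v.
Proof. by rewrite /L2norm sqr_sqrtr// ip_ge0. Qed.

Lemma continuous_L2 v : {within @I01 R, continuous v} -> L2 v.
Proof.
have sub : D `<=` @I01 R by apply: subset_itv; rewrite bnd_simp.
have mI : measurable (@I01 R : set (measurableTypeR R)) by exact: measurable_itv.
move=> cv; split.
  by apply: measurable_funS sub _ => //; exact: subspace_continuous_measurable_fun.
apply: (integrableS (mu := mu) (E := @I01 R)
  (f := EFin \o (fun x => v x ^+ 2)) mI measurable_D sub).
apply: continuous_compact_integrable; first exact: segment_compact.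
by move=> x; apply: (@continuousM _ (subspace (@I01 R)) v v); exact: cv.
Qed.

Lemma ae_ip v1 v2 w1 w2 :
  measurable_fun D v1 -> measurable_fun D v2 ->
  measurable_fun D w1 -> measurable_fun D w2 ->
  ae_eq mu D v1 v2 -> ae_eq mu D w1 w2 -> ip v1 w1 = ip v2 w2.
Proof.
move=> m1 m2 n1 n2 ev ew; rewrite /ip /Rintegral; congr fine.
apply: ae_eq_integral; first exact: measurable_D.
- by apply/measurable_EFinP; exact: measurable_funM.
- by apply/measurable_EFinP; exact: measurable_funM.
- by apply: filterS2 ev ew => x + + xD => /(_ xD) -> /(_ xD) ->.
Qed.

End SquareIntegrable.

(** * Double integrals over triangles *)

Section Triangle.
Variable R : realType.
Local Notation mu := (@lebesgue_measure R).
Local Notation RT := (measurableTypeR R).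
Implicit Types (f g : R -> R).

Let triangle_kernel f g : RT * RT -> \bar R :=
  fun p => (if p.2 < p.1 then f p.1 * g p.2 else 0)%:E.

Let measurable_triangle_kernel f g :
  measurable_fun [set: RT] (f : RT -> R) -> measurable_fun [set: RT] (g : RT -> R) ->
  measurable_fun [set: RT * RT] (triangle_kernel f g).
Proof.
move=> mf mg; apply/measurable_EFinP; apply: measurable_fun_ifT.
- by apply: measurable_fun_ltr; [exact: measurable_snd|exact: measurable_fst].
- apply: measurable_funM; apply: measurableT_comp => //.
- exact: measurable_cst.
Qed.

Let integrable_triangle_kernel f g :
  mu.-integrable [set: RT] (EFin \o f) -> mu.-integrable [set: RT] (EFin \o g) ->
  (mu \x mu)%E.-integrable [set: RT * RT] (triangle_kernel f g).
Proof.
move=> if_ ig; have /integrableP[/measurable_EFinP mf foo] := if_.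
have /integrableP[/measurable_EFinP mg goo] := ig.
apply/integrable12ltyP; first exact: measurable_triangle_kernel.
apply: (@le_lt_trans _ _ (\int[mu]_x (`|(f x)%:E| * \int[mu]_y `|(g y)%:E|))%E).
  apply: ge0_le_integral => //.
  - by move=> x _; apply: integral_ge0.
  - apply: (measurable_fun_fubini_tonelli_F (m2 := mu)
      (fun p => `|triangle_kernel f g p|%E)) => //.
    by apply: measurableT_comp => //; exact: measurable_triangle_kernel.
  - apply: emeasurable_funM; last exact: measurable_cst.
    by apply: measurableT_comp => //; exact/measurable_EFinP.
  - move=> x _; rewrite -ge0_integralZl//.
    + apply: ge0_le_integral => //.
      * apply: measurableT_comp => //.
        have := measurable_triangle_kernel mf mg.
        by move=> m; apply: (measurableT_comp m); exact: measurable_pair1.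
      * by apply: measurable_funeM; apply: measurableT_comp => //; exact/measurable_EFinP.
      * move=> y _; rewrite /triangle_kernel /=; case: ifP => _.
          by rewrite -EFinM lee_fin normrM.
        by rewrite -EFinM lee_fin normr0 mulr_ge0.
    + by apply: measurableT_comp => //; exact/measurable_EFinP.
rewrite ge0_integralZr//.
- by rewrite lte_mul_pinfty// ?integral_ge0// ge0_fin_numE// integral_ge0.
- by apply: measurableT_comp => //; exact/measurable_EFinP.
- exact: integral_ge0.
Qed.

(** The plane is, up to the diagonal, the union of the triangles [y < x] and
    [x < y]; [f x * g y] is integrated over both, by Fubini. *)
Lemma integral_triangles f g :
  mu.-integrable [set: RT] (EFin \o f) -> mu.-integrable [set: RT] (EFin \o g) ->
  \int[mu]_x (f x * \int[mu]_(y in `]-oo, x[) g y) +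
  \int[mu]_x (g x * \int[mu]_(y in `]-oo, x[) f y) =
  (\int[mu]_x f x) * (\int[mu]_x g x).
Proof.
move=> if_ ig.
have mNy (x : R) : measurable (`]-oo, x[%classic : set RT) by exact: measurable_itv.
have inner f' g' x : mu.-integrable [set: RT] (EFin \o g') ->
    (\int[mu]_y triangle_kernel f' g' (x, y))%E =
    (f' x * \int[mu]_(y in `]-oo, x[) g' y)%:E.
  move=> ig'.
  have ix : mu.-integrable `]-oo, x[ (EFin \o g').
    exact: (integrableS (mu := mu) (E := [set: RT]) (f := EFin \o g') measurableT (mNy x) (@subsetT _ _)).
  rewrite EFinM /Rintegral fineK; last exact: integrable_fin_num.
  rewrite -integralZl// integral_mkcond/=; apply: eq_integral => y _.
  rewrite /triangle_kernel /patch /=.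
  have -> : (y \in [set` `]-oo, x[]) = (y < x).
    by apply/idP/idP; rewrite inE /= in_itv.
  by case: ifP => _; rewrite ?EFinM.
have inner2 y :
    (\int[mu]_x triangle_kernel f g (x, y))%E =
    (\int[mu]_x f x * g y - g y * \int[mu]_(x in `]-oo, y[) f x)%:E.
  have my : measurable (`]y, +oo[%classic : set RT) by exact: measurable_itv.
  have iy : mu.-integrable `]y, +oo[ (EFin \o f).
    exact: (integrableS (mu := mu) (E := [set: RT]) (f := EFin \o f) measurableT my (@subsetT _ _)).
  have iNy : mu.-integrable `]-oo, y[ (EFin \o f).
    exact: (integrableS (mu := mu) (E := [set: RT]) (f := EFin \o f) measurableT (mNy y) (@subsetT _ _)).
  have iT : mu.-integrable `]-oo, +oo[ (EFin \o f) by rewrite set_itvNyy.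
  have := Rintegral_itvB iT (x := y) isT isT.
  rewrite -Rintegral_itv_bndo_bndc// set_itvNyy => e.
  rewrite (mulrC _ (g y)) -mulrBr e EFinM /Rintegral fineK; last exact: integrable_fin_num.
  rewrite -integralZl//.
  rewrite [RHS]integral_mkcond/=; apply: eq_integral => x _.
  rewrite /triangle_kernel /patch /=.
  have -> : (x \in [set` `]y, +oo[]) = (y < x).
    by apply/idP/idP; rewrite inE /= in_itv /= andbT.
  by case: ifP => _ //; rewrite EFinM muleC.
have iP f' g' : mu.-integrable [set: RT] (EFin \o f') ->
    mu.-integrable [set: RT] (EFin \o g') ->
    mu.-integrable [set: RT] (EFin \o (fun x => f' x * \int[mu]_(y in `]-oo, x[) g' y)).
  move=> i1 i2.
  have := integrable_fubini_F (integrable_triangle_kernel i1 i2).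
  by congr integrable; apply/funext => x; exact: inner.
have := Fubini (integrable_triangle_kernel if_ ig).
under eq_integral do rewrite inner//.
under [in RHS]eq_integral do rewrite inner2.
move=> /(congr1 fine); rewrite -!/(Rintegral _ _ _) => ->.
rewrite RintegralB//.
- by rewrite RintegralZl// addrNK.
- exact: (integrableZl (mu := mu) measurableT (\int[mu]_x f x) ig).
- exact: iP.
Qed.

End Triangle.

(** * Absolutely continuous functions on [0, 1] *)

Section AbsolutelyContinuous.
Variable R : realType.
Implicit Types (v w : R -> R) (a b x : R).

Local Notation mu := (@lebesgue_measure R).
Local Notation D := (@D R).
Local Notation RT := (measurableTypeR R).

(** Absolute continuity on [0, 1], with the density as part of the data: the form
    in which weak derivatives are computed below. The open interval of integration
    makes the case [x = 1] an integral over the domain [D] of the inner product. *)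
Definition AC01 v w : Prop :=
  L1 w /\ forall x, 0 <= x <= 1 -> v x = v 0 + \int[mu]_(y in `]0, x[) w y.

Lemma itv0x_sub x : x <= 1 -> `]0, x[ `<=` D.
Proof. by move=> x1; apply: subset_itv; rewrite bnd_simp. Qed.

Lemma measurable_itvR (i : interval R) : measurable ([set` i] : set RT).
Proof. exact: measurable_itv. Qed.

Lemma L1_itv w x : L1 w -> x <= 1 -> mu.-integrable `]0, x[ (EFin \o w).
Proof.
move=> iw x1; exact: (integrableS (mu := mu) (E := D) (f := EFin \o w)
  (@measurable_D R) (measurable_itvR `]0, x[) (itv0x_sub x1)).
Qed.

Lemma AC_eq v v' w : {in @I01 R, v =1 v'} -> AC01 v w -> AC01 v' w.
Proof.
move=> e [iw vw]; split=> // x x01.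
have x0 : 0 \in @I01 R by rewrite inE /I01 /= in_itv /= lexx ler01.
have xI : x \in @I01 R by rewrite inE /I01 /= in_itv.
by rewrite -(e x xI) -(e 0 x0) vw.
Qed.

Lemma AC_lin a b v v1 w w1 : AC01 v v1 -> AC01 w w1 ->
  AC01 (fun x => a * v x + b * w x) (fun x => a * v1 x + b * w1 x).
Proof.
move=> [iv ev] [iw ew]; split; first exact: L1_lin.
move=> x x01; rewrite (ev x x01) (ew x x01); have /andP[_ x1] := x01.
have mx := measurable_itvR `]0, x[.
have jv := L1_itv iv x1; have jw := L1_itv iw x1.
rewrite RintegralD//; last 2 first.
  exact: (integrableZl (mu := mu) mx a jv).
  exact: (integrableZl (mu := mu) mx b jw).
by rewrite !RintegralZl//; ring.
Qed.

Lemma AC_eqr v w w' : w =1 w' -> AC01 v w -> AC01 v w'.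
Proof. by move=> /funext ->. Qed.

Lemma ACD v v1 w w1 : AC01 v v1 -> AC01 w w1 ->
  AC01 (fun x => v x + w x) (fun x => v1 x + w1 x).
Proof.
move=> hv hw; have := AC_lin 1 1 hv hw.
by congr AC01; apply/funext => x; rewrite !mul1r.
Qed.

Lemma ACB v v1 w w1 : AC01 v v1 -> AC01 w w1 ->
  AC01 (fun x => v x - w x) (fun x => v1 x - w1 x).
Proof.
move=> hv hw; have := AC_lin 1 (-1) hv hw.
by congr AC01; apply/funext => x; rewrite mul1r mulN1r.
Qed.

Lemma ACZ a v v1 : AC01 v v1 -> AC01 (fun x => a * v x) (fun x => a * v1 x).
Proof.
move=> hv; have := AC_lin a 0 hv hv.
by congr AC01; apply/funext => x; rewrite mul0r addr0.
Qed.

Lemma L1_cc w : L1 w -> mu.-integrable `[0, 1] (EFin \o w).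
Proof.
move=> /integrableP[m foo]; apply/integrableP.
have m' : measurable_fun (`[0, 1]%classic : set RT) (EFin \o w).
  move/measurable_EFinP : m => m; apply/measurable_EFinP.
  exact: (@measurable_fun_itv_cc _ 0 1 false true w m).
split=> //; rewrite integral_itv_bndoo//.
by apply: measurableT_comp => //; exact: m.
Qed.

Lemma AC_continuous v w : AC01 v w -> {within @I01 R, continuous v}.
Proof.
move=> [iw ev]; have := parameterized_integral_continuous ler01 (L1_cc iw).
rewrite -/(@I01 R) => cW.
have c : {within @I01 R, continuous (fun x => v 0 +
    parameterized_integral mu 0 x w)}.
  move=> x; apply: (@continuousD _ _ (subspace (@I01 R))); first exact: cvg_cst.
  exact: cW.
apply: subspace_eq_continuous c => x.
rewrite inE /I01 /= in_itv /= => /andP[x0 x1].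
rewrite -[RHS]/(v x) (ev x) ?x0//; congr (_ + _); rewrite /parameterized_integral.
rewrite -Rintegral_itv_bndo_bndc; last first.
  exact: (integrableS (mu := mu) (E := `[0, 1]%classic) (f := EFin \o w)
    (measurable_itvR `[0, 1]) (measurable_itvR `[0, x[)
    (subset_itv (lexx _) (x1 : (BLeft x <= BRight 1)%O)) (L1_cc iw)).
rewrite Rintegral_itv_obnd_cbnd//; exact: L1_itv.
Qed.

Lemma AC_L2 v w : AC01 v w -> L2 v.
Proof. by move=> /AC_continuous/continuous_L2. Qed.

Lemma AC_integral v w : AC01 v w -> \int[mu]_(y in D) w y = v 1 - v 0.
Proof.
by move=> [_ /(_ 1)]; rewrite ler01 lexx => /(_ isT) ->; rewrite addrC addKr.
Qed.

End AbsolutelyContinuous.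

(** * The product rule for absolutely continuous functions *)

Section ProductRule.
Variable R : realType.
Implicit Types (v w : R -> R) (a b x : R).

Local Notation mu := (@lebesgue_measure R).
Local Notation D := (@D R).
Local Notation RT := (measurableTypeR R).

Lemma D_I01 : D `<=` @I01 R.
Proof. by apply: subset_itv; rewrite bnd_simp. Qed.

Lemma itv_continuous_bounded (p q : R) v : {within `[p, q], continuous v} ->
  exists2 M, 0 <= M & forall x, p <= x <= q -> `|v x| <= M.
Proof.
move=> cv; have /compact_bounded := continuous_compact cv (@segment_compact R p q).
move=> [M [Mr hM]]; exists (`|M| + 1); first by rewrite addr_ge0.
move=> x x01; apply: (hM (`|M| + 1)); first by rewrite ltr_pwDr// ler_norm.
by exists x => //=; rewrite in_itv.
Qed.

Lemma L1_mul_continuous v w : L1 v -> {within @I01 R, continuous w} ->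
  L1 (fun x => v x * w x).
Proof.
move=> iv cw; have [M M0 hM] := itv_continuous_bounded cw.
have [mw _] := continuous_L2 cw.
apply: (le_integrable (mu := mu) (@measurable_D R)
  (f := EFin \o (fun x => v x * w x)) (g := EFin \o (fun x => M * v x))).
- apply/measurable_EFinP; apply: measurable_funM => //; exact: L1_measurable.
- move=> x Dx /=; rewrite lee_fin !normrM mulrC (ger0_norm M0) ler_wpM2r//.
  by apply: hM; have := D_I01 Dx; rewrite /I01 /= in_itv.
- exact: (integrableZl (mu := mu) (@measurable_D R) M iv).
Qed.

Lemma restrict_integral_itv w x s : s <= x -> 
  \int[mu]_(y in `]-oo, s[) (w \_ `]0, x[) y = \int[mu]_(y in `]0, s[) w y.
Proof.
move=> sx; rewrite -Rintegral_mkcondr; congr Rintegral.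
rewrite eqEsubset; split => y /=; rewrite !in_itv /=.
  by move=> [-> /andP[-> _]].
by move=> /andP[-> ys]; rewrite ys (lt_le_trans ys sx).
Qed.

(** Subtracting the values at 0, the increments of [v] and [w] over [0, x] are
    integrals of the densities, and [integral_triangles] writes their product as
    the sum of two iterated integrals, whose inner integrals are increments
    again. *)
Lemma AC_mul v v1 w w1 : AC01 v v1 -> AC01 w w1 ->
  AC01 (fun x => v x * w x) (fun x => v1 x * w x + v x * w1 x).
Proof.
move=> hv hw; have cv := AC_continuous hv; have cw := AC_continuous hw.
have [iv ev] := hv; have [iw ew] := hw.
have i1 := L1_mul_continuous iv cw; have i2 := L1_mul_continuous iw cv.
have i2' : L1 (fun x => v x * w1 x).
  by move: i2; congr integrable; apply/funext => x /=; rewrite mulrC.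
split.
  have := L1_lin 1 1 i1 i2'.
  by congr integrable; apply/funext => x /=; rewrite !mul1r.
move=> x x01; have /andP[x0 x1] := x01.
have mx := measurable_itvR `]0, x[.
have rest f : L1 f -> mu.-integrable [set: RT] (EFin \o (f \_ `]0, x[)).
  move=> if_; rewrite -restrict_EFin; apply/(integrable_mkcond _ mx).1.
  exact: L1_itv.
have := integral_triangles (rest _ iv) (rest _ iw).
have E p p1 q q1 : AC01 p p1 -> AC01 q q1 ->
    \int[mu]_y ((p1 \_ `]0, x[) y * \int[mu]_(t in `]-oo, y[) (q1 \_ `]0, x[) t)
    = \int[mu]_(y in `]0, x[) (p1 y * q y) - q 0 * (p x - p 0).
  move=> hp hq; have [ip ep] := hp; have [_ eq] := hq.
  have ipq := L1_itv (L1_mul_continuous ip (AC_continuous hq)) x1.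
  have ipx := L1_itv ip x1.
  transitivity (\int[mu]_(y in `]0, x[) (p1 y * q y - q 0 * p1 y)); last first.
    rewrite RintegralB// ?RintegralZl//; last exact: (integrableZl (mu := mu) mx (q 0) ipx).
    by rewrite (ep x x01) (addrC (p 0)) addrK.
  rewrite [RHS]Rintegral_mkcond; apply: eq_Rintegral => y _.
  rewrite /patch; case: ifPn => [|_]; last by rewrite mul0r.
  rewrite inE /= in_itv /= => /andP[y0 yx].
  rewrite -/(patch _ _ _) restrict_integral_itv ?ltW// (eq y); first by ring.
  by rewrite (ltW y0) (le_trans (ltW yx)).
rewrite (E v v1 w w1)// (E w w1 v v1)// -!Rintegral_mkcond.
rewrite (_ : \int[mu]_(y in `]0, x[) v1 y = v x - v 0); last first.
  by rewrite (ev x x01) addrAC subrr add0r.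
rewrite (_ : \int[mu]_(y in `]0, x[) w1 y = w x - w 0); last first.
  by rewrite (ew x x01) addrAC subrr add0r.
move=> key; rewrite RintegralD//; last 2 first.
- exact: L1_itv i1 x1.
- exact: L1_itv i2' x1.
have -> : \int[mu]_(y in `]0, x[) (v y * w1 y) = \int[mu]_(y in `]0, x[) (w1 y * v y).
  by apply: eq_Rintegral => y _; rewrite mulrC.
by lra.
Qed.

End ProductRule.

(** * Classical, almost everywhere and weak derivatives *)

Section WeakDerivatives.
Variable R : realType.
Implicit Types (v w F f phi : R -> R) (a b c x : R).

Local Notation mu := (@lebesgue_measure R).
Local Notation D := (@D R).
Local Notation RT := (measurableTypeR R).

Lemma AC_classical F f :
  {within @I01 R, continuous F} -> {within @I01 R, continuous f} ->
  (forall x, 0 < x < 1 -> is_derive x 1 F (f x)) -> AC01 F f.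
Proof.
move=> cF cf dF; split; first exact/L2_L1/continuous_L2.
move=> x /andP[]; rewrite le_eqVlt => /predU1P[<- _|x0 x1].
  by rewrite set_itvoo0 Rintegral_set0 addr0.
have sub : `[0, x] `<=` @I01 R by apply: subset_itv; rewrite bnd_simp.
have cF' := continuous_subspaceW sub cF; have cf' := continuous_subspaceW sub cf.
have dF' y : y \in `]0, x[ -> is_derive y 1 F (f y).
  by rewrite in_itv /= => /andP[y0 yx]; apply: dF; rewrite y0 (lt_le_trans yx).
have [_ Fl Fr] := (continuous_within_itvP F x0).1 cF'.
have LR : derivable_oo_LRcontinuous F 0 x.
  by split=> // y /dF' [].
have E : {in `]0, x[, F^`()%classic =1 f}.
  by move=> y /dF' /@derive_val <-; rewrite derive1E.
have := continuous_FTC2 x0 cf' LR E.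
move=> /(congr1 fine); rewrite -/(Rintegral _ _ _) /= => e.
have s0x : `[0, x[ `<=` `[0, x] by apply: subset_itvl; rewrite bnd_simp.
have icc := continuous_compact_integrable (@segment_compact R 0 x) cf'.
have ico := integrableS (mu := mu) (E := `[0, x]%classic) (f := EFin \o f)
    (measurable_itvR `[0, x]) (measurable_itvR `[0, x[) s0x icc.
rewrite Rintegral_itv_obnd_cbnd; last exact: (L1_itv (L2_L1 (continuous_L2 cf))).
by rewrite Rintegral_itv_bndo_bndc// e addrCA subrr addr0.
Qed.

(** The difference of the densities has a vanishing primitive, so it vanishes
    almost everywhere by the Lebesgue differentiation theorem. *)
Lemma AC_unique v w1 w2 : AC01 v w1 -> AC01 v w2 -> ae_eq mu D w1 w2.
Proof.
move=> h1 h2; have [iz ez] := ACB h1 h2; set z := (fun x => w1 x - w2 x) in iz ez.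
have ez' x : 0 <= x <= 1 -> \int[mu]_(y in `]0, x[) z y = 0.
  by move=> /ez /eqP; rewrite !subrr add0r eq_sym => /eqP.
have Dm := @measurable_D R.
have iZ : mu.-integrable [set: RT] (EFin \o (z \_ D)).
  by rewrite -restrict_EFin; apply/(integrable_mkcond _ Dm).1.
have iNy (y : R) : mu.-integrable `]-oo, y] (EFin \o (z \_ D)).
  exact: (integrableS (mu := mu) (E := [set: RT]) (f := EFin \o (z \_ D))
    measurableT (measurable_itvR `]-oo, y]) (@subsetT _ _)).
have loc := integrable_locally Dm iz.
have F0 : (fun x => \int[mu]_(t in `]-oo, x]) (z \_ D) t) = cst 0.
  apply/funext => x; rewrite -Rintegral_mkcondr /=.
  have [x0|x0] := leP x 0.
    rewrite (_ : _ `&` _ = set0) ?Rintegral_set0//.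
    rewrite -subset0 => y; rewrite /D /= !in_itv /= => -[yx /andP[y0 _]].
    by move: (lt_le_trans y0 yx); rewrite ltNge x0.
  have [x1|x1] := leP 1 x.
    rewrite (_ : _ `&` _ = `]0, 1[%classic) ?ez' ?ler01 ?lexx//.
    rewrite eqEsubset; split => y; rewrite /D /= !in_itv /=; first by case.
    by move=> yD; split; [exact: (ltW (lt_le_trans (andP yD).2 x1))|exact: yD].
  rewrite (_ : _ `&` _ = `]0, x]%classic).
    by rewrite -Rintegral_itv_bndo_bndc ?ez' ?(ltW x0) ?ltW//; exact: (L1_itv iz (ltW x1)).
  rewrite eqEsubset; split => y /=; rewrite !in_itv /=.
    by rewrite /D /= in_itv /= => -[-> /andP[-> _]].
  by rewrite /D /= in_itv /= => /andP[-> yx]; rewrite yx (le_lt_trans yx).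
have := FTC1Ny iNy loc; rewrite F0 => ae0; apply: (@filterS _ _ (ae_filter_ringOfSetsType mu) _ _ _ ae0) => x [_ +] Dx.
by rewrite derive1_cst /patch mem_set// => /eqP; rewrite eq_sym subr_eq0 => /eqP.
Qed.

Lemma test_function_AC phi : test_function phi ->
  [/\ AC01 phi (derive1 phi), phi 0 = 0 & phi 1 = 0].
Proof.
move=> [dphi cphi sphi]; split.
- apply: AC_classical.
  + by apply: continuous_subspaceT => x; apply: differentiable_continuous; exact/derivable1_diffP.
  + exact: continuous_subspaceT.
  + by move=> x _; rewrite derive1E; exact/derivableP.
- apply/eqP/negP => /negP phi0; have : D 0 by apply: sphi; exact: subset_closure.
  by rewrite /D /= in_itv /= ltxx.
- apply/eqP/negP => /negP phi0; have : D 1 by apply: sphi; exact: subset_closure.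
  by rewrite /D /= in_itv /= ltxx andbF.
Qed.

(** Integration by parts against a test function, which vanishes at 0 and 1. *)
Lemma AC_weak v w : AC01 v w -> is_weak_deriv v w.
Proof.
move=> vw phi /test_function_AC[hphi phi0 phi1].
have := AC_integral (AC_mul vw hphi).
rewrite phi0 phi1 !mulr0 subrr => /eqP; rewrite RintegralD; last 3 first.
- exact: measurable_D.
- exact: L1_mul_continuous vw.1 (AC_continuous hphi).
- have := L1_mul_continuous hphi.1 (AC_continuous vw).
  by congr integrable; apply/funext => x /=; rewrite mulrC.
by rewrite addrC addr_eq0 => /eqP.
Qed.

End WeakDerivatives.

(** * The lemma of du Bois-Reymond *)

Section DuBoisReymond.
Variable R : realType.
Implicit Types (v w z g m phi : R -> R) (a b c x p q : R).

Local Notation mu := (@lebesgue_measure R).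
Local Notation D := (@D R).
Local Notation RT := (measurableTypeR R).

Lemma integrable_itvNy m x : mu.-integrable [set: RT] (EFin \o m) ->
  mu.-integrable `]-oo, x] (EFin \o m).
Proof.
move=> im; exact: (integrableS (mu := mu) (E := [set: RT]) (f := EFin \o m)
    measurableT (measurable_itvR `]-oo, x]) (@subsetT _ _)).
Qed.

Lemma continuous_antiderivative m : continuous m ->
  mu.-integrable [set: RT] (EFin \o m) ->
  forall x, is_derive x 1 (fun y : R => \int[mu]_(t in `]-oo, y]) m t) (m x).
Proof.
move=> cm im x.
have xx1 : x < x + 1 by rewrite ltrDl.
have [] : derivable (fun y : R => \int[mu]_(t in `]-oo, y]) m t) x 1 /\
    derive1 (fun y : R => \int[mu]_(t in `]-oo, y]) m t) x = m x.
  exact: (@continuous_FTC1 _ m -oo%O x (x + 1) xx1 (integrable_itvNy (x + 1) im) (ltNyr x) (cm x)).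
by move=> df e; apply: DeriveDef; [exact: df|rewrite -derive1E e].
Qed.

(** The primitive from minus infinity is monotone between two zeros, so it is
    constant and its derivative vanishes. *)
Lemma continuous_ge0_integral_eq0 m : continuous m -> (forall x, 0 <= m x) ->
  mu.-integrable [set: RT] (EFin \o m) -> \int[mu]_x m x = 0 ->
  forall x, m x = 0.
Proof.
move=> cm m0 im im0 x.
have F0 : (fun y : R => \int[mu]_(t in `]-oo, y]) m t) = cst 0.
  apply/funext => y; apply/eqP; rewrite eq_le; apply/andP; split.
    rewrite /= -im0 /Rintegral fine_le//.
    - by apply: integrable_fin_num => //; exact: integrable_itvNy.
    - exact: integrable_fin_num.
    - apply: ge0_subset_integral => //.
      + by have /integrableP[] := im.
      + by move=> t _; rewrite lee_fin.
  by apply: Rintegral_ge0 => t _.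
have [_ ] := continuous_antiderivative cm im x.
by rewrite F0 derive_cst => <-.
Qed.

(** A continuous weight that is positive exactly on the interval from [a] to [b];
    it localizes functions that are continuous on [0, 1] only. *)
Definition bump a b x : R := Num.max 0 (x - a) * Num.max 0 (b - x).

Lemma bump_ge0 a b x : 0 <= bump a b x.
Proof. by rewrite mulr_ge0// le_max lexx. Qed.

Lemma bump_gt0 a b x : a < x < b -> 0 < bump a b x.
Proof. by move=> /andP[ax xb]; rewrite mulr_gt0// lt_max subr_gt0 ?ax ?xb orbT. Qed.

Lemma bump_le a b x : x <= a -> bump a b x = 0.
Proof. by move=> xa; rewrite /bump max_l ?mul0r// subr_le0. Qed.

Lemma bump_ge a b x : b <= x -> bump a b x = 0.
Proof. by move=> xb; rewrite /bump (@max_l _ _ 0 (b - x)) ?mulr0// subr_le0. Qed.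

Lemma bump_continuous a b : continuous (bump a b).
Proof.
move=> x; apply: (@continuousM _ _ (fun x => Num.max 0 (x - a))
  (fun x => Num.max 0 (b - x))).
  by apply: continuous_max; [exact: cvg_cst|apply: cvgB; [exact: cvg_id|exact: cvg_cst]].
by apply: continuous_max; [exact: cvg_cst|apply: cvgB; [exact: cvg_cst|exact: cvg_id]].
Qed.

Section Cutoff.
Variables (a b : R).
Hypotheses (a0 : 0 < a) (b1 : b < 1).

Lemma cutoff_continuous g : {within @I01 R, continuous g} ->
  continuous (fun x => g x * bump a b x).
Proof.
move=> cg x.
have [x0|x0] := leP x 0.
  apply: (@cvg_trans _ ((cst (0 : R)) @ x)).
    apply: near_eq_cvg; near=> y; rewrite /= bump_le ?mulr0//.
    by near: y; apply: lt_le_nbhsl; rewrite (le_lt_trans x0).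
  rewrite bump_le ?mulr0 ?(ltW (le_lt_trans x0 a0))//.
  exact: (@cst_continuous R R (0 : R) x).
have [x1|x1] := leP 1 x.
  apply: (@cvg_trans _ ((cst (0 : R)) @ x)).
    apply: near_eq_cvg; near=> y; rewrite /= bump_ge ?mulr0//.
    by apply: ltW; near: y; apply: lt_nbhsr; rewrite (lt_le_trans b1).
  by rewrite bump_ge ?mulr0 ?(ltW (lt_le_trans b1 x1))//; exact: (@cst_continuous R R (0 : R) x).
apply: (@continuousM _ _ g (bump a b)); last exact: bump_continuous.
by apply: (within_continuous_continuous ltr01 cg); rewrite in_itv /= x0.
Unshelve. all: by end_near. Qed.

Lemma cutoff_restrict g : (fun x => g x * bump a b x) \_ D =
  (fun x => g x * bump a b x).
Proof.
apply/funext => x; rewrite /patch; case: ifPn => //; rewrite notin_setE /D /= in_itv /=.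
move=> /negP; rewrite negb_and -!leNgt => /orP[x0|x1].
  by rewrite bump_le ?mulr0// (ltW (le_lt_trans x0 a0)).
by rewrite bump_ge ?mulr0// (ltW (lt_le_trans b1 x1)).
Qed.

Lemma cutoff_integral g : \int[mu]_x (g x * bump a b x) = ip g (bump a b).
Proof. by rewrite /ip [RHS]Rintegral_mkcond cutoff_restrict. Qed.

Lemma cutoff_integrable g : {within @I01 R, continuous g} ->
  mu.-integrable [set: RT] (EFin \o (fun x => g x * bump a b x)).
Proof.
move=> cg; have i : L1 (fun x => g x * bump a b x).
  apply: (L2_L1); apply: continuous_L2; apply: continuous_subspaceT.
  exact: cutoff_continuous.
rewrite -cutoff_restrict -restrict_EFin.
by apply/(integrable_mkcond _ (@measurable_D R)).1.
Qed.

End Cutoff.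

(** Let [c] be the mean of [z] for the weight [bump a b]. Then [(z - c) * bump a b]
    has integral 0, so it is the derivative of a test function [phi], and
    orthogonality to [phi'] gives that [(z - c)^2] has integral 0 for the weight.
    Hence [z = c] on the interval from [a] to [b]. *)
Lemma orthogonal_to_derivatives z : {within @I01 R, continuous z} ->
  (forall phi, test_function phi -> ip z (derive1 phi) = 0) ->
  forall p q, 0 < p -> p < q -> q < 1 -> z p = z q.
Proof.
move=> cz oz p q p0 pq q1.
pose a := p / 2; pose b := (1 + q) / 2.
have a0 : 0 < a by rewrite /a; lra.
have b1 : b < 1 by rewrite /b; lra.
have pab : a < p < b by rewrite /a /b; apply/andP; split; lra.
have qab : a < q < b by rewrite /a /b; apply/andP; split; lra.
pose e := bump a b; pose o : R -> R := cst 1.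
have co : {within @I01 R, continuous o} by apply: continuous_subspaceT => x; exact: cst_continuous.
have ce : {within @I01 R, continuous e} by apply: continuous_subspaceT; exact: bump_continuous.
have Lz := continuous_L2 cz; have Lo := continuous_L2 co; have Le := continuous_L2 ce.
have e_neq0 : ip o e != 0.
  apply/eqP => oe0.
  have oge0 x : 0 <= o x * bump a b x by rewrite mulr_ge0 ?ler01// bump_ge0.
  have := continuous_ge0_integral_eq0 (cutoff_continuous a0 b1 co) oge0
    (cutoff_integrable a0 b1 co).
  rewrite cutoff_integral// => /(_ oe0 p)/eqP.
  by rewrite mul1r gt_eqF// bump_gt0.
pose c := ip z e / ip o e.
pose g x := 1 * z x + (- c) * o x.
have cg : {within @I01 R, continuous g}.
  move=> x; apply: (@continuousD _ _ (subspace (@I01 R)) (fun x => 1 * z x) (fun x => - c * o x)).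
    by apply: continuousM; [exact: cst_continuous|exact: cz].
  by apply: continuousM; [exact: cst_continuous|exact: co].
have Lg := continuous_L2 cg.
have ge0 : ip g e = 0 by rewrite ip_linl// mul1r mulNr divfK ?subrr.
pose f x := g x * bump a b x.
have cf : continuous f by exact: cutoff_continuous.
have if_ := cutoff_integrable a0 b1 cg.
have f_le x : x <= a -> f x = 0 by move=> xa; rewrite /f bump_le ?mulr0.
have f_ge x : b <= x -> f x = 0 by move=> xb; rewrite /f bump_ge ?mulr0.
have Lf : L2 f by apply: continuous_L2; exact: continuous_subspaceT.
pose phi (y : R) := \int[mu]_(t in `]-oo, y]) f t.
have dphi x : is_derive x 1 phi (f x) by exact: continuous_antiderivative.
have phi_le y : y <= a -> phi y = 0.
  move=> ya; transitivity (\int[mu]_(t in `]-oo, y]) (0 : R)).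
    apply: eq_Rintegral => t; rewrite inE /= in_itv /= => ty.
    by rewrite f_le// (le_trans ty).
  by rewrite Rintegral_cst ?mul0r//; exact: measurable_itvR.
have phi_ge y : b <= y -> phi y = 0.
  move=> yb; rewrite /phi Rintegral_mkcond -[RHS]ge0 -cutoff_integral//.
  apply: eq_Rintegral => t _; rewrite /patch; case: ifPn => //.
  rewrite notin_setE /= in_itv /= => /negP; rewrite -ltNge => yt.
  by rewrite -/(f t) f_ge// (le_trans yb)// ltW.
have dphiE : derive1 phi = f.
  by apply/funext => x; rewrite derive1E; have [_ ->] := dphi x.
have tphi : test_function phi.
  split; first by move=> x; have [] := dphi x.
    by rewrite dphiE.
  apply: (@subset_trans _ `[a, b]%classic).
    rewrite [X in _ `<=` X](closure_id _).1; last exact: interval_closed.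
    apply: closureS => x /= phix; rewrite in_itv /=; apply/andP; split.
      by rewrite leNgt; apply: contra phix => /ltW/phi_le ->.
    by rewrite leNgt; apply: contra phix => /ltW/phi_ge ->.
  by apply: subset_itv; rewrite bnd_simp.
have zf : ip z f = 0 by rewrite -(oz phi tphi) dphiE.
have of0 : ip o f = 0.
  by rewrite -[RHS]ge0; apply: eq_Rintegral => x _; rewrite mul1r.
have gf : ip g f = 0 by rewrite ip_linl// zf of0 !mulr0 addr0.
pose g2 x := g x * g x.
have cg2 : {within @I01 R, continuous g2}.
  by move=> x; apply: (@continuousM _ (subspace (@I01 R)) g g); exact: cg.
have g2ge0 x : 0 <= g2 x * bump a b x.
  by rewrite mulr_ge0 ?bump_ge0// /g2 -expr2 sqr_ge0.
have g2f : ip g2 e = 0.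
  by rewrite -[RHS]gf; apply: eq_Rintegral => x _; rewrite /g2 /f -mulrA.
have := continuous_ge0_integral_eq0 (cutoff_continuous a0 b1 cg2) g2ge0
  (cutoff_integrable a0 b1 cg2).
rewrite cutoff_integral// => /(_ g2f) key.
have g0 x : a < x < b -> z x = c.
  move=> xab; have /eqP := key x.
  rewrite mulf_eq0 (gt_eqF (bump_gt0 xab)) orbF /g2 mulf_eq0 orbb => /eqP.
  by rewrite /g /o /= mulr1 mul1r => /eqP; rewrite subr_eq0 => /eqP.
by rewrite !g0.
Qed.

Lemma constant_on_I01 z k : {within @I01 R, continuous z} ->
  (forall x, 0 < x < 1 -> z x = k) -> forall x, 0 <= x <= 1 -> z x = k.
Proof.
move=> /(continuous_within_itvP _ ltr01)[_ z0 z1] zk x /andP[].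
rewrite le_eqVlt => /predU1P[<- _|x0].
  apply: (cvg_unique _ z0) => //; apply: cvg_near_cst; near=> y.
  by apply: zk; apply/andP; split; near: y; [exact: nbhs_right_gt|exact: nbhs_right_lt].
rewrite le_eqVlt => /predU1P[->|x1]; last by rewrite zk// x0.
apply: (cvg_unique _ z1) => //; apply: cvg_near_cst; near=> y.
by apply: zk; apply/andP; split; near: y; [exact: nbhs_left_gt|exact: nbhs_left_lt].
Unshelve. all: by end_near. Qed.

(** The lemma of du Bois-Reymond: [v] minus the primitive of its weak derivative
    is orthogonal to all derivatives of test functions. *)
Lemma weak_AC v w : {within @I01 R, continuous v} -> L2 w ->
  is_weak_deriv v w -> AC01 v w.
Proof.
move=> cv Lw vw.
pose W (x : R) := \int[mu]_(y in `]0, x[) w y.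
have W0 : W 0 = 0 by rewrite /W set_itvoo0 Rintegral_set0.
have hW : AC01 W w by split; [exact: L2_L1|move=> x _; rewrite W0 add0r].
have cW := AC_continuous hW.
pose z x := v x - W x.
have cz : {within @I01 R, continuous z}.
  by move=> x; apply: (@continuousB _ _ (subspace (@I01 R)) v W); [exact: cv|exact: cW].
have oz phi : test_function phi -> ip z (derive1 phi) = 0.
  move=> tphi; have [_ cphi _] := tphi.
  have Lphi : L2 (derive1 phi) by apply: continuous_L2; exact: continuous_subspaceT.
  rewrite ipBl//; [|exact: continuous_L2|exact: continuous_L2].
  by rewrite vw// (AC_weak hW)// subrr.
have zk x : 0 < x < 1 -> z x = z (1 / 2).
  move=> /andP[x0 x1]; have O := orthogonal_to_derivatives cz oz.
  by have [xh|xh|->//] := ltgtP x (1 / 2); [|symmetry]; apply: O => //; lra.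
have {}zk := constant_on_I01 cz zk.
split; first exact: L2_L1.
move=> x x01; have := zk x x01; rewrite -(zk 0) ?lexx ?ler01//.
by rewrite /z W0 subr0 => /eqP; rewrite subr_eq => /eqP.
Qed.

(** The difference of two weak derivatives is a weak derivative of 0, hence a
    density of 0 by [weak_AC]. *)
Lemma weak_deriv_unique v w1 w2 : L2 w1 -> L2 w2 ->
  is_weak_deriv v w1 -> is_weak_deriv v w2 -> ae_eq mu D w1 w2.
Proof.
move=> L1' L2' h1 h2.
have c0 : {within @I01 R, continuous (cst (0 : R))}.
  by apply: continuous_subspaceT => x; exact: cst_continuous.
pose z x := w1 x - w2 x.
have hz : AC01 (cst 0) z.
  apply: weak_AC => //; first exact: L2B.
  move=> phi tphi; have [hphi _ _] := test_function_AC tphi.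
  rewrite ipBl//; last exact: AC_L2 hphi.
  have := h1 phi tphi; rewrite (h2 phi tphi) => /eqP; rewrite eqr_opp => /eqP ->.
  rewrite subrr oppr0 /ip; under eq_Rintegral do rewrite mul0r.
  by rewrite Rintegral_cst ?mul0r//; exact: measurable_D.
have h0 : AC01 (cst 0) (fun=> 0 : R).
  by have := ACB hz hz; congr AC01; apply/funext => x; rewrite ?subrr.
have := AC_unique hz h0; apply: filterS => x /[apply] /eqP.
by rewrite subr_eq0 => /eqP.
Qed.

End DuBoisReymond.

(** * Sobolev norms and energy forms of functions with explicit derivatives *)

Section WeakDerivativesOfAC.
Variable R : realType.
Implicit Types (v w phi : R -> R) (d e : nat -> R -> R).

Local Notation mu := (@lebesgue_measure R).
Local Notation D := (@D R).

Lemma L2_test_derive phi : test_function phi -> L2 (derive1 phi).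
Proof.
by move=> [_ cphi _]; apply: continuous_L2; exact: continuous_subspaceT.
Qed.

Lemma ae_ip_l v v' w : L2 v -> L2 v' -> L2 w -> ae_eq mu D v v' -> ip v w = ip v' w.
Proof.
by move=> [mv _] [mv' _] [mw _] e; apply: ae_ip => //; exact: ae_eq_refl.
Qed.

Lemma ae_ip_L2 v v' w w' : L2 v -> L2 v' -> L2 w -> L2 w' ->
  ae_eq mu D v v' -> ae_eq mu D w w' -> ip v w = ip v' w'.
Proof. by move=> [mv _] [mv' _] [mw _] [mw' _] e1 e2; apply: ae_ip. Qed.

(** The set from which [wderiv] chooses depends on the function only through
    integrals, so even the chosen derivatives are the same. *)
Lemma ae_wderiv v v' : L2 v -> L2 v' -> ae_eq mu D v v' -> wderiv v = wderiv v'.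
Proof.
move=> Lv Lv' e; rewrite /wderiv; congr xget; apply/funext => w; apply/propext.
by split=> -[Lw h]; split=> // phi tphi; rewrite -h//; [symmetry|];
  apply: ae_ip_l => //; exact: L2_test_derive.
Qed.

Lemma wderiv_AC v w : AC01 v w -> L2 w ->
  [/\ L2 (wderiv v), is_weak_deriv v (wderiv v) & ae_eq mu D (wderiv v) w].
Proof.
move=> vw Lw; have ww := AC_weak vw.
have [Lx wx] : L2 (wderiv v) /\ is_weak_deriv v (wderiv v).
  exact: (@xgetPex _ (fun=> 0) [set w | L2 w /\ is_weak_deriv v w] (ex_intro _ w (conj Lw ww))).
by split=> //; exact: weak_deriv_unique wx ww.
Qed.

(** The entry [d l] is the derivative of order [l] of [d 0]. *)
Definition AC_chain n d : Prop :=
  (forall l, (l < n)%N -> AC01 (d l) (d l.+1)) /\ L2 (d n).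

Lemma AC_chain_L2 n d l : AC_chain n d -> (l <= n)%N -> L2 (d l).
Proof.
move=> [hd Ln]; rewrite leq_eqVlt => /predU1P[->//|ln].
exact: AC_L2 (hd l ln).
Qed.

(** Iterated weak derivatives may be exchanged for the entries of the chain, since
    by [ae_wderiv] a modification on a null set does not affect the next one. *)
Lemma AC_chain_wderiv n d l : AC_chain n d -> (l <= n)%N ->
  L2 (iter l (@wderiv R) (d 0%N)) /\ ae_eq mu D (iter l (@wderiv R) (d 0%N)) (d l).
Proof.
move=> hd; elim: l => [_|l IHl ln].
  by split; [exact: AC_chain_L2 hd _|exact: ae_eq_refl].
have [Ll el] := IHl (ltnW ln).
rewrite iterS (ae_wderiv Ll (AC_chain_L2 hd (ltnW ln)) el).
by have [Lw _ ew] := wderiv_AC (hd.1 l ln) (AC_chain_L2 hd ln).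
Qed.

Lemma AC_chain_Hs n d : AC_chain n d -> Hs n (d 0%N).
Proof.
move=> hd; split; first exact: AC_chain_L2 hd _.
move=> l ln; have [Ll el] := AC_chain_wderiv hd (ltnW ln).
have L1l := AC_chain_L2 hd (ltnW ln).
have [Lw ww ew] := wderiv_AC (hd.1 l ln) (AC_chain_L2 hd ln).
rewrite iterS (ae_wderiv Ll L1l el); split => // phi tphi.
by rewrite -ww//; apply: ae_ip_l => //; exact: L2_test_derive.
Qed.

Lemma AC_chain_HH n d : (0 < n)%N -> AC_chain n d -> d 0%N 0 = 0 -> HH n (d 0%N).
Proof.
by move=> n0 hd d0; split; [exact: AC_chain_Hs|exact: AC_continuous (hd.1 _ n0)|].
Qed.

Lemma AC_chain_Hnorm n d : AC_chain n d ->
  Hnorm n (d 0%N) ^+ 2 = \sum_(l < n.+1) ip (d l) (d l).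
Proof.
move=> hd; rewrite /Hnorm sqr_sqrtr; last first.
  by apply: sumr_ge0 => i _; exact: sqr_ge0.
apply: eq_bigr => l _; rewrite L2norm_sqr.
have ln : (l <= n)%N by rewrite -ltnS.
have [Ll el] := AC_chain_wderiv hd ln.
by apply: ae_ip_L2 => //; exact: AC_chain_L2 hd ln.
Qed.

Lemma Hnorm_ge0 n v : 0 <= Hnorm n v.
Proof. exact: sqrtr_ge0. Qed.

Lemma AC_B v v1 w w1 : AC01 v v1 -> L2 v1 -> AC01 w w1 -> L2 w1 ->
  B v w = ip v1 w1.
Proof.
move=> vv Lv ww Lw; have [? _ ?] := wderiv_AC vv Lv; have [? _ ?] := wderiv_AC ww Lw.
exact: ae_ip_L2.
Qed.

(** The case of order 2, with the derivatives listed as arguments. *)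
Definition H2_derivs v v1 v2 : Prop := [/\ AC01 v v1, AC01 v1 v2 & L2 v2].

Definition list3 v0 v1 v2 : nat -> R -> R :=
  fun l => match l with 0%N => v0 | 1%N => v1 | _ => v2 end.

Lemma H2_derivs_chain v v1 v2 : H2_derivs v v1 v2 -> AC_chain 2 (list3 v v1 v2).
Proof. by move=> [h1 h2 L]; split=> // -[|[|]]. Qed.

Lemma H2_derivs_L2 v v1 v2 : H2_derivs v v1 v2 -> [/\ L2 v, L2 v1 & L2 v2].
Proof. by move=> [h1 h2 L]; split=> //; [exact: AC_L2 h1|exact: AC_L2 h2]. Qed.

Lemma H2_derivs_lin a b v v1 v2 w w1 w2 :
  H2_derivs v v1 v2 -> H2_derivs w w1 w2 ->
  H2_derivs (fun x => a * v x + b * w x) (fun x => a * v1 x + b * w1 x)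
            (fun x => a * v2 x + b * w2 x).
Proof.
by move=> [v01 v12 Lv] [w01 w12 Lw]; split; [exact: AC_lin|exact: AC_lin|exact: L2_lin].
Qed.

Lemma H2_derivs_B v v1 v2 w w1 w2 :
  H2_derivs v v1 v2 -> H2_derivs w w1 w2 -> B v w = ip v1 w1.
Proof.
by move=> [v01 v12 _] [w01 w12 _]; apply: AC_B => //; [exact: AC_L2 v12|exact: AC_L2 w12].
Qed.

Lemma H2_derivs_Bstar v v1 v2 w w1 w2 :
  H2_derivs v v1 v2 -> H2_derivs w w1 w2 -> Bstar v w = ip v2 w2.
Proof.
move=> hv hw; have [_ _ Lv] := hv; have [_ _ Lw] := hw.
have [Lv' ev] := AC_chain_wderiv (H2_derivs_chain hv) (leqnn 2).
have [Lw' ew] := AC_chain_wderiv (H2_derivs_chain hw) (leqnn 2).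
exact: (ae_ip_L2 Lv' Lv Lw' Lw ev ew).
Qed.

Lemma H2_derivs_gammastar v v1 v2 w w1 w2 :
  H2_derivs v v1 v2 -> H2_derivs w w1 w2 -> gammastar v w = ip v2 w2 + ip v1 w1.
Proof.
by move=> hv hw; rewrite /gammastar (H2_derivs_B hv hw) (H2_derivs_Bstar hv hw).
Qed.

Lemma H2_derivs_Hnorm v v1 v2 : H2_derivs v v1 v2 ->
  Hnorm 2 v ^+ 2 = ip v v + ip v1 v1 + ip v2 v2.
Proof.
move=> /H2_derivs_chain/AC_chain_Hnorm -> /=.
by rewrite !big_ord_recr big_ord0 /= add0r.
Qed.

Lemma AC_Hnorm1 v v1 : AC01 v v1 -> L2 v1 -> Hnorm 1 v ^+ 2 = ip v v + ip v1 v1.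
Proof.
move=> h L; have c : AC_chain 1 (list3 v v1 v1) by split=> // -[|].
by rewrite (AC_chain_Hnorm c) !big_ord_recr big_ord0 /= add0r.
Qed.

End WeakDerivativesOfAC.

(** * One-sided derivatives *)

Section OneSidedDerivatives.
Variable R : realType.
Implicit Types (f g : R -> R) (a b x l : R).

Lemma near_within_dnbhsP (A : set R) x (P : R -> Prop) :
  (\forall y \near within A x^', P y) <->
  exists2 e, 0 < e & forall y, A y -> y != x -> `|y - x| < e -> P y.
Proof.
split.
  move=> /nbhs_ballP[e /= e0 h]; exists e => // y Ay yx yxe; apply: h => //.
  by rewrite /ball /= distrC.
move=> [e e0 h]; apply/nbhs_ballP; exists e => //= y.
rewrite /ball /= distrC => yxe yx Ay; exact: h.
Qed.

Lemma cvg_within_dnbhsP (A : set R) x f l :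
  f y @[y --> within A x^'] --> l <->
  forall k, 0 < k -> exists2 e, 0 < e &
    forall y, A y -> y != x -> `|y - x| < e -> `|f y - l| < k.
Proof.
split.
  move=> /cvgrPdist_lt h k k0; have /near_within_dnbhsP[e e0 he] := h k k0.
  by exists e => // y Ay yx yxe; rewrite distrC he.
move=> h; apply/cvgrPdist_lt => k k0; apply/near_within_dnbhsP.
by have [e e0 he] := h k k0; exists e => // y Ay yx yxe; rewrite distrC he.
Qed.

Lemma derivable_inP (A : set R) f x : derivable_in A f x ->
  forall k, 0 < k -> exists2 e, 0 < e & forall y, A y -> y != x ->
    `|y - x| < e -> `|(f y - f x) / (y - x) - deriv_in A f x| < k.
Proof. by move=> /cvg_within_dnbhsP. Qed.

(** Also at the ends of the interval there are points to approach from, so the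
    limits that define [deriv_in] are unique. *)
Lemma within_itv_dnbhs_proper a b x : a < b -> a <= x <= b ->
  ProperFilter (within `[a, b] x^').
Proof.
move=> ab /andP[ax xb]; apply: Build_ProperFilter_ex => P.
move=> /near_within_dnbhsP[e e0 h].
have [xb'|bx] := ltP x b.
  exists (Num.min b (x + e / 2)); apply: h.
  - by rewrite /= in_itv /= le_min ge_min lexx (le_trans ax xb) /= andbT;
      rewrite (le_trans ax)// lerDl divr_ge0 // ltW.
  - by rewrite gt_eqF// lt_min xb' ltrDl divr_gt0.
  - rewrite ger0_norm; last by rewrite subr_ge0 le_min xb lerDl divr_ge0// ltW.
    by rewrite ltrBlDl gt_min; apply/orP; right; lra.
have xE : x = b by apply/eqP; rewrite eq_le xb.
exists (Num.max a (x - e / 2)); apply: h.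
- by rewrite /= in_itv /= ge_max le_max lexx (ltW ab) /=; lra.
- by rewrite lt_eqF// gt_max xE ab /=; lra.
- rewrite ler0_norm; last by rewrite subr_le0 ge_max ax; lra.
  by rewrite opprB ltrBlDl -ltrBlDr lt_max; apply/orP; right; lra.
Qed.

Lemma deriv_in_unique a b f x l : a < b -> a <= x <= b ->
  (forall k, 0 < k -> exists2 e, 0 < e & forall y, `[a, b]%classic y ->
     y != x -> `|y - x| < e -> `|(f y - f x) / (y - x) - l| < k) ->
  derivable_in `[a, b] f x /\ deriv_in `[a, b] f x = l.
Proof.
move=> ab xab /cvg_within_dnbhsP h; have PF := within_itv_dnbhs_proper ab xab.
by split; [exact: cvgP h|exact: cvg_lim h].
Qed.

Lemma eq_deriv_in (A : set R) f g x : A x -> {in A, f =1 g} ->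
  (derivable_in A f x -> derivable_in A g x) /\ deriv_in A f x = deriv_in A g x.
Proof.
move=> Ax fg.
have e : (f y - f x) / (y - x) @[y --> within A x^'] =
         (g y - g x) / (y - x) @[y --> within A x^'].
  apply/seteqP; split=> P /near_within_dnbhsP[e e0 h];
    apply/near_within_dnbhsP; exists e => // y Ay yx yxe;
    by have := h y Ay yx yxe; rewrite /= !fg ?inE.
by rewrite /derivable_in /deriv_in e.
Qed.

Lemma derivable_in_continuous (A : set R) f x : derivable_in A f x ->
  forall k, 0 < k -> exists2 e, 0 < e & forall y, A y -> `|y - x| < e ->
    `|f y - f x| < k.
Proof.
move=> /derivable_inP h k k0; have [e e0 he] := h 1 ltr01.
pose M := `|deriv_in A f x| + 1.
have M0 : 0 < M by rewrite ltr_wpDl.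
exists (Num.min e (k / M)); first by rewrite lt_min e0 divr_gt0.
move=> y Ay; rewrite lt_min => /andP[yxe yxk].
have [->|yx] := eqVneq y x; first by rewrite subrr normr0.
have yx0 : y - x != 0 by rewrite subr_eq0.
have : `|(f y - f x) / (y - x)| < M.
  rewrite -[X in `|X|](subrK (deriv_in A f x)) (le_lt_trans (ler_normD _ _))//.
  by rewrite /M addrC ltrD2l he.
rewrite normrM normfV ltr_pdivrMr ?normr_gt0// => lt1.
by rewrite (lt_trans lt1)// mulrC -ltr_pdivlMr.
Qed.

Lemma within_continuousP (A : set R) f :
  {within A, continuous f} <->
  forall x, A x -> forall k, 0 < k -> exists2 e, 0 < e & forall y, A y ->
    `|y - x| < e -> `|f y - f x| < k.
Proof.
split.
  move=> /subspace_continuousP h x Ax k k0.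
  have /cvgrPdist_lt/(_ k k0)/nbhs_ballP[e /= e0 he] := h x Ax.
  exists e => // y Ay yx; rewrite distrC; apply: he => //.
  by rewrite /ball /= distrC.
move=> h; apply/subspace_continuousP => x Ax; apply/cvgrPdist_lt => k k0.
have [e e0 he] := h x Ax k k0; apply/nbhs_ballP; exists e => //= y.
by rewrite /ball /= distrC => yxe Ay; rewrite distrC he.
Qed.

Lemma derivable_in_within (A : set R) f :
  (forall x, A x -> derivable_in A f x) -> {within A, continuous f}.
Proof.
move=> h; apply/within_continuousP => x Ax; exact/derivable_in_continuous/h.
Qed.

Lemma is_derive_eps f x l :
  (forall k, 0 < k -> exists2 e, 0 < e & forall y, y != x -> `|y - x| < e ->
     `|(f y - f x) / (y - x) - l| < k) -> is_derive x 1 f l.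
Proof.
move=> h.
have c : h^-1 *: ((f \o shift x) (h *: (1 : R)) - f x) @[h --> 0^'] --> l.
  apply/cvgrPdist_lt => k k0; have [e e0 he] := h k k0.
  apply/nbhs_ballP; exists e => //= t; rewrite /ball /= sub0r normrN => te t0.
  have := he (t + x); rewrite addrK -subr_eq0 addrK => /(_ t0 te).
  by rewrite distrC /= mulrC /GRing.scale /= mulr1.
by apply: DeriveDef; [exact: cvgP c|exact: cvg_lim c].
Qed.

Lemma deriv_in_is_derive a b f x : a < x < b -> derivable_in `[a, b] f x ->
  is_derive x 1 f (deriv_in `[a, b] f x).
Proof.
move=> /andP[ax xb] /derivable_inP h; apply: is_derive_eps => k k0.
have [e e0 he] := h k k0.
exists (Num.min e (Num.min (x - a) (b - x))).
  by rewrite !lt_min e0 !subr_gt0 ax.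
move=> y yx; rewrite !lt_min => /and3P[ye].
move=> /ltr_normlP[y3 y4] /ltr_normlP[y5 y6]; apply: he => //.
by rewrite /= in_itv /=; apply/andP; split; lra.
Qed.

Lemma AC_deriv_in f : C1_I01 f -> AC01 f (deriv_in (@I01 R) f).
Proof.
move=> [df cf]; apply: AC_classical => //; first exact: derivable_in_within.
move=> x x01; apply: deriv_in_is_derive => //; apply: df.
by case/andP: x01 => ? ?; rewrite /I01 /= in_itv /= !ltW.
Qed.

(** The classical derivative is a continuous representative of the first weak
    derivative, so [weak_AC] makes the second weak derivative its density. *)
Lemma HH2_C1_derivs v : HH 2 v -> C1_I01 v ->
  H2_derivs v (deriv_in (@I01 R) v) (iter 2 (@wderiv R) v).
Proof.
move=> [[Lv hv] _ _] C1v; have h1 := AC_deriv_in C1v; have [_ c1] := C1v.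
have [L1v _] := hv 0%N isT; have [L2v w2] := hv 1%N isT.
have L1 := continuous_L2 c1; have [Lw _ e] := wderiv_AC h1 L1.
split=> //; apply: weak_AC => // phi tphi; rewrite -w2//.
by apply: ae_ip_l => //; [exact: L2_test_derive|exact: ae_eq_sym].
Qed.

End OneSidedDerivatives.

(** * Poincare, Sobolev and trace inequalities *)

Section Inequalities.
Variable R : realType.
Implicit Types (v w z : R -> R) (a b c k x : R).

Local Notation mu := (@lebesgue_measure R).
Local Notation D := (@D R).

Lemma L2_sqr_L1 v : L2 v -> L1 (fun x => v x * v x).
Proof. by move=> L; exact: L2_mul_integrable. Qed.

Lemma ip_le v w : L2 v -> L2 w -> (forall x, 0 < x < 1 -> v x ^+ 2 <= w x ^+ 2) ->
  ip v v <= ip w w.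
Proof.
move=> Lv Lw vw; rewrite /ip; apply: le_Rintegral.
- exact: measurable_D.
- exact: L2_sqr_L1.
- exact: L2_sqr_L1.
- by move=> x; rewrite /D /= in_itv /= => /vw; rewrite !expr2.
Qed.

Lemma ip_cst c : ip (fun=> c) (fun=> c) = c ^+ 2 :> R.
Proof.
rewrite /ip Rintegral_cst; last exact: measurable_D.
rewrite [X in fine X](_ : _ = 1%:E); last exact: measure_D.
by rewrite mulr1 expr2.
Qed.

Lemma ip_bounded c v : L2 v -> (forall x, 0 < x < 1 -> v x ^+ 2 <= c ^+ 2) ->
  ip v v <= c ^+ 2.
Proof. by move=> Lv vc; rewrite -ip_cst; apply: ip_le => //; exact: L2_cst. Qed.

Lemma L2_norm v : L2 v -> L2 (fun x => `|v x|).
Proof.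
move=> [mv iv]; split; first exact: measurableT_comp.
by move: iv; congr integrable; apply/funext => x /=; rewrite real_normK ?num_real.
Qed.

Lemma ip_norm v : ip (fun x => `|v x|) (fun x => `|v x|) = ip v v.
Proof.
by apply: eq_Rintegral => x _; rewrite -expr2 real_normK ?num_real// expr2.
Qed.

(** Cauchy-Schwarz for the increment of [v] over [0, x]; integrated in [x], it is
    the inequality of Poincare. *)
Lemma AC_sup v w x : AC01 v w -> L2 w -> v 0 = 0 -> 0 <= x <= 1 ->
  v x ^+ 2 <= ip w w.
Proof.
move=> [iw ev] Lw v0 x01; have /andP[x0 x1] := x01.
have Ln := L2_norm Lw; have L1' := L2_cst (1 : R).
have h : `|v x| <= ip (fun y => `|w y|) (fun=> 1).
  rewrite (ev x x01) v0 add0r.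
  apply: (le_trans (le_normr_Rintegral (measurable_itvR `]0, x[) (L1_itv iw x1))).
  rewrite /ip /Rintegral; apply: fine_le.
  - by apply: integrable_fin_num => //; exact: (L1_itv (L2_L1 Ln) x1).
  - by apply: integrable_fin_num; [exact: measurable_D|exact: L2_mul_integrable].
  - under [leRHS]eq_integral do rewrite mulr1.
    apply: ge0_subset_integral => //; last exact: itv0x_sub.
      exact: measurable_D.
    by have [/measurable_EFinP mn _] := Ln; exact: mn.
have := ip_CauchySchwarz Ln L1'.
rewrite ip_norm ip_cst expr1n mulr1 => le2; apply: le_trans le2.
by rewrite -[leLHS]real_normK ?num_real// lerXn2r// nnegrE (le_trans _ h).
Qed.

Lemma ip_poincare v w : AC01 v w -> L2 w -> v 0 = 0 -> ip v v <= ip w w.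
Proof.
move=> vw Lw v0; rewrite -[leRHS]sqr_sqrtr ?ip_ge0//.
apply: ip_bounded; first exact: AC_L2 vw.
move=> x /andP[x0 x1]; rewrite sqr_sqrtr ?ip_ge0//.
by apply: AC_sup => //; rewrite !ltW.
Qed.

Lemma AC_cst c : AC01 (fun=> c) (fun=> 0 : R).
Proof.
split; first exact/L2_L1/L2_cst.
by move=> x _; rewrite Rintegral_cst ?mul0r ?addr0//; exact: measurable_itvR.
Qed.

Lemma AC_id : AC01 (fun x : R => x) (fun=> 1).
Proof.
apply: AC_classical.
- by apply: continuous_subspaceT => x; exact: cvg_id.
- by apply: continuous_subspaceT => x; exact: cst_continuous.
Qed.

Lemma AC_primitive w : L1 w -> AC01 (fun x => \int[mu]_(y in `]0, x[) w y) w.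
Proof.
move=> iw; split=> // x _.
by rewrite (_ : `]0, 0[%classic = set0) ?set_itvoo0// Rintegral_set0 add0r.
Qed.

Lemma AC_by_parts v v1 w w1 : AC01 v v1 -> AC01 w w1 -> L2 v1 -> L2 w1 ->
  ip v1 w + ip v w1 = v 1 * w 1 - v 0 * w 0.
Proof.
move=> hv hw L1' L2'; rewrite -(AC_integral (AC_mul hv hw)) RintegralD//.
- exact: measurable_D.
- exact: L1_mul_continuous hv.1 (AC_continuous hw).
- by apply: L2_mul_integrable => //; exact: AC_L2 hv.
Qed.

Lemma L2_mul_continuous v w : L2 v -> {within @I01 R, continuous w} ->
  L2 (fun x => w x * v x).
Proof.
move=> Lv cw; have [mv iv] := Lv; have [mw _] := continuous_L2 cw.
have [M M0 hM] := itv_continuous_bounded cw.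
split; first exact: measurable_funM.
apply: (le_integrable (mu := mu) (@measurable_D R)
  (f := EFin \o (fun x => (w x * v x) ^+ 2)) (g := EFin \o (fun x => M ^+ 2 * v x ^+ 2))).
- by apply/measurable_EFinP; apply: measurable_funX; exact: measurable_funM.
- move=> x; rewrite /D /= in_itv /= => /andP[x0 x1].
  rewrite lee_fin ger0_norm ?sqr_ge0// ger0_norm ?(mulr_ge0 (sqr_ge0 _) (sqr_ge0 _))//.
  rewrite exprMn ler_wpM2r ?sqr_ge0// -[leLHS]real_normK ?num_real//.
  by rewrite lerXn2r ?nnegrE// hM// !ltW.
- exact: (integrableZl (mu := mu) (@measurable_D R) (M ^+ 2) iv).
Qed.

(** Integrate the derivative [v ^ 2 + 2 * x * v * w] of [x * v x ^ 2] over [0, 1].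
    The free parameter makes the multiple of [ip w w] as small as desired. *)
Lemma AC_trace v w k : AC01 v w -> L2 w -> 0 < k ->
  v 1 ^+ 2 <= (1 + k^-1) * ip v v + k * ip w w.
Proof.
move=> vw Lw k0; have Lv := AC_L2 vw; have cv := AC_continuous vw.
have cid := AC_continuous AC_id.
pose xv x := x * v x.
have hxv : AC01 xv (fun x => 1 * v x + x * w x) := AC_mul AC_id vw.
have Lxw : L2 (fun x => x * w x) := L2_mul_continuous Lw cid.
have Ld : L2 (fun x => 1 * v x + x * w x).
  by apply: L2D => //; exact: L2Z.
have Lxv := AC_L2 hxv.
have := AC_by_parts hxv vw Ld Lw; rewrite /xv mul1r mul0r mul0r subr0 -expr2 => <-.
rewrite ipDl//; last exact: L2Z.
rewrite ipZl// mul1r.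
have -> : ip (fun x => x * w x) v = ip xv w.
  by apply: eq_Rintegral => x _; rewrite /xv mulrAC.
have y := ip_young k0 Lw Lxv; rewrite (ipC w) in y.
have le1 : ip xv xv <= ip v v.
  apply: ip_le => // x /andP[x0 x1]; rewrite exprMn ler_piMl ?sqr_ge0//.
  by rewrite expr_le1// ltW.
have kl : k^-1 * ip xv xv <= k^-1 * ip v v by rewrite ler_wpM2l// invr_ge0 ltW.
have := ler_norm (ip xv w); rewrite -/xv; lra.
Qed.

End Inequalities.

(** * The elliptic projection *)

Section EllipticProjection.
Variable R : realType.
Implicit Types (v w z rho chi : R -> R) (S : set (R -> R)) (a b c x : R).

Definition in_H2 v : Prop := exists v1 v2, H2_derivs v v1 v2.

Lemma in_H2_lin a b v w : in_H2 v -> in_H2 w -> in_H2 (fun x => a * v x + b * w x).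
Proof.
move=> [v1 [v2 hv]] [w1 [w2 hw]].
by eexists; eexists; exact: H2_derivs_lin hv hw.
Qed.

Lemma H2_derivs0 : H2_derivs (fun=> 0 : R) (fun=> 0) (fun=> 0).
Proof. by split; [exact: AC_cst|exact: AC_cst|exact: L2_cst]. Qed.

Lemma in_H2_sum n (c : 'I_n -> R) (phi : 'I_n -> R -> R) :
  (forall i, in_H2 (phi i)) -> in_H2 (fun x => \sum_(i < n) c i * phi i x).
Proof.
elim: n c phi => [|n IHn] c phi hphi.
  exists (fun=> 0), (fun=> 0); have := H2_derivs0.
  by congr H2_derivs; apply/funext => x; rewrite big_ord0.
have := in_H2_lin 1 (c ord_max) (IHn (fun i => c (widen_ord (leqnSn n) i)) _
  (fun i => hphi (widen_ord (leqnSn n) i))) (hphi ord_max).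
by congr in_H2; apply/funext => x; rewrite big_ord_recr /= mul1r.
Qed.

(** The energy product [gammastar], locked so that unification does not search
    inside the integrals. *)
Definition energy v w : R := locked (@gammastar R) v w.

Lemma energyE v w : energy v w = gammastar v w.
Proof. by rewrite /energy -lock. Qed.

Lemma energyC v w : energy v w = energy w v.
Proof.
rewrite !energyE.
have e1 : B v w = B w v := ipC (wderiv v) (wderiv w).
have e2 : Bstar v w = Bstar w v := ipC (iter 2 (@wderiv R) v) (iter 2 (@wderiv R) w).
by rewrite /gammastar e1 e2.
Qed.

Lemma energy_ge0 v : 0 <= energy v v.
Proof. by rewrite energyE addr_ge0// ip_ge0. Qed.

Lemma H2_derivs_energy v v1 v2 w w1 w2 :
  H2_derivs v v1 v2 -> H2_derivs w w1 w2 -> energy v w = ip v2 w2 + ip v1 w1.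
Proof. by move=> hv hw; rewrite energyE (H2_derivs_gammastar hv hw). Qed.

Lemma energy_linl a b v w z : in_H2 v -> in_H2 w -> in_H2 z ->
  energy (fun x => a * v x + b * w x) z = a * energy v z + b * energy w z.
Proof.
move=> [v1 [v2 hv]] [w1 [w2 hw]] [z1 [z2 hz]].
have [_ ? ?] := H2_derivs_L2 hv; have [_ ? ?] := H2_derivs_L2 hw.
have [_ ? ?] := H2_derivs_L2 hz.
rewrite (H2_derivs_energy (H2_derivs_lin a b hv hw) hz).
rewrite (H2_derivs_energy hv hz) (H2_derivs_energy hw hz).
by rewrite !ip_linl//; ring.
Qed.

Lemma energy_linr a b v w z : in_H2 v -> in_H2 w -> in_H2 z ->
  energy z (fun x => a * v x + b * w x) = a * energy z v + b * energy z w.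
Proof.
move=> hv hw hz; rewrite (energyC z v) (energyC z w) -energy_linl//.
by rewrite energyC.
Qed.

Lemma energy_sumr n (c : 'I_n -> R) (phi : 'I_n -> R -> R) z :
  (forall i, in_H2 (phi i)) -> in_H2 z ->
  energy z (fun x => \sum_(i < n) c i * phi i x) =
  \sum_(i < n) c i * energy z (phi i).
Proof.
elim: n c phi => [|n IHn] c phi hphi hz.
  rewrite big_ord0; have [z1 [z2 hz']] := hz; have [_ L1' L2'] := H2_derivs_L2 hz'.
  have := energy_linr 0 0 hz hz hz; rewrite !mul0r addr0 => e.
  rewrite -[RHS]e; congr energy; apply/funext => x.
  by rewrite big_ord0 !mul0r addr0.
rewrite big_ord_recr /= -IHn//; set f := (fun x => _).
pose g := fun x => \sum_(i < n) c (widen_ord (leqnSn n) i) * phi (widen_ord (leqnSn n) i) x.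
have -> : f = fun x => 1 * g x + c ord_max * phi ord_max x.
  by apply/funext => x; rewrite /f big_ord_recr /= mul1r.
by rewrite energy_linr// ?mul1r//; exact: in_H2_sum.
Qed.

Lemma energy_CauchySchwarz v w : in_H2 v -> in_H2 w ->
  energy v w ^+ 2 <= energy v v * energy w w.
Proof.
move=> hv hw; have v0 := energy_ge0 v; have w0 := energy_ge0 w.
have Q (k : R) : 0 <= k ^+ 2 * energy v v + 2 * k * energy v w + energy w w.
  have := energy_ge0 (fun x => k * v x + 1 * w x).
  rewrite energy_linl//; last exact: in_H2_lin.
  rewrite energy_linr// energy_linr// (energyC w v) => h; apply: (le_trans h).
  by rewrite le_eqVlt; apply/orP; left; apply/eqP; ring.
have [vz|vp] := eqVneq (energy v v) 0.
  rewrite vz mul0r; have [->|vw] := eqVneq (energy v w) 0; first by rewrite expr0n.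
  have := Q (- (energy w w + 1) / (2 * energy v w)); rewrite vz mulr0 add0r.
  have -> : 2 * (- (energy w w + 1) / (2 * energy v w)) * energy v w
      = - (energy w w + 1) by field.
  by lra.
have {}v0 : 0 < energy v v by rewrite lt_neqAle eq_sym vp.
have := Q (- energy v w / energy v v).
have -> : (- energy v w / energy v v) ^+ 2 * energy v v
    + 2 * (- energy v w / energy v v) * energy v w + energy w w
    = (energy v v * energy w w - energy v w ^+ 2) / energy v v.
  by field; rewrite gt_eqF.
by rewrite pmulr_lge0 ?invr_gt0// subr_ge0.
Qed.

Lemma energy_eq v v' w : in_H2 v -> in_H2 w -> {in @I01 R, v =1 v'} ->
  in_H2 v' /\ energy v' w = energy v w.
Proof.
move=> [v1 [v2 hv]] [w1 [w2 hw]] e; have [h1 h2 L] := hv.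
have hv' : H2_derivs v' v1 v2 by split=> //; exact: AC_eq h1.
split; first by exists v1, v2.
by rewrite (H2_derivs_energy hv' hw) (H2_derivs_energy hv hw).
Qed.

Lemma energy_Hnorm v : in_H2 v -> energy v v <= Hnorm 2 v ^+ 2.
Proof.
move=> [v1 [v2 hv]]; rewrite (H2_derivs_energy hv hv) (H2_derivs_Hnorm hv).
by rewrite [leLHS]addrC -addrA lerDr ip_ge0.
Qed.

Lemma finite_dim_lin S a b v w : finite_dim_space S -> S v -> S w ->
  S (fun x => a * v x + b * w x).
Proof.
move=> [n [phi hS]] /hS[c hc] /hS[d hd]; apply/hS; exists (fun i => a * c i + b * d i).
move=> x Ix; rewrite hc// hd// !mulr_sumr -big_split /=.
by apply: eq_bigr => i _; ring.
Qed.

(** The linear system for the coefficients of the projection is solvable: its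
    right-hand side vanishes on the kernel of the Gram matrix, which consists of
    coefficients of functions of zero energy. This way the generating functions of
    the space may be linearly dependent. *)
Lemma elliptic_projection_exists S v : finite_dim_space S ->
  (forall chi, S chi -> in_H2 chi) -> in_H2 v ->
  exists w, is_elliptic_projection S v w.
Proof.
move=> [n [phi hS]] hH2 hv.
have Sphi i : S (phi i).
  apply/hS; exists (fun j => (j == i)%:R) => x _.
  rewrite (bigD1 i)//= eqxx mul1r big1 ?addr0// => j /negbTE ->.
  by rewrite mul0r.
have Hphi i : in_H2 (phi i) by exact: hH2.
pose G := \matrix_(i < n, j < n) energy (phi i) (phi j).
pose b := \row_(j < n) energy v (phi j).
have : (b <= G)%MS.
  rewrite submxE; apply/eqP/matrixP => i k; rewrite mxE [RHS]mxE.
  pose d j := cokermx G j k.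
  pose psi x := \sum_(j < n) d j * phi j x.
  have Hpsi : in_H2 psi by exact: in_H2_sum.
  have phipsi l : energy (phi l) psi = 0.
    have := mulmx_coker G => /matrixP/(_ l k); rewrite mxE [RHS]mxE => <-.
    by rewrite energy_sumr//; apply: eq_bigr => j _; rewrite mulrC; congr (_ * _); rewrite mxE.
  have psi0 : energy psi psi = 0.
    rewrite energy_sumr//; apply: big1 => j _.
    by rewrite (energyC psi (phi j)) phipsi mulr0.
  have := energy_CauchySchwarz hv Hpsi.
  rewrite psi0 mulr0 => h; have /eqP : energy v psi ^+ 2 = 0.
    by apply/eqP; rewrite eq_le h sqr_ge0.
  rewrite expf_eq0 /= energy_sumr// => /eqP vpsi; rewrite -[RHS]vpsi.
  by apply: eq_bigr => j _; rewrite mulrC; congr (_ * _); rewrite mxE.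
move=> /submxP[c bc].
pose w x := \sum_(i < n) c 0 i * phi i x.
have Sw : S w by apply/hS; exists (fun i => c 0 i).
exists w; split; first exact: Sw.
move=> chi Schi; rewrite -(energyE w chi) -(energyE v chi).
have [e he] := (hS chi).1 Schi.
pose chi' x := \sum_(i < n) e i * phi i x.
have Hchi' : in_H2 chi' by exact: in_H2_sum.
have cc : {in @I01 R, chi' =1 chi} by move=> x; rewrite inE => Ix; rewrite he.
have Hw : in_H2 w by exact: hH2.
rewrite (energyC w chi) (energyC v chi).
rewrite (energy_eq Hchi' Hw cc).2 (energy_eq Hchi' hv cc).2.
rewrite (energyC chi' w) (energyC chi' v) energy_sumr// energy_sumr//; apply: eq_bigr => j _; congr (_ * _).
rewrite (energyC w (phi j)) energy_sumr//.
have /matrixP/(_ 0 j) := bc; rewrite mxE [RHS]mxE => ->.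
by apply: eq_bigr => i _; rewrite mxE (energyC (phi j) (phi i)).
Qed.

End EllipticProjection.

(** * Galerkin orthogonality and quasi-optimality *)

Section ProjectionError.
Variable R : realType.
Implicit Types (v w rho chi : R -> R) (S : set (R -> R)).

(** What the error analysis uses of a finite element space, apart from the cube
    and the approximation property. *)
Definition H2_space S : Prop :=
  [/\ finite_dim_space S,
      forall chi, S chi -> exists chi2, H2_derivs chi (deriv_in (@I01 R) chi) chi2
    & forall chi, S chi -> chi 0 = 0].

Lemma H2_space_in_H2 S chi : H2_space S -> S chi -> in_H2 chi.
Proof. by move=> [_ h _] /h[chi2 hc]; exists (deriv_in (@I01 R) chi), chi2. Qed.

Lemma fe_space_H2 r h S : fe_space r h S -> H2_space S.
Proof.
move=> [fd reg _ _]; split=> // chi /reg[hh c1].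
  by exists (iter 2 (@wderiv R) chi); exact: HH2_C1_derivs.
by case: hh.
Qed.

Lemma projection_orthogonal S v w : H2_space S -> in_H2 v ->
  is_elliptic_projection S v w ->
  forall chi, S chi -> energy (fun x => w x - v x) chi = 0.
Proof.
move=> hS hv [Sw ew] chi Schi; have hw := H2_space_in_H2 hS Sw.
have hc := H2_space_in_H2 hS Schi.
have -> : (fun x => w x - v x) = (fun x => 1 * w x + (-1) * v x).
  by apply/funext => x; rewrite mul1r mulN1r.
by rewrite energy_linl// !energyE ew// mul1r mulN1r subrr.
Qed.

(** Since [rho] is orthogonal to the space, [v] may be replaced by [v - chi] for
    every [chi] of the space, and then Cauchy-Schwarz applies. Taken with [v] a
    dual function this is the duality estimate; taken with the projected function
    itself it gives quasi-optimality. *)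
Lemma galerkin_bound S v rho K : H2_space S -> in_H2 v -> in_H2 rho ->
  (forall chi, S chi -> energy rho chi = 0) ->
  (S !=set0) ->
  inf [set Hnorm 2 (v \- chi) | chi in S] <= K ->
  `|energy v rho| <= Num.sqrt (energy rho rho) * K.
Proof.
move=> hS hv hrho orth [chi0 Schi0] infK.
set s := Num.sqrt (energy rho rho).
have s0 : 0 <= s by exact: sqrtr_ge0.
have bd chi : S chi -> `|energy v rho| <= s * Hnorm 2 (v \- chi).
  move=> Schi; have hc := H2_space_in_H2 hS Schi.
  have hd : in_H2 (v \- chi).
    have := in_H2_lin 1 (-1) hv hc.
    by congr in_H2; apply/funext => x /=; rewrite mul1r mulN1r.
  have e : energy v rho = energy (v \- chi) rho.
    have -> : v \- chi = (fun x => 1 * v x + (-1) * chi x).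
      by apply/funext => x /=; rewrite mul1r mulN1r.
    by rewrite energy_linl// (energyC chi rho) orth// mulr0 addr0 mul1r.
  have CS := energy_CauchySchwarz hd hrho.
  have H0 := Hnorm_ge0 2 (v \- chi).
  rewrite e -ler_sqr ?nnegrE ?mulr_ge0// real_normK ?num_real//.
  rewrite exprMn sqr_sqrtr ?energy_ge0// mulrC (le_trans CS)//.
  by rewrite ler_wpM2r ?energy_ge0// energy_Hnorm.
have [s_eq0|s_neq0] := eqVneq s 0.
  by have := bd _ Schi0; rewrite s_eq0 !mul0r.
have sp : 0 < s by rewrite lt_neqAle eq_sym s_neq0.
rewrite mulrC -ler_pdivrMr//; apply: le_trans infK; apply: lb_le_inf.
  by exists (Hnorm 2 (v \- chi0)), chi0.
by move=> _ [chi Schi <-]; rewrite ler_pdivrMr// mulrC bd.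
Qed.

(** The energy of [rho] is minus its energy product with [v]. *)
Lemma galerkin_best_approximation S v w K : H2_space S -> in_H2 v ->
  is_elliptic_projection S v w -> 0 <= K ->
  inf [set Hnorm 2 (v \- chi) | chi in S] <= K ->
  Num.sqrt (energy (fun x => w x - v x) (fun x => w x - v x)) <= K.
Proof.
move=> hS hv ew K0 infK; set rho := (fun x => w x - v x).
have [Sw _] := ew; have hw := H2_space_in_H2 hS Sw.
have orth := projection_orthogonal hS hv ew.
have rhoE : rho = (fun x => 1 * w x + (-1) * v x).
  by apply/funext => x; rewrite mul1r mulN1r.
have hrho : in_H2 rho by rewrite rhoE; exact: in_H2_lin.
have := galerkin_bound hS hv hrho orth (ex_intro _ w Sw) infK.
set s := Num.sqrt _ => h.
have e : energy rho rho = - energy v rho.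
  rewrite {1}rhoE energy_linl// (energyC w rho) orth//.
  by rewrite mulr0 add0r mulN1r.
have ss : s ^+ 2 = energy rho rho by rewrite sqr_sqrtr// energy_ge0.
have s0 : 0 <= s by exact: sqrtr_ge0.
have := le_trans (ler_norm (- energy v rho)) (eq_ind_r (fun t => t <= _) h (normrN _)).
rewrite -e -ss expr2 => h2.
have [->//|sn] := eqVneq s 0.
by rewrite -(ler_pM2l (_ : 0 < s))// lt_neqAle eq_sym sn.
Qed.

(** With linearity, this makes the projection of a time-differentiable function
    differentiable in time. *)
Lemma projection_contraction S v w : H2_space S -> in_H2 v ->
  is_elliptic_projection S v w -> energy w w <= energy v v.
Proof.
move=> hS hv ew; have [Sw eq] := ew; have hw := H2_space_in_H2 hS Sw.
have := energy_ge0 (fun x => 1 * v x + (-1) * w x).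
rewrite energy_linl//; last exact: in_H2_lin.
rewrite energy_linr// energy_linr// (energyC w v).
have -> : energy v w = energy w w by rewrite !energyE eq.
lra.
Qed.

End ProjectionError.

(** * Duality and the boundary flux *)

Section Duality.
Variable R : realType.
Implicit Types (v w rho phi : R -> R) (x K : R).

Local Notation mu := (@lebesgue_measure R).

Lemma H2_derivs_cube :
  H2_derivs (fun x : R => x ^+ 3) (fun x => 3 * x ^+ 2) (fun x => 6 * x).
Proof.
have h2 : AC01 (fun x : R => x * x) (fun x => 1 * x + x * 1) := AC_mul (@AC_id R) (@AC_id R).
have h3 := AC_mul (@AC_id R) h2.
split.
- apply: (@AC_eq _ (fun x => x * (x * x))); first by move=> x _; rewrite !exprS mulr1.
  by apply: AC_eqr h3 => x; ring.
- apply: (@AC_eq _ (fun x => 3 * (x * x))); first by move=> x _; rewrite expr2.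
  by apply: AC_eqr (ACZ 3 h2) => x; ring.
- by apply: L2Z; exact: AC_L2 (@AC_id R).
Qed.

(** The second derivative [6 x] of the cube vanishes at 0, so integration by parts
    in [(rho2, 6 x)] leaves only the boundary value [6 * rho1 1] and integrals of
    [rho1]. *)
Lemma orthogonal_cube_flux rho rho1 rho2 : H2_derivs rho rho1 rho2 ->
  energy rho (fun x => x ^+ 3) = 0 -> rho1 1 ^+ 2 <= ip rho1 rho1.
Proof.
move=> hrho; rewrite (H2_derivs_energy hrho H2_derivs_cube) => e0.
have [_ h12 _] := hrho; have [_ L1' L2'] := H2_derivs_L2 hrho.
have Lid := AC_L2 (@AC_id R).
have L6x : L2 (fun x : R => 6 * x) := L2Z 6 Lid.
have h6 : AC01 (fun x : R => 6 * x) (fun=> 6).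
  by apply: AC_eqr (ACZ 6 (@AC_id R)) => x; rewrite mulr1.
have bp := AC_by_parts h12 h6 L2' (L2_cst 6).
have [_ L3x2 _] := H2_derivs_L2 H2_derivs_cube.
pose z x : R := 1 * 6 + (-1) * (3 * x ^+ 2).
have Lz : L2 z by apply: L2_lin => //; exact: L2_cst.
have e6 : 6 * rho1 1 = ip rho1 z.
  rewrite ip_linr//; last exact: L2_cst.
  by move: bp e0; rewrite !mulr0 mulr1; lra.
have zz : ip z z <= 6 ^+ 2.
  apply: ip_bounded => // x /andP[x0 x1]; rewrite /z.
  have : x ^+ 2 <= 1 by rewrite expr_le1// ltW.
  by have := sqr_ge0 x; nra.
have := ip_CauchySchwarz L1' Lz; rewrite -e6 exprMn => cs.
have := ler_wpM2l (ip_ge0 rho1) zz.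
have := ip_ge0 rho1; lra.
Qed.

Definition list4 v0 v1 v2 v3 : nat -> R -> R :=
  fun l => match l with 0%N => v0 | 1%N => v1 | 2%N => v2 | _ => v3 end.

(** Aubin-Nitsche duality without solving a boundary value problem. The test
    function is the second antiderivative [P] of [rho]: integrating by parts in
    [energy P rho] yields [- ip rho1 rho1 - ip rho rho] and boundary terms with the
    factor [rho 1]. The value [rho 1] is in turn the energy product of [rho] with
    the identity function, so it is small by duality as well. *)
Lemma aubin_nitsche rho rho1 rho2 K : H2_derivs rho rho1 rho2 -> rho 0 = 0 ->
  rho1 1 ^+ 2 <= ip rho1 rho1 -> 0 <= K ->
  (forall d, AC_chain 3 d -> d 0%N 0 = 0 ->
     `|energy (d 0%N) rho| <= K * Hnorm 3 (d 0%N)) ->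
  ip rho1 rho1 <= (6 * K) ^+ 2.
Proof.
move=> hrho rho00 flux K0 dual.
have [h01 h12 _] := hrho; have [L0 L1' L2'] := H2_derivs_L2 hrho.
set N := ip rho1 rho1 in flux *; pose n := Num.sqrt N.
have N0 : 0 <= N by exact: ip_ge0.
have n0 : 0 <= n by exact: sqrtr_ge0.
have nN : n ^+ 2 = N by rewrite sqr_sqrtr.
have rhoN : ip rho rho <= N by exact: ip_poincare.
have rho1K : `|rho 1| <= K * 2.
  (* The dual function is the identity, whose norm of order 3 is at most 2. *)
  pose d := list4 (fun x : R => x) (fun=> 1) (fun=> 0) (fun=> 0).
  have hd : AC_chain 3 d.
    split; last exact: L2_cst.
    by move=> [|[|[|]]]// _; [exact: AC_id|exact: AC_cst|exact: AC_cst].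
  have hid : H2_derivs (fun x : R => x) (fun=> 1) (fun=> 0).
    by split; [exact: AC_id|exact: AC_cst|exact: L2_cst].
  have := dual d hd (erefl _); rewrite (H2_derivs_energy hid hrho).
  have -> : ip (fun=> 0) rho2 = 0.
    transitivity (\int[mu]_(y in @D R) (0 : R)).
      by apply: eq_Rintegral => x _; rewrite mul0r.
    by rewrite Rintegral_cst ?mul0r//; exact: measurable_D.
  have -> : ip (fun=> 1) rho1 = rho 1.
    transitivity (\int[mu]_(y in @D R) rho1 y).
      by apply: eq_Rintegral => x _; rewrite mul1r.
    by rewrite (AC_integral h01) rho00 subr0.
  rewrite add0r => le; apply: (le_trans le); rewrite ler_wpM2l//.
  rewrite -ler_sqr ?nnegrE ?Hnorm_ge0// (AC_chain_Hnorm hd).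
  rewrite !big_ord_recr big_ord0 /= !ip_cst !expr0n /= expr1n.
  have : ip (fun x : R => x) (fun x => x) <= 1 ^+ 2.
    apply: ip_bounded; first exact: AC_L2 (@AC_id R).
    by move=> x /andP[x0 x1]; rewrite lerXn2r ?nnegrE// ltW.
  lra.
pose P1 x := \int[mu]_(y in `]0, x[) rho y.
pose P x := \int[mu]_(y in `]0, x[) P1 y.
have hP1 : AC01 P1 rho by apply: AC_primitive; exact: L2_L1.
have LP1 := AC_L2 hP1.
have hP : AC01 P P1 by apply: AC_primitive; exact: L2_L1.
have P10 : P1 0 = 0 by rewrite /P1 set_itvoo0 Rintegral_set0.
have P0 : P 0 = 0 by rewrite /P set_itvoo0 Rintegral_set0.
have hPd : H2_derivs P P1 rho by [].
pose d := list4 P P1 rho rho1.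
have hd : AC_chain 3 d by split=> // -[|[|[|]]].
have P1N : ip P1 P1 <= N by apply: le_trans rhoN; exact: ip_poincare.
have PN : ip P P <= N by apply: le_trans P1N; exact: ip_poincare.
have HP : Hnorm 3 P <= 2 * n.
  rewrite -ler_sqr ?nnegrE ?Hnorm_ge0 ?mulr_ge0// (AC_chain_Hnorm hd).
  rewrite !big_ord_recr big_ord0 /= add0r exprMn nN -/N.
  by move: PN P1N rhoN; clearbody N; lra.
(* Each of [P], [P1], [rho] and [rho1] has norm at most [n], whence the factor 2. *)
have bpP : `|energy P rho| <= K * (2 * n).
  by apply: (le_trans (dual d hd P0)); rewrite ler_wpM2l.
have P11 : `|P1 1| <= n.
  rewrite -ler_sqr ?nnegrE// real_normK ?num_real// nN.
  by apply: le_trans rhoN; apply: (AC_sup hP1) => //; rewrite ler01 lexx.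
have rho11 : `|rho1 1| <= n.
  by rewrite -ler_sqr ?nnegrE// real_normK ?num_real// nN.
rewrite (H2_derivs_energy hPd hrho) in bpP.
have b1 := AC_by_parts h01 h12 L1' L2'.
have b2 := AC_by_parts hP1 h01 L0 L1'.
rewrite rho00 mul0r subr0 in b1; rewrite P10 mul0r subr0 in b2.
have rho0 := ip_ge0 rho.
have key : N <= n * (6 * K).
  have e : N = rho 1 * rho1 1 + P1 1 * rho 1 - ip rho rho - (ip rho rho2 + ip P1 rho1).
    by rewrite -b1 -b2 /N; ring.
  have m1 : rho 1 * rho1 1 <= K * 2 * n.
    by rewrite (le_trans (ler_norm _))// normrM ler_pM.
  have m2 : P1 1 * rho 1 <= n * (K * 2).
    by rewrite (le_trans (ler_norm _))// normrM ler_pM.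
  have := le_trans (ler_norm (- (ip rho rho2 + ip P1 rho1))) (eq_ind_r (fun t => t <= _) bpP (normrN _)).
  lra.
rewrite -nN lerXn2r ?nnegrE ?mulr_ge0//.
have [->|nn] := eqVneq n 0; first by rewrite mulr_ge0.
have np : 0 < n by rewrite lt_neqAle eq_sym nn.
by rewrite -(ler_pM2l np) -expr2 nN.
Qed.

End Duality.

(** * The rate of the projection error *)

Section ProjectionRate.
Variable R : realType.

Lemma AC_chain_H2 n (d : nat -> R -> R) : (2 < n)%N -> AC_chain n d ->
  H2_derivs (d 0%N) (d 1%N) (d 2%N).
Proof.
move=> n2 hd; have [h _] := hd; split.
- by apply: h; rewrite (ltn_trans _ n2).
- by apply: h; rewrite (ltn_trans _ n2).
- by apply: (AC_chain_L2 hd); rewrite ltnW.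
Qed.

(** Quasi-optimality contributes the power [r - 1] of [h], and duality with
    functions of order 3 one more. *)
Lemma projection_rate (r : nat) (hstar : R) (S : R -> set (R -> R)) :
  (3 <= r)%N -> (forall h, 0 < h <= hstar -> fe_space r h (S h)) ->
  approximation_property r hstar S ->
  exists2 C : R, 0 <= C &
    forall h d w, 0 < h <= hstar -> AC_chain r.+1 d -> d 0%N 0 = 0 ->
      is_elliptic_projection (S h) (d 0%N) w ->
      let rho1 x := deriv_in (@I01 R) w x - d 1%N x in
      ip rho1 rho1 <= (C * h ^+ r * Hnorm r.+1 (d 0%N)) ^+ 2 /\
      rho1 1 ^+ 2 <= ip rho1 rho1.
Proof.
move=> r3 Sfe [C hC]; exists (6 * `|C| * `|C|); first by rewrite !mulr_ge0.
move=> h d w hh hd d00 ew rho1; have /andP[h0 hs] := hh.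
have fe := Sfe h hh; have hS := fe_space_H2 fe.
have [_ _ _ Scube] := fe; have [_ SH2 S0] := hS.
have rn : (2 < r.+1)%N by rewrite ltnW.
have hv := AC_chain_H2 rn hd.
have Hv : in_H2 (d 0%N) by exists (d 1%N), (d 2%N).
have [Sw _] := ew; have [w2 hw] := SH2 w Sw.
pose rho x := w x - d 0%N x.
have hrho : H2_derivs rho rho1 (fun x => w2 x - d 2%N x).
  have := H2_derivs_lin 1 (-1) hw hv.
  by congr H2_derivs; apply/funext => x; rewrite /rho /rho1 mul1r mulN1r.
have Hrho : in_H2 rho by eexists; eexists; exact: hrho.
have orth := projection_orthogonal hS Hv ew.
have infle s v : (1 <= s <= r)%N -> HH s.+1 v ->
    inf [set Hnorm 2 (v \- chi) | chi in S h] <= `|C| * h ^+ s.-1 * Hnorm s.+1 v.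
  move=> sr Hsv; apply: (le_trans (hC h s v hh sr Hsv)).
  by rewrite ler_wpM2r ?Hnorm_ge0// ler_wpM2r ?ler_norm// exprn_ge0// ltW.
pose G := Num.sqrt (energy rho rho).
have G0 : 0 <= G by exact: sqrtr_ge0.
have hG : G <= `|C| * h ^+ r.-1 * Hnorm r.+1 (d 0%N).
  apply: (galerkin_best_approximation hS Hv ew).
    by rewrite !mulr_ge0 ?Hnorm_ge0// exprn_ge0// ltW.
  by apply: infle; [rewrite leqnn andbT (leq_trans _ r3)|exact: AC_chain_HH].
have flux : rho1 1 ^+ 2 <= ip rho1 rho1.
  exact: (orthogonal_cube_flux hrho (orth _ Scube)).
split=> //.
have K0 : 0 <= G * (`|C| * h) by rewrite !mulr_ge0// ltW.
have rho00 : rho 0 = 0 by rewrite /rho (S0 w Sw) d00 subrr.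
have dual e : AC_chain 3 e -> e 0%N 0 = 0 ->
    `|energy (e 0%N) rho| <= G * (`|C| * h) * Hnorm 3 (e 0%N).
  move=> he e0; have Hev := AC_chain_H2 (ltnSn 2) he.
  have Hee : in_H2 (e 0%N) by eexists; eexists; exact: Hev.
  rewrite -mulrA; apply: (galerkin_bound hS Hee Hrho orth (ex_intro _ w Sw)).
  have r2 : (1 <= 2 <= r)%N by rewrite (ltnW r3).
  by have := infle 2%N _ r2 (AC_chain_HH (isT : (0 < 3)%N) he e0); rewrite expr1.
apply: (le_trans (aubin_nitsche hrho rho00 flux K0 dual)).
rewrite lerXn2r ?nnegrE//.
- by rewrite mulr_ge0.
- by rewrite !mulr_ge0 ?Hnorm_ge0// exprn_ge0// ltW.
have -> : h ^+ r = h * h ^+ r.-1 by rewrite -exprS prednK// (leq_trans _ r3).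
have -> : 6 * (G * (`|C| * h)) = 6 * `|C| * h * G by ring.
have -> : 6 * `|C| * `|C| * (h * h ^+ r.-1) * Hnorm r.+1 (d 0%N) =
    6 * `|C| * h * (`|C| * h ^+ r.-1 * Hnorm r.+1 (d 0%N)) by ring.
by rewrite ler_wpM2l// !mulr_ge0// ltW.
Qed.

End ProjectionRate.

(** * Functions smooth in space and time *)

Section SpaceTime.
Variable R : realType.
Implicit Types (T t tau x y k : R) (F G : R -> R -> R) (f df : R -> R).

Local Notation I01 := (@I01 R).

Lemma rectP T t x : rect T (t, x) <-> (0 <= t <= T) /\ (0 <= x <= 1).
Proof. by rewrite /rect /Defs.I01 /= !in_itv /=. Qed.

Lemma rect_compact T : compact (rect T).
Proof. by apply: compact_setX; exact: segment_compact. Qed.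

(** Compactness of the rectangle, in its covering form: near each point a radius
    works for all neighbours at once. *)
Lemma continuous_rect_unif T F : continuous_rect T F ->
  forall k, 0 < k -> exists2 e, 0 < e & forall t x s y,
    rect T (t, x) -> rect T (s, y) -> `|s - t| < e -> `|y - x| < e ->
    `|F s y - F t x| < k.
Proof.
move=> /subspace_continuousP cF k k0.
pose P (e : R) (p : R * R) := rect T p -> forall q : R * R, rect T q ->
  `|q.1 - p.1| < e -> `|q.2 - p.2| < e -> `|F q.1 q.2 - F p.1 p.2| < k.
have := @rect_compact T; rewrite compact_near_coveringP.
move=> /(_ R (0^'+) P _) [].
  move=> p0 rp0; have k2 : 0 < k / 2 by rewrite divr_gt0.
  have /cvgrPdist_lt/(_ _ k2)/nbhs_ballP[d /= d0 hd] := cF p0 rp0.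
  have d2 : 0 < d / 2 by rewrite divr_gt0.
  exists (ball p0 (d / 2), [set e | e < d / 2]); first split => /=.
  - exact: nbhsx_ballx.
  - exact: nbhs_right_lt.
  move=> [p e] /= [[b1 b2] ed] rp q rq q1 q2.
  have hp : `|F p0.1 p0.2 - F p.1 p.2| < k / 2.
    by apply: hd => //; split => /=; [apply: lt_trans b1 _|apply: lt_trans b2 _]; lra.
  have hq : `|F p0.1 p0.2 - F q.1 q.2| < k / 2.
    apply: hd => //; split; rewrite /ball /=.
      have -> : p0.1 - q.1 = (p0.1 - p.1) - (q.1 - p.1) by ring.
      rewrite (le_lt_trans (ler_normB _ _))// [d]splitr ltrD//.
      exact: lt_trans q1 ed.
    have -> : p0.2 - q.2 = (p0.2 - p.2) - (q.2 - p.2) by ring.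
    rewrite (le_lt_trans (ler_normB _ _))// [d]splitr ltrD//.
    exact: lt_trans q2 ed.
  have -> : F q.1 q.2 - F p.1 p.2 =
      (F p0.1 p0.2 - F p.1 p.2) - (F p0.1 p0.2 - F q.1 q.2) by ring.
  by rewrite (le_lt_trans (ler_normB _ _))// [k]splitr ltrD.
move=> e0 /= e0p he; exists (e0 / 2); first by rewrite divr_gt0.
move=> t x s y rtx rsy st yx; have e2 : 0 < e0 / 2 by rewrite divr_gt0.
apply: (he (e0 / 2) _ e2 (t, x) rtx rtx (s, y) rsy st yx).
by rewrite /ball_ /= sub0r normrN gtr0_norm//; lra.
Qed.

Lemma continuous_rect_bounded T F : continuous_rect T F ->
  exists2 M, 0 <= M & forall t x, rect T (t, x) -> `|F t x| <= M.
Proof.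
move=> cF; have /compact_bounded := continuous_compact cF (@rect_compact T).
move=> [M [Mr hM]]; exists (`|M| + 1); first by rewrite addr_ge0.
move=> t x tx; apply: (hM (`|M| + 1)); first by rewrite ltr_pwDr// ler_norm.
by exists (t, x).
Qed.

Lemma continuous_rect_slice T F t : continuous_rect T F -> 0 <= t <= T ->
  {within I01, continuous (F t)}.
Proof.
move=> cF tT; apply/within_continuousP => x Ix k k0.
have [e e0 he] := continuous_rect_unif cF k0; exists e => // y Iy yx.
by apply: he => //; rewrite subrr normr0.
Qed.

Lemma MVT_deriv_in (p q a b : R) f df :
  (forall x, p <= x <= q -> derivable_in `[p, q] f x /\ deriv_in `[p, q] f x = df x) ->
  p <= a -> a < b -> b <= q ->
  exists2 c, a < c < b & f b - f a = df c * (b - a).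
Proof.
move=> hf pa ab bq.
have cf : {within `[a, b], continuous f}.
  apply: (@continuous_subspaceW _ _ _ `[p, q]); first by apply: subset_itv; rewrite bnd_simp.
  by apply: derivable_in_within => x /=; rewrite in_itv /= => /hf[].
have df' x : x \in `]a, b[%R -> is_derive x 1 f (df x).
  rewrite in_itv /= => /andP[ax xb].
  have px : p < x < q by rewrite (le_lt_trans pa ax) (lt_le_trans xb bq).
  have /andP[/ltW px' /ltW xq'] := px.
  have [d <-] := hf x (introT andP (conj px' xq')).
  exact: deriv_in_is_derive.
have [c] := MVT ab df' cf; rewrite in_itv /= => cab e; by exists c.
Qed.

Lemma MVT_deriv_in_dist (p q a b : R) f df :
  (forall x, p <= x <= q -> derivable_in `[p, q] f x /\ deriv_in `[p, q] f x = df x) ->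
  p <= a <= q -> p <= b <= q -> a != b ->
  exists2 c, (p <= c <= q) && (`|c - a| <= `|b - a|) & f b - f a = df c * (b - a).
Proof.
move=> hf /andP[pa aq] /andP[pb bq]; rewrite neq_lt => /orP[ab|ba].
  have [c /andP[ac cb] e] := MVT_deriv_in hf pa ab bq; exists c => //.
  by rewrite !ger0_norm; lra.
have [c /andP[bc ca] e] := MVT_deriv_in hf pb ba aq; exists c.
  by rewrite !ler0_norm; lra.
by rewrite -[LHS]opprB e; ring.
Qed.

Definition has_dt T F G := forall t x, rect T (t, x) ->
  derivable_in `[0, T] (F ^~ x) t /\ deriv_in `[0, T] (F ^~ x) t = G t x.

Definition has_dx T F G := forall t x, rect T (t, x) ->
  derivable_in I01 (F t) x /\ deriv_in I01 (F t) x = G t x.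

(** Exchange of the derivatives, together with uniformity in [x]: by the mean value
    theorem in time and then in space, the second difference of [F] divided by both
    steps is a value of [G1] nearby. No derivative in time of [F1] is presupposed,
    so the lemma can be iterated. *)
Lemma uniform_quotient_dx T F G F1 G1 :
  has_dt T F G -> has_dx T F F1 -> has_dx T G G1 -> continuous_rect T G1 ->
  forall k, 0 < k -> exists2 e, 0 < e & forall t tau x, rect T (t, x) ->
    0 <= tau <= T -> tau != t -> `|tau - t| < e ->
    `|(F1 tau x - F1 t x) / (tau - t) - G1 t x| <= k.
Proof.
move=> hF hF1 hG1 cG1 k k0; have [e e0 he] := continuous_rect_unif cG1 k0.
exists e => // t tau x rtx tauT taut te; have [tT xI] := (rectP T t x).1 rtx.
have rtaux : rect T (tau, x) by apply/rectP.
have tt0 : tau - t != 0 by rewrite subr_eq0.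
pose A y := ((F tau y - F tau x) / (y - x) - (F t y - F t x) / (y - x)) / (tau - t).
have near_A y : 0 <= y <= 1 -> y != x -> `|y - x| < e -> `|A y - G1 t x| < k.
  move=> yI yx yxe; have yx0 : y - x != 0 by rewrite subr_eq0.
  pose phi s := F s y - F s x.
  have dphi s : 0 <= s <= T -> derivable_in `[0, T] phi s /\
      deriv_in `[0, T] phi s = G s y - G s x.
    move=> sT; have rsx : rect T (s, x) by apply/rectP.
    have rsy : rect T (s, y) by apply/rectP.
    have [d1 e1] := hF s x rsx; have [d2 e2] := hF s y rsy.
    have T0 : 0 < T.
      rewrite lt_neqAle; case/andP: (tT) => t0 tT'; rewrite (le_trans t0 tT') andbT.
      apply: contra taut => /eqP T0; rewrite -T0 in tT' tauT; case/andP: tauT => ? ?.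
      by rewrite eq_le; apply/andP; split; lra.
    apply: deriv_in_unique => // j j0; have j2 : 0 < j / 2 by rewrite divr_gt0.
    have [a1 a10 ha1] := derivable_inP d1 j2.
    have [a2 a20 ha2] := derivable_inP d2 j2.
    exists (Num.min a1 a2); first by rewrite lt_min a10.
    move=> r rT rs; rewrite lt_min => /andP[r1 r2].
    have := ha1 r rT rs r1; have := ha2 r rT rs r2; rewrite e1 e2 /= => l2 l1.
    have -> : (phi r - phi s) / (r - s) - (G s y - G s x) =
       ((F r y - F s y) / (r - s) - G s y) - ((F r x - F s x) / (r - s) - G s x).
      by rewrite /phi; ring.
    by rewrite (le_lt_trans (ler_normB _ _))// [j]splitr ltrD.
  have ttau : t != tau by rewrite eq_sym.
  have [xi /andP[xiT xit] exi] := MVT_deriv_in_dist dphi tT tauT ttau.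
  have dG z : 0 <= z <= 1 -> derivable_in I01 (G xi) z /\ deriv_in I01 (G xi) z = G1 xi z.
    by move=> zI; apply: hG1; apply/rectP.
  have xy : x != y by rewrite eq_sym.
  have [eta /andP[etaI etax] eeta] := MVT_deriv_in_dist dG xI yI xy.
  have -> : A y = G1 xi eta.
    rewrite /A -mulrBl (_ : _ - _ = phi tau - phi t); last by rewrite /phi; ring.
    by rewrite exi eeta; field; rewrite yx0 tt0.
  have rxe : rect T (xi, eta) by apply/rectP.
  exact: (he _ _ _ _ rtx rxe (le_lt_trans xit te) (le_lt_trans etax yxe)).
have cA : A y @[y --> within I01 x^'] --> (F1 tau x - F1 t x) / (tau - t).
  have [d1 e1] := hF1 tau x rtaux; have [d2 e2] := hF1 t x rtx.
  rewrite /derivable_in in d1 d2; rewrite -e1 -e2 /deriv_in.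
  by apply: cvgMl; apply: cvgB.
have PF := within_itv_dnbhs_proper ltr01 xI.
rewrite leNgt; apply/negP => contra.
have j0 : 0 < `|(F1 tau x - F1 t x) / (tau - t) - G1 t x| - k by rewrite subr_gt0.
have [j j00 hj] := (cvg_within_dnbhsP _ _ _ _).1 cA _ j0.
have : \forall y \near within I01 x^', `|A y - G1 t x| < k /\
   `|A y - (F1 tau x - F1 t x) / (tau - t)| <
   `|(F1 tau x - F1 t x) / (tau - t) - G1 t x| - k.
  apply/near_within_dnbhsP; exists (Num.min e j); first by rewrite lt_min e0.
  move=> y Iy yx; rewrite lt_min => /andP[ye yj]; split; last exact: hj.
  by apply: near_A => //; move: Iy; rewrite /Defs.I01 /= in_itv.
move=> /filter_ex[y [l1 l2]].
have := ler_distD (A y) ((F1 tau x - F1 t x) / (tau - t)) (G1 t x).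
by rewrite (distrC _ (A y)); lra.
Qed.

End SpaceTime.

(** * Time slices and difference quotients of the exact solution *)

Section SmoothSlices.
Variable R : realType.
Implicit Types (T t tau x y k m : R) (F G u : R -> R -> R) (v w : R -> R).

Local Notation I01 := (@I01 R).

Lemma ip_abs_le v w m k : L2 v -> L2 w -> 0 <= m -> 0 <= k ->
  ip v v <= m ^+ 2 -> ip w w <= k ^+ 2 -> `|ip v w| <= m * k.
Proof.
move=> Lv Lw m0 k0 vm wk; rewrite -ler_sqr ?nnegrE ?mulr_ge0// real_normK ?num_real//.
rewrite (le_trans (ip_CauchySchwarz Lv Lw))// exprMn ler_pM// ip_ge0//.
Qed.

Lemma ip_perturb v w m k : L2 v -> L2 w -> 0 <= m -> 0 <= k ->
  ip v v <= m ^+ 2 -> ip (fun x => w x - v x) (fun x => w x - v x) <= k ^+ 2 ->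
  `|ip w w - ip v v| <= 2 * m * k + k ^+ 2.
Proof.
move=> Lv Lw m0 k0 vm; set d := (fun x => w x - v x) => dk.
have Ld : L2 d by exact: L2B.
have -> : ip w w - ip v v = 2 * ip v d + ip d d.
  have -> : ip w w = ip (fun x => 1 * v x + 1 * d x) (fun x => 1 * v x + 1 * d x).
    by congr ip; apply/funext => x; rewrite /d; ring.
  by rewrite ip_sqr_lin//; ring.
have le := ip_abs_le Lv Ld m0 k0 vm dk.
rewrite (le_trans (ler_normD _ _))// lerD//.
  by rewrite normrM ger0_norm// -mulrA ler_wpM2l.
by rewrite ger0_norm ?ip_ge0.
Qed.

Lemma continuous_ip_slice T F : continuous_rect T F ->
  {within `[0, T], continuous (fun t => ip (F t) (F t))}.
Proof.
move=> cF; apply/within_continuousP => t /=; rewrite in_itv /= => tT k k0.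
have [M M0 hM] := continuous_rect_bounded cF.
have Lt s : 0 <= s <= T -> L2 (F s).
  by move=> sT; apply: continuous_L2; exact: continuous_rect_slice cF sT.
pose j := Num.min 1 (k / (2 * M + 2)).
have M2 : 0 < 2 * M + 2 by lra.
have j0 : 0 < j by rewrite lt_min ltr01 divr_gt0.
have j1 : j <= 1 by rewrite ge_min lexx.
have jk : j * (2 * M + 2) <= k by rewrite -ler_pdivlMr// ge_min lexx orbT.
have [e e0 he] := continuous_rect_unif cF j0; exists e => // s; rewrite in_itv /= => sT st.
have inR r x : 0 <= r <= T -> 0 < x < 1 -> rect T (r, x).
  by move=> rT /andP[x0 x1]; apply/rectP; split=> //; rewrite !ltW.
have sq (b c : R) : `|b| <= c -> b ^+ 2 <= c ^+ 2.
  move=> bc; rewrite -[leLHS]real_normK ?num_real// lerXn2r// nnegrE.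
  exact: le_trans bc.
apply: (@le_lt_trans _ _ (2 * M * j + j ^+ 2)).
  apply: ip_perturb => //; [exact: Lt|exact: Lt|exact: ltW| |].
    apply: ip_bounded; first exact: Lt.
    by move=> x x01; apply: sq; apply: hM; exact: inR.
  apply: ip_bounded; first by apply: L2B; exact: Lt.
  by move=> x x01; apply/sq/ltW/he; rewrite ?subrr ?normr0//; exact: inR.
have : j ^+ 2 <= j by rewrite expr2 ler_piMl// ltW.
lra.
Qed.

Section C1n.
Variables (T : R) (n : nat) (u : R -> R -> R).
Hypotheses (T0 : 0 < T) (hu : C1n_rect T n u).

Let p i j := iter j (@dx R) (iter i (dt T) u).

Lemma C1n_has_dt : has_dt T u (dt T u).
Proof. by have [h _ _] := hu; move=> t x tx; split; first exact: h. Qed.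

Lemma C1n_has_dx i j : (i <= 1)%N -> (j < n)%N -> has_dx T (p i j) (p i j.+1).
Proof. by have [_ h _] := hu; move=> i1 jn t x tx; split; first exact: h. Qed.

Lemma C1n_continuous i j : (i <= 1)%N -> (j <= n)%N -> continuous_rect T (p i j).
Proof. by have [_ _ h] := hu; exact: h. Qed.

Lemma C1n_AC_chain i t : (i <= 1)%N -> 0 <= t <= T -> AC_chain n (fun j => p i j t).
Proof.
move=> i1 tT; split=> [l ln|]; last first.
  by apply: continuous_L2; apply: continuous_rect_slice tT; exact: C1n_continuous.
apply: AC_deriv_in; split.
  move=> x; rewrite /Defs.I01 /= in_itv /= => x01.
  by have [] := C1n_has_dx i1 ln (_ : rect T (t, x)); first exact/rectP.
exact: (continuous_rect_slice (C1n_continuous i1 (ln : (l.+1 <= n)%N)) tT).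
Qed.

Lemma uniform_quotient_has_dt F G :
  (forall k, 0 < k -> exists2 e, 0 < e & forall t tau x, rect T (t, x) ->
    0 <= tau <= T -> tau != t -> `|tau - t| < e ->
    `|(F tau x - F t x) / (tau - t) - G t x| <= k) -> has_dt T F G.
Proof.
move=> h t x tx; have [tT _] := (rectP T t x).1 tx.
apply: deriv_in_unique => // k k0; have k2 : 0 < k / 2 by rewrite divr_gt0.
have [e e0 he] := h _ k2; exists e => // y; rewrite /= in_itv /= => yT yt yte.
by apply: le_lt_trans (he t y x tx yT yt yte) _; lra.
Qed.

(** Applied to [u], [uniform_quotient_dx] shows that [dx u] is differentiable in
    time, which is what its second application, to [dx u], requires. *)
Lemma C1n_uniform_quotient j : (0 < j <= 2)%N -> (2 <= n)%N ->
  forall k, 0 < k -> exists2 e, 0 < e & forall t tau x, rect T (t, x) ->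
    0 <= tau <= T -> tau != t -> `|tau - t| < e ->
    `|(p 0 j tau x - p 0 j t x) / (tau - t) - p 1 j t x| <= k.
Proof.
move=> j2 n2.
have q1 := uniform_quotient_dx C1n_has_dt
  (C1n_has_dx (isT : (0 <= 1)%N) (ltnW n2)) (C1n_has_dx (leqnn 1) (ltnW n2))
  (C1n_continuous (leqnn 1) (ltnW n2)).
have hd := uniform_quotient_has_dt q1.
have q2 := uniform_quotient_dx hd (C1n_has_dx (isT : (0 <= 1)%N) n2)
  (C1n_has_dx (leqnn 1) n2) (C1n_continuous (leqnn 1) n2).
case: j j2 => [|[|[|j]]] j2; [exfalso|exact: q1|exact: q2|exfalso].
  by move: j2; clear.
by move: j2; clear.
Qed.

(** The distance of a difference quotient in time from its presumed limit. *)
Definition quotient_defect F G t tau : R -> R :=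
  fun x => (F tau x - F t x) / (tau - t) - G t x.

Lemma H2_derivs_quotient F F1 F2 G G1 G2 t tau :
  H2_derivs (F tau) (F1 tau) (F2 tau) -> H2_derivs (F t) (F1 t) (F2 t) ->
  H2_derivs (G t) (G1 t) (G2 t) ->
  H2_derivs (quotient_defect F G t tau) (quotient_defect F1 G1 t tau)
    (quotient_defect F2 G2 t tau).
Proof.
move=> h1 h2 h3.
have := H2_derivs_lin (tau - t)^-1 (-1) (H2_derivs_lin 1 (-1) h1 h2) h3.
by congr H2_derivs; apply/funext => x; rewrite /quotient_defect !mulN1r mul1r mulrC.
Qed.

Lemma C1n_H2_derivs i t : (i <= 1)%N -> (2 < n)%N -> 0 <= t <= T ->
  H2_derivs (p i 0 t) (p i 1 t) (p i 2 t).
Proof. by move=> i1 n2 tT; exact: (AC_chain_H2 n2 (C1n_AC_chain i1 tT)). Qed.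

Lemma C1n_energy_quotient : (2 < n)%N ->
  forall k, 0 < k -> exists2 e, 0 < e & forall t tau, 0 <= t <= T ->
    0 <= tau <= T -> tau != t -> `|tau - t| < e ->
    in_H2 (quotient_defect u (dt T u) t tau) /\
    energy (quotient_defect u (dt T u) t tau) (quotient_defect u (dt T u) t tau)
      <= k ^+ 2.
Proof.
move=> n2 k k0; have k2 : 0 < k / 2 by rewrite divr_gt0.
have [e1 e10 h1] := C1n_uniform_quotient (isT : (0 < 1 <= 2)%N) (ltnW n2) k2.
have [e2 e20 h2] := C1n_uniform_quotient (isT : (0 < 2 <= 2)%N) (ltnW n2) k2.
exists (Num.min e1 e2); first by rewrite lt_min e10.
move=> t tau tT tauT taut; rewrite lt_min => /andP[te1 te2].
have hq := H2_derivs_quotient (C1n_H2_derivs (isT : (0 <= 1)%N) n2 tauT)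
  (C1n_H2_derivs (isT : (0 <= 1)%N) n2 tT) (C1n_H2_derivs (leqnn 1) n2 tT).
split; first by eexists; eexists; exact: hq.
rewrite (H2_derivs_energy hq hq); have [_ L1' L2'] := H2_derivs_L2 hq.
have sq (b c : R) : `|b| <= c -> b ^+ 2 <= c ^+ 2.
  move=> bc; rewrite -[leLHS]real_normK ?num_real// lerXn2r// nnegrE.
  exact: le_trans bc.
have inR x : 0 < x < 1 -> rect T (t, x).
  by move=> /andP[x0 x1]; apply/rectP; split=> //; rewrite !ltW.
have b1 : ip (quotient_defect (p 0 1) (p 1 1) t tau)
    (quotient_defect (p 0 1) (p 1 1) t tau) <= (k / 2) ^+ 2.
  by apply: ip_bounded => // x /inR tx; apply: sq; exact: h1.
have b2 : ip (quotient_defect (p 0 2) (p 1 2) t tau)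
    (quotient_defect (p 0 2) (p 1 2) t tau) <= (k / 2) ^+ 2.
  by apply: ip_bounded => // x /inR tx; apply: sq; exact: h2.
apply: (le_trans (lerD b2 b1)).
have -> : (k / 2) ^+ 2 + (k / 2) ^+ 2 = k ^+ 2 / 2 by field.
by rewrite ler_pdivrMr// ler_peMr ?sqr_ge0// ler1n.
Qed.

End C1n.
End SmoothSlices.

(** * Differentiating a squared norm, and Gronwall's inequality *)

Section TimeEstimates.
Variable R : realType.
Implicit Types (T t tau x k m K : R) (v w : R -> R).

Local Notation mu := (@lebesgue_measure R).

Lemma ip_sum_le v w : L2 v -> L2 w ->
  ip (fun x => v x + w x) (fun x => v x + w x) <= 2 * (ip v v + ip w w).
Proof.
move=> Lv Lw.
have -> : ip (fun x => v x + w x) (fun x => v x + w x) =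
    ip v v + 2 * ip v w + ip w w.
  have := ip_sqr_lin 1 1 Lv Lw; rewrite /= !expr1n !mul1r !mulr1 => <-.
  by congr ip; apply/funext => x; rewrite !mul1r.
have := ip_young ltr01 Lv Lw; rewrite invr1 !mul1r.
by have := ler_norm (ip v w); lra.
Qed.

(** With [z] the difference quotient, [th tau = th t + (tau - t) * z], and the
    square expands into [2 (tau - t) (th t, z)] and a remainder of second order. *)
Lemma ip_sqr_deriv_in T (th : R -> R -> R) (eta : R -> R) t : 0 < T -> 0 <= t <= T ->
  (forall s, 0 <= s <= T -> L2 (th s)) -> L2 eta ->
  (forall k, 0 < k -> exists2 e, 0 < e & forall tau, 0 <= tau <= T ->
     tau != t -> `|tau - t| < e ->
     let q := quotient_defect th (fun=> eta) t tau in ip q q <= k ^+ 2) ->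
  derivable_in `[0, T] (fun s => ip (th s) (th s)) t /\
  deriv_in `[0, T] (fun s => ip (th s) (th s)) t = 2 * ip eta (th t).
Proof.
move=> T0 tT Lth Leta hq; apply: deriv_in_unique => // kap kap0.
have Lt := Lth t tT.
pose m := Num.sqrt (ip (th t) (th t) + ip eta eta).
have m0 : 0 <= m by exact: sqrtr_ge0.
have mE : m ^+ 2 = ip (th t) (th t) + ip eta eta.
  by rewrite sqr_sqrtr// addr_ge0// ip_ge0.
have thm : ip (th t) (th t) <= m ^+ 2 by rewrite mE lerDl ip_ge0.
have etam : ip eta eta <= m ^+ 2 by rewrite mE lerDr ip_ge0.
have m1 : 0 < 4 * (m + 1) by lra.
have mm : 0 < 4 * (1 + m ^+ 2) by have := sqr_ge0 m; lra.
pose k := Num.min 1 (kap / (4 * (m + 1))).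
have k0 : 0 < k by rewrite lt_min ltr01 divr_gt0.
have k1 : k <= 1 by rewrite ge_min lexx.
have kk : k * (4 * (m + 1)) <= kap by rewrite -ler_pdivlMr// ge_min lexx orbT.
have [e e0 he] := hq k k0.
exists (Num.min e (kap / (4 * (1 + m ^+ 2)))); first by rewrite lt_min e0 divr_gt0.
move=> tau; rewrite /= in_itv /= => tauT taut; rewrite lt_min => /andP[te tk].
have Ltau := Lth tau tauT; have tt0 : tau - t != 0 by rewrite subr_eq0.
rewrite ltr_pdivlMr// in tk.
have := he tau tauT taut te; rewrite /=; set q := quotient_defect _ _ _ _ => qk.
have Lq : L2 q.
  have := L2_lin (tau - t)^-1 (-1) (L2_lin 1 (-1) Ltau Lt) Leta.
  by congr L2; apply/funext => x; rewrite /q /quotient_defect !mulN1r mul1r mulrC.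
pose z x := q x + eta x.
have Lz : L2 z by exact: L2D.
have zz : ip z z <= 2 * (1 + m ^+ 2).
  apply: (le_trans (ip_sum_le Lq Leta)); rewrite ler_wpM2l// lerD//.
  by apply: (le_trans qk); rewrite expr_le1// ltW.
have -> : ip (th tau) (th tau) = ip (fun x => 1 * th t x + (tau - t) * z x)
    (fun x => 1 * th t x + (tau - t) * z x).
  by congr ip; apply/funext => x; rewrite /z /q /quotient_defect; field.
rewrite ip_sqr_lin//.
have zth : ip (th t) z = ip q (th t) + ip eta (th t) by rewrite ipC ipDl.
have -> : (1 ^+ 2 * ip (th t) (th t) + 2 * 1 * (tau - t) * ip (th t) z +
    (tau - t) ^+ 2 * ip z z - ip (th t) (th t)) / (tau - t) - 2 * ip eta (th t) =
    2 * ip q (th t) + (tau - t) * ip z z.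
  by rewrite zth; field.
have b1 : `|ip q (th t)| <= k * m by apply: ip_abs_le => //; exact: ltW.
rewrite (le_lt_trans (ler_normD _ _))// !normrM (ger0_norm (ip_ge0 z)).
rewrite (ger0_norm (_ : 0 <= 2))//.
have b2 : `|tau - t| * ip z z <= `|tau - t| * (2 * (1 + m ^+ 2)) by rewrite ler_wpM2l.
have : k * m <= k * (m + 1) by rewrite ler_wpM2l ?ltW// ltrDl.
by lra.
Qed.

(** The function [E s * exp (- K s)] minus the integral of [kap] is nonincreasing. *)
Lemma gronwall T K (E dE kap : R -> R) : 0 < T -> 0 <= K -> E 0 = 0 ->
  (forall t, 0 <= t <= T ->
     derivable_in `[0, T] E t /\ deriv_in `[0, T] E t = dE t) ->
  {within `[0, T], continuous kap} -> (forall t, 0 <= t <= T -> 0 <= kap t) ->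
  (forall t, 0 <= t <= T -> dE t <= K * E t + kap t) ->
  forall t, 0 <= t <= T -> E t <= expR (K * T) * \int[mu]_(s in `[0, t]) kap s.
Proof.
move=> T0 K0 E0 hE ckap kap0 ineq t /andP[t0 tT].
have int_ge0 : 0 <= \int[mu]_(s in `[0, t]) kap s.
  apply: Rintegral_ge0 => s /=; rewrite in_itv /= => /andP[s0 st].
  by apply: kap0; rewrite s0 (le_trans st).
move: t0; rewrite le_eqVlt => /predU1P[t0|t0].
  by subst t; rewrite E0 mulr_ge0// expR_ge0.
pose P (s : R) := \int[mu]_(r in `[0, s]) kap r.
pose X (s : R) : R := expR (- K * s).
have sub : `[0, t] `<=` `[0, T] by apply: subset_itv; rewrite bnd_simp.
have ikap := continuous_compact_integrable (@segment_compact R 0 T) ckap.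
have dX (s : R) : is_derive s 1 X (- K * X s).
  rewrite /X; apply: is_derive_eq; rewrite /GRing.scale /=; ring.
have dP (s : R) : 0 < s < T -> is_derive s 1 P (kap s).
  move=> /andP[s0 sT].
  have cs : {for s, continuous kap}.
    by apply: (within_continuous_continuous T0 ckap); rewrite in_itv /= s0.
  have [df e] := continuous_FTC1_closed sT ikap s0 cs.
  by apply: DeriveDef; [exact: df|rewrite -derive1E e].
pose M (s : R) : R := E s * X s - P s.
have dM (s : R) : s \in `]0, t[%R -> is_derive s 1 M ((dE s - K * E s) * X s - kap s).
  rewrite in_itv /= => /andP[s0 st]; have sT : 0 < s < T by rewrite s0 (lt_le_trans st).
  have sT' : 0 <= s <= T by case/andP: sT => ? ?; rewrite !ltW.
  have [d e] := hE s sT'; have dEs := deriv_in_is_derive sT d; rewrite e in dEs.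
  have dPs := dP s sT; have dXs := dX s.
  apply: is_derive_eq; rewrite /GRing.scale /=; ring.
have cM : {within `[0, t], continuous M}.
  have cE : {within `[0, T], continuous E}.
    by apply: derivable_in_within => s /=; rewrite in_itv /= => /hE[].
  have cX : {within `[0, T], continuous X}.
    apply: continuous_subspaceT => s.
    by apply: differentiable_continuous; apply/derivable1_diffP; have [] := dX s.
  have cP := parameterized_integral_continuous (ltW T0) ikap.
  apply: (continuous_subspaceW sub) => s.
  apply: (@continuousB _ _ (subspace `[0, T]) (fun s => E s * X s) P); last exact: cP.
  by apply: (@continuousM _ (subspace `[0, T]) E X); [exact: cE|exact: cX].
have [c] := MVT t0 dM cM; rewrite in_itv /= => /andP[c0 ct] eM.
have cT : 0 <= c <= T by rewrite ltW//= (le_trans (ltW ct)).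
have X1 : X c <= 1 by rewrite /X -expR0 ler_expR mulNr oppr_le0 mulr_ge0// ltW.
have X0 : 0 <= X c by exact: expR_ge0.
have Mt : M t <= 0.
  have M0 : M 0 = 0 by rewrite /M E0 mul0r sub0r /P set_itv1 Rintegral_set1 oppr0.
  rewrite M0 subr0 in eM; rewrite eM pmulr_lle0; last by rewrite subr_gt0.
  have h1 : (dE c - K * E c) * X c <= kap c * X c.
    by rewrite ler_wpM2r// lerBlDl ineq.
  have h2 : kap c * X c <= kap c * 1 by rewrite ler_wpM2l// kap0.
  by lra.
have EP : E t * X t <= P t by move: Mt; rewrite /M subr_le0.
have -> : E t = E t * X t * expR (K * t).
  by rewrite -mulrA /X -expRD mulNr addNr expR0 mulr1.
apply: (@le_trans _ _ (P t * expR (K * t))); first by rewrite ler_wpM2r// expR_ge0.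
by rewrite mulrC ler_wpM2r// ler_expR ler_wpM2l.
Qed.

End TimeEstimates.

(** * The energy inequality *)

Section ErrorEquation.
Variable R : realType.
Implicit Types (a b k x M : R) (v w f g z : R -> R) (S : set (R -> R)).

Local Notation I01 := (@I01 R).
Local Notation mu := (@lebesgue_measure R).

Lemma deriv_in_lin a b f g x : 0 <= x <= 1 ->
  derivable_in I01 f x -> derivable_in I01 g x ->
  deriv_in I01 (fun y => a * f y + b * g y) x =
  a * deriv_in I01 f x + b * deriv_in I01 g x.
Proof.
move=> x01 df dg; have PF := within_itv_dnbhs_proper ltr01 x01.
apply: cvg_lim => //.
have -> : (fun y => (a * f y + b * g y - (a * f x + b * g x)) / (y - x)) =
    (fun y => a * ((f y - f x) / (y - x)) + b * ((g y - g x) / (y - x))).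
  by apply/funext => y; ring.
by apply: cvgD; apply: cvgMr.
Qed.

Lemma projection_lin S a b v v' w w' : H2_space S -> in_H2 v -> in_H2 v' ->
  is_elliptic_projection S v w -> is_elliptic_projection S v' w' ->
  is_elliptic_projection S (fun x => a * v x + b * v' x)
    (fun x => a * w x + b * w' x).
Proof.
move=> hS hv hv' [Sw ew] [Sw' ew']; have [fd _ _] := hS.
split; first exact: finite_dim_lin.
move=> chi Schi; have hw := H2_space_in_H2 hS Sw; have hw' := H2_space_in_H2 hS Sw'.
have hc := H2_space_in_H2 hS Schi; have e1 : energy w chi = energy v chi by rewrite !energyE; exact: ew.
have e2 : energy w' chi = energy v' chi by rewrite !energyE; exact: ew'.
by rewrite -!energyE !energy_linl// e1 e2.
Qed.

Lemma ip_mul_bounded M v z : {within I01, continuous z} -> L2 v ->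
  (forall x, 0 <= x <= 1 -> `|z x| <= M) ->
  ip (fun x => z x * v x) (fun x => z x * v x) <= M ^+ 2 * ip v v.
Proof.
move=> cb Lv bM.
have -> : M ^+ 2 * ip v v = ip (fun x => M * v x) (fun x => M * v x).
  rewrite ipZl//; last exact: L2Z.
  by rewrite (ipC v) ipZl//; ring.
apply: ip_le; [exact: L2_mul_continuous|exact: L2Z|].
move=> x /andP[x0 x1]; rewrite !exprMn ler_wpM2r ?sqr_ge0//.
have bx := bM x (introT andP (conj (ltW x0) (ltW x1))).
by rewrite -[leLHS]real_normK ?num_real// lerXn2r// nnegrE (le_trans _ bx).
Qed.

(** The constant produced by [energy_inequality]; [2 * a0 / (5 * M)] is the
    parameter of the trace inequality there. *)
Definition gronwall_constant (a0 M : R) : R :=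
  2 * (1 + 5 / 2 * M * (1 + (2 * a0 / (5 * M))^-1) + 2 * M + 4 * M ^+ 2).

(** The energy inequality at a fixed time: [th] is the discrete error, [rho] the
    projection error, and [tht1], [rhot1] are the space derivatives of their time
    derivatives. All products are split by Young's inequality; only the boundary
    terms need the coercive term [a * ip th2 th2]. *)
Lemma energy_inequality (a0 M al ka a : R) (b0 b1 th th1 th2 rho rho1 rho2 tht1 rhot1 : R -> R) :
  0 < a0 -> 1 <= M -> a0 <= a <= M -> `|al| <= M -> `|ka| <= M ->
  {within I01, continuous b0} -> {within I01, continuous b1} ->
  (forall x, 0 <= x <= 1 -> `|b0 x| <= M) -> (forall x, 0 <= x <= 1 -> `|b1 x| <= M) ->
  H2_derivs th th1 th2 -> H2_derivs rho rho1 rho2 -> th 0 = 0 -> rho 0 = 0 ->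
  L2 tht1 -> L2 rhot1 ->
  ip rho2 th2 + ip rho1 th1 = 0 -> rho1 1 ^+ 2 <= ip rho1 rho1 ->
  ip (fun x => tht1 x + rhot1 x) th1 =
    (al * (th1 1 + rho1 1) - ka * (th 1 + rho 1)) * th1 1
    - a * ip (fun x => th2 x + rho2 x) th2
    + ip (fun x => b1 x * (th x + rho x) + b0 x * (th1 x + rho1 x)) th1 ->
  2 * ip tht1 th1 <=
    gronwall_constant a0 M * (ip th1 th1 + ip rho1 rho1 + ip rhot1 rhot1).
Proof.
move=> a00 M1 /andP[a0a aM] alM kaM cb cb1 bM b1M hth hrho th0 rho0 Ltt Lrt orth flux.
have [Lth Lth1 Lth2] := H2_derivs_L2 hth; have [Lrho Lrho1 Lrho2] := H2_derivs_L2 hrho.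
have [h01 h12 _] := hth; have [r01 r12 _] := hrho.
rewrite (ipDl Ltt Lrt Lth1) (ipDl Lth2 Lrho2 Lth2).
set w := (fun x => b1 x * (th x + rho x) + b0 x * (th1 x + rho1 x)).
pose e x := th x + rho x; pose e1 x := th1 x + rho1 x.
have Le : L2 e by exact: L2D.
have Le1 : L2 e1 by exact: L2D.
have he : AC01 e e1 by exact: ACD.
have e0 : e 0 = 0 by rewrite /e th0 rho0 addr0.
have Lw : L2 w by apply: L2D; exact: L2_mul_continuous.
have M0 : 0 < M by lra.
have ww : ip w w <= 8 * M ^+ 2 * (ip th1 th1 + ip rho1 rho1).
  apply: (le_trans (ip_sum_le (L2_mul_continuous Le cb1) (L2_mul_continuous Le1 cb))).
  have i1 := ip_mul_bounded cb1 Le b1M; have i2 := ip_mul_bounded cb Le1 bM.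
  have i3 : M ^+ 2 * ip e e <= M ^+ 2 * ip e1 e1.
    by rewrite ler_wpM2l ?sqr_ge0//; exact: ip_poincare.
  have i4 : M ^+ 2 * ip e1 e1 <= M ^+ 2 * (2 * (ip th1 th1 + ip rho1 rho1)).
    by rewrite ler_wpM2l ?sqr_ge0//; exact: ip_sum_le.
  move: i1 i2 i3 i4; set A := ip (fun _ => _) _; set B' := ip (fun _ => _) _.
  lra.
have y1 := ip_young ltr01 Lrt Lth1; rewrite invr1 !mul1r in y1.
have y2 := ip_young ltr01 Lw Lth1; rewrite invr1 !mul1r in y2.
have y3 := ip_young ltr01 Lrho1 Lth1; rewrite invr1 !mul1r in y3.
(* The boundary terms contain [th1 1 ^ 2] with total weight [5 / 2 * M]; with this
   parameter the trace inequality costs exactly [a0 * ip th2 th2]. *)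
pose k := 2 * a0 / (5 * M).
have k0 : 0 < k by rewrite divr_gt0// mulr_gt0.
have tr := AC_trace h12 Lth2 k0.
have I1 : 0 <= (1 : R) <= 1 by rewrite ler01 lexx.
have th1s := AC_sup h01 Lth1 th0 I1.
have rhos := AC_sup r01 Lrho1 rho0 I1.
have MkZ : 5 / 2 * M * (k * ip th2 th2) = a0 * ip th2 th2.
  by rewrite /k; field; rewrite gt_eqF.
have Mtr : 5 / 2 * M * th1 1 ^+ 2 <=
    5 / 2 * M * ((1 + k^-1) * ip th1 th1) + a0 * ip th2 th2.
  have c0 : 0 <= 5 / 2 * M by lra.
  by rewrite -MkZ -mulrDr ler_wpM2l.
have ms (c p q : R) : `|c| <= M -> c * (p * q) <= M * ((p ^+ 2 + q ^+ 2) / 2).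
  move=> cM; rewrite (le_trans (ler_norm _))// normrM ler_pM//.
  by rewrite ler_norml; apply/andP; split;
    have := sqr_ge0 (p + q); have := sqr_ge0 (p - q); nra.
have m1 := ms al (th1 1) (th1 1) alM.
have m2 := ms al (rho1 1) (th1 1) alM.
have kaN : `|- ka| <= M by rewrite normrN.
have m3 := ms (- ka) (th 1) (th1 1) kaN.
have m4 := ms (- ka) (rho 1) (th1 1) kaN.
have aZ : a0 * ip th2 th2 <= a * ip th2 th2 by rewrite ler_wpM2r ?ip_ge0.
have aN : `|a| <= M by rewrite ger0_norm//; lra.
have ar : a * ip rho1 th1 <= M * ((ip rho1 rho1 + ip th1 th1) / 2).
  rewrite (le_trans (ler_norm _))// normrM ler_pM//; lra.
have orth' : a * ip rho2 th2 = - (a * ip rho1 th1).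
  by rewrite -mulrN; congr (_ * _); lra.
have Mth : M * th 1 ^+ 2 <= M * ip th1 th1 by rewrite ler_wpM2l// ltW.
have Mrh : M * rho 1 ^+ 2 <= M * ip rho1 rho1 by rewrite ler_wpM2l// ltW.
have Mr1 : M * rho1 1 ^+ 2 <= M * ip rho1 rho1 by rewrite ler_wpM2l// ltW.
have n1 := ler_norm (- ip rhot1 th1); rewrite normrN in n1.
have n2 := ler_norm (ip w th1).
have E0 := ip_ge0 th1; have N0 := ip_ge0 rho1; have Nt0 := ip_ge0 rhot1.
have coef : 0 <= 5 / 2 * M * (1 + k^-1).
  by rewrite mulr_ge0 ?addr_ge0 ?invr_ge0 ?(ltW k0)// mulr_ge0 ?divr_ge0// ltW.
rewrite /gronwall_constant -/k.
set X := 5 / 2 * M * (1 + k^-1) in coef *.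
have XE : 5 / 2 * M * ((1 + k^-1) * ip th1 th1) = X * ip th1 th1 by rewrite /X mulrA.
rewrite {}XE in Mtr.
set M2 := M ^+ 2 in ww *.
have M20 : 0 <= M2 by exact: sqr_ge0.
have p1 : 0 <= M2 * ip rhot1 rhot1 by rewrite mulr_ge0.
have p2 : 0 <= M * ip rhot1 rhot1 by rewrite mulr_ge0// ltW.
have p3 : 0 <= X * ip rhot1 rhot1 by rewrite mulr_ge0.
have p4 : 0 <= X * ip rho1 rho1 by rewrite mulr_ge0.
have p5 : 0 <= M * ip rho1 rho1 by rewrite mulr_ge0// ltW.
have p6 : 0 <= M * ip th1 th1 by rewrite mulr_ge0// ltW.
move: orth' ww y1 y2 Mtr m1 m2 m3 m4 aZ ar Mth Mrh Mr1 n1 n2 E0 N0 Nt0 p1 p2 p3 p4 p5 p6.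
clearbody X M2; clear.
set E := ip th1 th1; set Z := ip th2 th2; set N := ip rho1 rho1.
set Nt := ip rhot1 rhot1; set P := ip tht1 th1; set Q := ip rhot1 th1.
set W := ip w th1; set OT := ip rho2 th2; set O1 := ip rho1 th1; set WW := ip w w.
clearbody E Z N Nt P Q W OT O1 WW.
set t := th1 1; set r := rho1 1; set q := th 1; set s := rho 1.
clearbody t r q s.
move=> *; lra.
Qed.

End ErrorEquation.

(** * The error on one mesh *)

Section DiscreteError.
Variable R : realType.

Local Notation I01 := (@I01 R).
Local Notation mu := (@lebesgue_measure R).
Local Notation Dx := (deriv_in I01).

Lemma ip_sub_le (v w : R -> R) : L2 v -> L2 w ->
  ip (fun x => v x - w x) (fun x => v x - w x) <= 2 * (ip v v + ip w w).
Proof.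
move=> Lv Lw; have := ip_sum_le Lv (L2Z (-1) Lw).
rewrite ipZl//; last exact: L2Z.
rewrite (ipC w) ipZl// !mulN1r opprK => le; apply: le_trans le.
by rewrite le_eqVlt; apply/orP; left; apply/eqP; congr ip; apply/funext => x; rewrite mulN1r.
Qed.

(* Stated over abstract reals, since [ring] would compare integrals and weak
   derivatives up to conversion. *)
Let telescope (A B C : R) : 1 * A + (-1) * B + (1 * B + (-1) * C) = A - C.
Proof. ring. Qed.

Let telescope1 (A B C : R) : 1 * A + (-1) * B + (B - C) = A - C.
Proof. ring. Qed.

Let subtract_equations (a e d g b f1 f0 U1 U v1 v c1 c0 X1 X2 Y1 Y2 W1 W2 F : R) :
  X1 = (a / e * U1 - (d / e + b) * U - (g / e + f1)) * c1 + f0 * c0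
       - a * Y1 + W1 + F ->
  X2 = (a / e * v1 - d / e * v - g / e - b * v - f1) * c1 - - f0 * c0
       - a * Y2 + W2 + F ->
  X1 - X2 = (a / e * (U1 - v1) - (d / e + b) * (U - v)) * c1
            - a * (Y1 - Y2) + (W1 - W2).
Proof. by move=> -> ->; ring. Qed.

(** Both sides of the equation are absolutely continuous in [x], so their densities
    agree almost everywhere by [AC_unique]; the third derivative is then moved to
    the test function. *)
Lemma weak_form_in_space (a : R) (ut ut1 u0 u1 u2 u3 b b1 f f1 chi1 chi2 : R -> R) :
  AC01 ut ut1 -> AC01 u0 u1 -> AC01 u2 u3 -> AC01 b b1 -> AC01 f f1 ->
  AC01 chi1 chi2 -> L2 ut1 -> L2 u1 -> L2 u3 -> {within I01, continuous b1} ->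
  L2 f1 -> L2 chi2 ->
  (forall x, 0 <= x <= 1 -> ut x = a * u2 x + b x * u0 x + f x) ->
  ip ut1 chi1 = a * u2 1 * chi1 1 - a * u2 0 * chi1 0 - a * ip u2 chi2
    + ip (fun x => b1 x * u0 x + b x * u1 x) chi1 + ip f1 chi1.
Proof.
move=> hut hu hu2 hb hf hchi Lut1 Lu1 Lu3 cb1 Lf1 Lchi2 eq.
have Lu0 := AC_L2 hu; have Lchi1 := AC_L2 hchi.
pose bu x := b1 x * u0 x + b x * u1 x.
have Lbu : L2 bu.
  by apply: L2D; apply: L2_mul_continuous => //; exact: AC_continuous hb.
pose rhs1 x := 1 * (a * u3 x + 1 * bu x) + 1 * f1 x.
have hrhs : AC01 (fun x => 1 * (a * u2 x + 1 * (b x * u0 x)) + 1 * f x) rhs1.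
  by apply: AC_lin => //; apply: AC_lin => //; exact: AC_mul.
have hut' : AC01 ut rhs1.
  apply: AC_eq hrhs => x; rewrite inE /Defs.I01 /= in_itv /= => x01.
  by rewrite eq//; ring.
have L1' : L2 (fun x => a * u3 x + 1 * bu x) by exact: L2_lin.
have Lrhs : L2 rhs1 by exact: L2_lin.
rewrite (ae_ip_l Lut1 Lrhs Lchi1 (AC_unique hut hut')).
rewrite /rhs1 ip_linl// ip_linl//.
have := AC_by_parts hu2 hchi Lu3 Lchi2; rewrite -/bu => bp.
have -> : ip u3 chi1 = u2 1 * chi1 1 - u2 0 * chi1 0 - ip u2 chi2 by lra.
ring.
Qed.

Lemma within_continuous_sum (A : set R) n (F : 'I_n -> R -> R) :
  (forall i, {within A, continuous (F i)}) ->
  {within A, continuous (fun t => \sum_(i < n) F i t)}.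
Proof.
elim: n F => [|n IHn] F cF.
  apply: continuous_subspaceT => x.
  rewrite (_ : (fun t => _) = cst 0); first exact: cst_continuous.
  by apply/funext => t; rewrite big_ord0.
rewrite (_ : (fun t => _) = (fun t => \sum_(i < n) F (widen_ord (leqnSn n) i) t + F ord_max t)).
  move=> x; apply: (@continuousD _ _ (subspace A)
    (fun t => \sum_(i < n) F (widen_ord (leqnSn n) i) t) (F ord_max)).
    by apply: IHn => i; exact: cF.
  exact: cF.
by apply/funext => t; rewrite big_ord_recr.
Qed.

Lemma gronwall_constant_ge0 (a0 M : R) : 0 < a0 -> 1 <= M ->
  0 <= gronwall_constant a0 M.
Proof.
move=> a00 M1; have M0 : 0 <= M by lra.
have i0 : 0 <= (2 * a0 / (5 * M))^-1.
  by rewrite invr_ge0 divr_ge0 ?mulr_ge0// ltW.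
rewrite /gronwall_constant mulr_ge0// !addr_ge0 ?mulr_ge0 ?sqr_ge0 ?addr_ge0//.
Qed.

Let quotient_of_difference (A A' B B' a b d : R) :
  (1 * A + (-1) * B - (1 * A' + (-1) * B')) / d - (a - b) =
  ((A - A') / d - a) - ((B - B') / d - b).
Proof. ring. Qed.

Section OneMesh.
Variables (r : nat) (S : set (R -> R)) (T : R).
Variables (beta f : R -> R -> R) (delta g eps a u0 : R -> R).
Variables (u uh : R -> R -> R).
Hypotheses (r3 : (3 <= r)%N) (T0 : 0 < T).
Hypothesis hS : H2_space S.
Hypothesis Sreg : forall chi, S chi -> HH 2 chi /\ C1_I01 chi.
Hypothesis hu : C1n_rect T r.+1 u.
Hypothesis hsol : solution_P T beta f delta g eps a u0 u.
Hypothesis hsemi : semidiscrete T beta f delta g eps a u0 S uh.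
Hypothesis eps_gt0 : forall t, 0 <= t <= T -> 0 < eps t.
Hypotheses (beta_C1 : forall t, 0 <= t <= T -> C1_I01 (beta t))
           (f_C1 : forall t, 0 <= t <= T -> C1_I01 (f t)).
Variables (a0 M : R).
Hypotheses (a0_gt0 : 0 < a0) (M1 : 1 <= M).
Hypothesis aM : forall t, 0 <= t <= T -> a0 <= a t <= M.
Hypothesis alM : forall t, 0 <= t <= T -> `|a t / eps t| <= M.
Hypothesis kaM : forall t, 0 <= t <= T -> `|delta t / eps t + beta t 1| <= M.
Hypothesis bM : forall t x, 0 <= t <= T -> 0 <= x <= 1 -> `|beta t x| <= M.
Hypothesis b1M : forall t x, 0 <= t <= T -> 0 <= x <= 1 -> `|Dx (beta t) x| <= M.
Variable Q : R.
Hypothesis Q0 : 0 <= Q.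
Hypothesis rate : forall d w, AC_chain r.+1 d -> d 0%N 0 = 0 ->
  is_elliptic_projection S (d 0%N) w ->
  let rho1 x := Dx w x - d 1%N x in
  ip rho1 rho1 <= (Q * Hnorm r.+1 (d 0%N)) ^+ 2 /\ rho1 1 ^+ 2 <= ip rho1 rho1.

Let p i j := iter j (@dx R) (iter i (dt T) u).
(* The energy product sees functions on [0, 1] only, so it does not determine the
   projection elsewhere, and a choice is made at each time. *)
Let w t := xget (fun=> 0) [set w | is_elliptic_projection S (u t) w].
Let wt t := xget (fun=> 0) [set w | is_elliptic_projection S (dt T u t) w].
Let w2 chi := iter 2 (@wderiv R) chi.

Let th t x := 1 * uh t x + (-1) * w t x.
Let th1 t x := 1 * Dx (uh t) x + (-1) * Dx (w t) x.
Let th2 t x := 1 * w2 (uh t) x + (-1) * w2 (w t) x.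
Let rho t x := 1 * w t x + (-1) * u t x.
Let rho1 t x := Dx (w t) x - p 0 1 t x.
Let rho2 t x := 1 * w2 (w t) x + (-1) * p 0 2 t x.
Let tht1 t x := Dx (dt T uh t) x - Dx (wt t) x.
Let rhot1 t x := Dx (wt t) x - p 1 1 t x.

Let S_derivs chi : S chi -> H2_derivs chi (Dx chi) (w2 chi).
Proof. by move=> /Sreg[]; exact: HH2_C1_derivs. Qed.

Let r2 : (2 < r.+1)%N. Proof. exact: ltnW. Qed.

Let u_H2 i t : (i <= 1)%N -> 0 <= t <= T -> H2_derivs (p i 0 t) (p i 1 t) (p i 2 t).
Proof. by move=> i1 tT; exact: (C1n_H2_derivs hu i1 r2 tT). Qed.

Let u_in_H2 i t : (i <= 1)%N -> 0 <= t <= T -> in_H2 (p i 0 t).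
Proof. by move=> i1 tT; eexists; eexists; exact: u_H2. Qed.

Let w_proj t : 0 <= t <= T -> is_elliptic_projection S (u t) (w t).
Proof.
move=> tT; have [fd _ _] := hS.
have ex := elliptic_projection_exists fd (fun chi => @H2_space_in_H2 _ S chi hS)
  (u_in_H2 (isT : (0 <= 1)%N) tT).
exact: (@xgetPex _ (fun=> 0) [set w | is_elliptic_projection S (u t) w] ex).
Qed.

Let wt_proj t : 0 <= t <= T -> is_elliptic_projection S (dt T u t) (wt t).
Proof.
move=> tT; have [fd _ _] := hS.
have ex := elliptic_projection_exists fd (fun chi => @H2_space_in_H2 _ S chi hS)
  (u_in_H2 (leqnn 1) tT).
exact: (@xgetPex _ (fun=> 0) [set w | is_elliptic_projection S (dt T u t) w] ex).
Qed.

Let Sw t : 0 <= t <= T -> S (w t). Proof. by move=> /w_proj[]. Qed.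
Let Swt t : 0 <= t <= T -> S (wt t). Proof. by move=> /wt_proj[]. Qed.
Let Suh t : 0 <= t <= T -> S (uh t).
Proof. by move=> tT; have [hC _ _] := hsemi; have [] := hC t tT. Qed.
Let Suht t : 0 <= t <= T -> S (dt T uh t).
Proof. by move=> tT; have [hC _ _] := hsemi; have [] := hC t tT. Qed.

Let u_at0 t : 0 <= t <= T -> u t 0 = 0.
Proof. by have [_ h _ _] := hsol; exact: h. Qed.

(** At [x = 0] the solution vanishes for all times, so its time derivative vanishes
    too and the equation there determines the second derivative. *)
Let ut_at0 t : 0 <= t <= T -> dt T u t 0 = 0.
Proof.
move=> tT; have tI : `[0, T]%classic t by rewrite /= in_itv.
have e : {in `[0, T]%classic, (fun tau => u tau 0) =1 cst 0}.
  by move=> s; rewrite inE /= in_itv /= => sT; rewrite u_at0.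
rewrite /dt (eq_deriv_in tI e).2; apply: (deriv_in_unique T0 tT _).2 => k k0.
by exists 1 => // y _ _ _; rewrite /cst !subrr mul0r subrr normr0.
Qed.

Let rho1_rate t : 0 <= t <= T ->
  ip (rho1 t) (rho1 t) <= (Q * Hnorm r.+1 (u t)) ^+ 2 /\
  rho1 t 1 ^+ 2 <= ip (rho1 t) (rho1 t).
Proof.
move=> tT.
exact: (rate (C1n_AC_chain hu (isT : (0 <= 1)%N) tT) (u_at0 tT) (w_proj tT)).
Qed.

Let rhot1_rate t : 0 <= t <= T ->
  ip (rhot1 t) (rhot1 t) <= (Q * Hnorm r.+1 (dt T u t)) ^+ 2.
Proof.
move=> tT.
exact: (rate (C1n_AC_chain hu (leqnn 1) tT) (ut_at0 tT) (wt_proj tT)).1.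
Qed.

Let th_H2 t : 0 <= t <= T -> H2_derivs (th t) (th1 t) (th2 t).
Proof. by move=> tT; apply: H2_derivs_lin; apply: S_derivs; [exact: Suh|exact: Sw]. Qed.

Let rho_H2 t : 0 <= t <= T -> H2_derivs (rho t) (rho1 t) (rho2 t).
Proof.
move=> tT; have := H2_derivs_lin 1 (-1) (S_derivs (Sw tT)) (u_H2 (isT : (0 <= 1)%N) tT).
by congr H2_derivs; apply/funext => x; rewrite /rho1 mul1r mulN1r.
Qed.

Let S_th t : 0 <= t <= T -> S (th t).
Proof.
by move=> tT; have [fd _ _] := hS; apply: finite_dim_lin => //; [exact: Suh|exact: Sw].
Qed.

Let rho_orth t chi : 0 <= t <= T -> S chi -> energy (rho t) chi = 0.
Proof.
move=> tT Schi.
rewrite -(projection_orthogonal hS (u_in_H2 (isT : (0 <= 1)%N) tT) (w_proj tT) Schi).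
by congr energy; apply/funext => x; rewrite /rho mul1r mulN1r.
Qed.

Let at0 chi : S chi -> chi 0 = 0. Proof. by have [_ _ h] := hS; exact: h. Qed.

Let Dx_th t x : 0 <= t <= T -> 0 <= x <= 1 -> Dx (th t) x = th1 t x.
Proof.
move=> tT x01; have Ix : I01 x by rewrite /Defs.I01 /= in_itv.
apply: deriv_in_lin => //.
  by have [_ [h _]] := Sreg (Suh tT); exact: h.
by have [_ [h _]] := Sreg (Sw tT); exact: h.
Qed.

(** The equation in the domain at [x = 1] and the dynamical boundary condition both
    contain the time derivative of [u] at 1; eliminating it gives [a * u'' (1)] in
    the form that occurs in the semidiscrete problem. *)
Let error_equation t : 0 <= t <= T ->
  ip (fun x => tht1 t x + rhot1 t x) (th1 t) =
    (a t / eps t * (th1 t 1 + rho1 t 1)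
     - (delta t / eps t + beta t 1) * (th t 1 + rho t 1)) * th1 t 1
    - a t * ip (fun x => th2 t x + rho2 t x) (th2 t)
    + ip (fun x => Dx (beta t) x * (th t x + rho t x)
                   + beta t x * (th1 t x + rho1 t x)) (th1 t).
Proof.
move=> tT; have I1 : 0 <= (1 : R) <= 1 by rewrite ler01 lexx.
have I0 : 0 <= (0 : R) <= 1 by rewrite ler01 lexx.
have [_ _ disc] := hsemi; have [pde _ bc1 _] := hsol.
have hth := th_H2 tT; have [Lth Lth1 Lth2] := H2_derivs_L2 hth; have [h01 h12 _] := hth.
have hU := S_derivs (Suh tT); have [LU LU1 LU2] := H2_derivs_L2 hU; have [U01 _ _] := hU.
have hUt := S_derivs (Suht tT); have [LUt LUt1 LUt2] := H2_derivs_L2 hUt.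
have hb := AC_deriv_in (beta_C1 tT); have [_ cb1] := beta_C1 tT.
have hf := AC_deriv_in (f_C1 tT); have [_ cf1] := f_C1 tT.
have Lf1 := continuous_L2 cf1; have cb := AC_continuous hb.
have Lprod v v1 : L2 v -> L2 v1 -> L2 (fun x => Dx (beta t) x * v x + beta t x * v1 x).
  by move=> ? ?; apply: L2D; exact: L2_mul_continuous.
have := disc (th t) t (S_th tT) tT.
rewrite (H2_derivs_B hUt hth) (H2_derivs_Bstar hU hth) !Dx_th//.
rewrite (AC_B (AC_mul hb U01) (Lprod _ _ LU LU1) h01 Lth1) (AC_B hf Lf1 h01 Lth1).
move=> eqh.
have c0 := u_H2 (isT : (0 <= 1)%N) tT; have c1 := u_H2 (leqnn 1) tT.
have [Lu Lu1 Lu2] := H2_derivs_L2 c0; have [Lut Lut1 _] := H2_derivs_L2 c1.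
have [v01 _ _] := c0; have [vt01 _ _] := c1.
have chain := C1n_AC_chain hu (isT : (0 <= 1)%N) tT.
have v23 : AC01 (p 0 2 t) (p 0 3 t) by apply: chain.1; exact: r2.
have Lu3 : L2 (p 0 3 t) by apply: (AC_chain_L2 chain); exact: r2.
have pde' x : 0 <= x <= 1 -> p 1 0 t x = a t * p 0 2 t x + beta t x * p 0 0 t x + f t x.
  by move=> x01; apply: pde; apply/rectP.
have := weak_form_in_space vt01 v01 v23 hb hf h12 Lut1 Lu1 Lu3 cb1 Lf1 Lth2 pde'.
have e0 : a t * p 0 2 t 0 = - f t 0.
  have := pde' 0 I0; rewrite /p /= (ut_at0 tT) (u_at0 tT) mulr0 addr0 => /eqP.
  by rewrite eq_sym addr_eq0 => /eqP.
have en : eps t != 0 by rewrite gt_eqF// eps_gt0.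
have e1 : a t * p 0 2 t 1 = a t / eps t * p 0 1 t 1 - delta t / eps t * u t 1
    - g t / eps t - beta t 1 * u t 1 - f t 1.
  have -> : a t * p 0 2 t 1 = p 1 0 t 1 - beta t 1 * u t 1 - f t 1.
    by rewrite (pde' 1 I1) /p /=; ring.
  have -> : p 1 0 t 1 = (a t * p 0 1 t 1 - delta t * u t 1 - g t) / eps t.
    have -> : a t * p 0 1 t 1 = eps t * p 1 0 t 1 + delta t * u t 1 + g t := bc1 t tT.
    by field.
  by field.
rewrite e0 e1 => equ.
have -> : ip (fun x => tht1 t x + rhot1 t x) (th1 t) =
    ip (Dx (dt T uh t)) (th1 t) - ip (p 1 1 t) (th1 t).
  rewrite -(ipBl LUt1 Lut1 Lth1); congr ip; apply/funext => x; rewrite /tht1 /rhot1.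
  by rewrite addrA subrK.
have -> : ip (fun x => th2 t x + rho2 t x) (th2 t) =
    ip (w2 (uh t)) (th2 t) - ip (p 0 2 t) (th2 t).
  rewrite -(ipBl LU2 Lu2 Lth2); congr ip; apply/funext => x.
  exact: (telescope (w2 (uh t) x) (w2 (w t) x) (p 0 2 t x)).
have -> : ip (fun x => Dx (beta t) x * (th t x + rho t x)
                   + beta t x * (th1 t x + rho1 t x)) (th1 t) =
    ip (fun x => Dx (beta t) x * uh t x + beta t x * Dx (uh t) x) (th1 t) -
    ip (fun x => Dx (beta t) x * p 0 0 t x + beta t x * p 0 1 t x) (th1 t).
  rewrite -(ipBl (Lprod _ _ LU LU1) (Lprod _ _ Lu Lu1) Lth1); congr ip.
  apply/funext => x.
  have -> : th t x + rho t x = uh t x - u t x by exact: telescope.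
  have -> : th1 t x + rho1 t x = Dx (uh t) x - p 0 1 t x by exact: telescope1.
  by rewrite !mulrBr opprD addrACA.
have -> : th1 t 1 + rho1 t 1 = Dx (uh t) 1 - p 0 1 t 1.
  exact: telescope1.
have -> : th t 1 + rho t 1 = uh t 1 - u t 1 by exact: telescope.
exact: (subtract_equations eqh equ).
Qed.

(** The defect of [th] is that of [uh], which tends to 0 by assumption, minus that
    of [w], which is the projection of the defect of [u]. *)
Let th1_quotient t : 0 <= t <= T ->
  forall k, 0 < k -> exists2 e, 0 < e & forall tau, 0 <= tau <= T ->
     tau != t -> `|tau - t| < e ->
     let q := quotient_defect th1 (fun=> tht1 t) t tau in ip q q <= k ^+ 2.
Proof.
move=> tT k k0; have j0 : 0 < k / 2 by rewrite divr_gt0.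
have [hC _ _] := hsemi; have [_ _ lim _] := hC t tT.
have [e1 e10 h1] := (cvg_within_dnbhsP _ _ _ _).1 lim _ j0.
have [e2 e20 h2] := C1n_energy_quotient T0 hu r2 j0.
exists (Num.min e1 e2); first by rewrite lt_min e10.
move=> tau tauT taut; rewrite lt_min => /andP[te1 te2].
have hU := @H2_derivs_quotient _ uh (fun s => Dx (uh s)) (fun s => w2 (uh s))
  (dt T uh) (fun s => Dx (dt T uh s)) (fun s => w2 (dt T uh s)) t tau
  (S_derivs (Suh tauT)) (S_derivs (Suh tT)) (S_derivs (Suht tT)).
have hW := @H2_derivs_quotient _ w (fun s => Dx (w s)) (fun s => w2 (w s))
  wt (fun s => Dx (wt s)) (fun s => w2 (wt s)) t tau
  (S_derivs (Sw tauT)) (S_derivs (Sw tT)) (S_derivs (Swt tT)).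
have [LU0 LU1 LU2] := H2_derivs_L2 hU; have [_ LW1 LW2] := H2_derivs_L2 hW.
set qU := quotient_defect (fun s => Dx (uh s)) _ t tau in hU LU1.
set qW := quotient_defect (fun s => Dx (w s)) _ t tau in hW LW1.
have bU : ip qU qU <= (k / 2) ^+ 2.
  have tauI : `[0, T]%classic tau by rewrite /= in_itv.
  have := h1 tau tauI taut te1; rewrite subr0 => hn.
  have := H2_derivs_Hnorm hU => e.
  apply: (@le_trans _ _ (Hnorm 2 (quotient_defect uh (dt T uh) t tau) ^+ 2)).
    by rewrite e addrAC lerDr addr_ge0// ip_ge0.
  by rewrite lerXn2r ?nnegrE ?Hnorm_ge0// ?(ltW j0)// (le_trans (ler_norm _))// ltW.
have bW : ip qW qW <= (k / 2) ^+ 2.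
  have [Hq eq] := h2 t tau tT tauT taut te2.
  have P : is_elliptic_projection S (quotient_defect u (dt T u) t tau)
      (quotient_defect w wt t tau).
    have Hu s : 0 <= s <= T -> in_H2 (u s) by exact: (u_in_H2 (isT : (0 <= 1)%N)).
    have qE (F G : R -> R -> R) : quotient_defect F G t tau =
        (fun x => (tau - t)^-1 * (1 * F tau x + (-1) * F t x) + (-1) * G t x).
      by apply/funext => x; rewrite /quotient_defect !mulN1r mul1r mulrC.
    rewrite (qE u) (qE w).
    exact: (projection_lin (tau - t)^-1 (-1) hS
      (in_H2_lin 1 (-1) (Hu _ tauT) (Hu _ tT)) (u_in_H2 (leqnn 1) tT)
      (projection_lin 1 (-1) hS (Hu _ tauT) (Hu _ tT) (w_proj tauT) (w_proj tT))
      (wt_proj tT)).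
  apply: le_trans (le_trans (projection_contraction hS Hq P) eq).
  by rewrite (H2_derivs_energy hW hW) lerDr ip_ge0.
rewrite /= (_ : quotient_defect th1 _ t tau = fun x => qU x - qW x); last first.
  by apply/funext => x; exact: quotient_of_difference.
apply: (le_trans (ip_sub_le LU1 LW1)).
have -> : k ^+ 2 = 2 * ((k / 2) ^+ 2 + (k / 2) ^+ 2) by field.
exact: (ler_wpM2l (ler0n R 2) (lerD bU bW)).
Qed.

Let L2_th1 t : 0 <= t <= T -> L2 (th1 t).
Proof. by move=> /th_H2/H2_derivs_L2[]. Qed.

Let L2_tht1 t : 0 <= t <= T -> L2 (tht1 t).
Proof.
move=> tT; have [_ L1' _] := H2_derivs_L2 (S_derivs (Suht tT)).
have [_ L2' _] := H2_derivs_L2 (S_derivs (Swt tT)).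
exact: L2B.
Qed.

Let L2_rhot1 t : 0 <= t <= T -> L2 (rhot1 t).
Proof.
move=> tT; have [_ L1' _] := H2_derivs_L2 (S_derivs (Swt tT)).
have [_ L2' _] := H2_derivs_L2 (u_H2 (leqnn 1) tT).
exact: L2B.
Qed.

(** The initial discrete error lies in the space and is orthogonal to it. *)
Let th1_initial : ip (th1 0) (th1 0) = 0.
Proof.
have tT : 0 <= (0 : R) <= T by rewrite lexx ltW.
have [_ [_ init] _] := hsemi; have [_ _ _ hu0] := hsol.
have Hu := u_in_H2 (isT : (0 <= 1)%N) tT.
have Huh := H2_space_in_H2 hS (Suh tT); have Hw := H2_space_in_H2 hS (Sw tT).
have orth chi : S chi -> energy (th 0) chi = 0.
  move=> Schi; have Hc := H2_space_in_H2 hS Schi.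
  have e1 : energy (uh 0) chi = energy u0 chi by rewrite !energyE; exact: init.
  have eu : {in I01, u 0 =1 u0}.
    by move=> x; rewrite inE => Ix; exact: hu0.
  have e2 := (energy_eq Hu Hc eu).2.
  have e3 : energy (w 0) chi = energy (u 0) chi.
    by rewrite !energyE; exact: (w_proj tT).2.
  have -> : energy (th 0) chi = 1 * energy (uh 0) chi + (-1) * energy (w 0) chi.
    exact: energy_linl.
  by rewrite e1 e2 e3 mul1r mulN1r subrr.
have := orth _ (S_th tT); rewrite (H2_derivs_energy (th_H2 tT) (th_H2 tT)) => e.
apply/le_anti/andP; split; last exact: ip_ge0.
by rewrite -[leRHS]e lerDr; exact: ip_ge0.
Qed.

Let K := gronwall_constant a0 M.

Let K0 : 0 <= K. Proof. exact: gronwall_constant_ge0. Qed.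

Let th1_inequality t : 0 <= t <= T ->
  2 * ip (tht1 t) (th1 t) <=
  K * ip (th1 t) (th1 t) + K * Q ^+ 2 * Gamma_D T r u t.
Proof.
move=> tT; have I1 : 0 <= (1 : R) <= 1 by rewrite ler01 lexx.
have cb := AC_continuous (AC_deriv_in (beta_C1 tT)); have [_ cb1] := beta_C1 tT.
have th00 : th t 0 = 0 by rewrite /th (at0 (Suh tT)) (at0 (Sw tT)) !mulr0 addr0.
have rho00 : rho t 0 = 0 by rewrite /rho (at0 (Sw tT)) u_at0// !mulr0 addr0.
have orth := rho_orth tT (S_th tT).
rewrite (H2_derivs_energy (rho_H2 tT) (th_H2 tT)) in orth.
have [rN flux] := rho1_rate tT; have rNt := rhot1_rate tT.
have ineq := energy_inequality a0_gt0 M1 (aM tT) (alM tT) (kaM tT) cb cb1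
  (fun x => @bM t x tT) (fun x => @b1M t x tT) (th_H2 tT) (rho_H2 tT) th00 rho00
  (L2_tht1 tT) (L2_rhot1 tT) orth flux (error_equation tT).
apply: (le_trans ineq).
rewrite -/K -addrA mulrDr lerD2l -mulrA ler_wpM2l// /Gamma_D mulrDr -!exprMn.
exact: lerD.
Qed.

Let Gamma_continuous : {within `[0, T], continuous (Gamma_D T r u)}.
Proof.
pose G t := \sum_(l < r.+2) ip (p 0 l t) (p 0 l t) + \sum_(l < r.+2) ip (p 1 l t) (p 1 l t).
have cG : {within `[0, T], continuous G}.
  have c i : (i <= 1)%N -> {within `[0, T], continuous (fun t => \sum_(l < r.+2) ip (p i l t) (p i l t))}.
    move=> i1; apply: within_continuous_sum => l; apply: continuous_ip_slice.
    by apply: (C1n_continuous hu) => //; rewrite -ltnS.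
  move=> x; apply: (@continuousD _ _ (subspace `[0, T])
    (fun t => \sum_(l < r.+2) ip (p 0 l t) (p 0 l t))
    (fun t => \sum_(l < r.+2) ip (p 1 l t) (p 1 l t))); exact: c.
apply: subspace_eq_continuous cG => t; rewrite inE /= in_itv /= => tT.
rewrite -[LHS]/(G t) -[RHS]/(Gamma_D T r u t) /Gamma_D.
rewrite (AC_chain_Hnorm (C1n_AC_chain hu (isT : (0 <= 1)%N) tT)).
by rewrite (AC_chain_Hnorm (C1n_AC_chain hu (leqnn 1) tT)).
Qed.

Lemma Gamma_integral_ge0 t : 0 <= \int[mu]_(tau in `[0, t]) Gamma_D T r u tau.
Proof. by apply: Rintegral_ge0 => s _; rewrite addr_ge0// sqr_ge0. Qed.

(** Gronwall's inequality bounds [th], the rate bounds [rho], and Poincare's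
    inequality reduces the norm to the one of the derivative. *)
Lemma one_mesh_error t : 0 <= t <= T ->
  Hnorm 1 (uh t \- u t) ^+ 2 <=
    4 * (expR (K * T) * K * Q ^+ 2 * \int[mu]_(tau in `[0, t]) Gamma_D T r u tau
         + Q ^+ 2 * Hnorm r.+1 (u t) ^+ 2).
Proof.
move=> tT; have /andP[t0 tT'] := tT.
pose kap s := K * Q ^+ 2 * Gamma_D T r u s.
have KQ0 : 0 <= K * Q ^+ 2 by rewrite mulr_ge0// sqr_ge0.
have G0 s : 0 <= Gamma_D T r u s by rewrite addr_ge0// sqr_ge0.
have ckap : {within `[0, T], continuous kap}.
  move=> x; apply: (@continuousM _ (subspace `[0, T]) (cst (K * Q ^+ 2)) (Gamma_D T r u)).
    exact: cst_continuous.
  exact: Gamma_continuous.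
have dE s : 0 <= s <= T ->
    derivable_in `[0, T] (fun s => ip (th1 s) (th1 s)) s /\
    deriv_in `[0, T] (fun s => ip (th1 s) (th1 s)) s = 2 * ip (tht1 s) (th1 s).
  by move=> sT; apply: (ip_sqr_deriv_in T0 sT L2_th1 (L2_tht1 sT)); exact: th1_quotient.
have kap0 s : 0 <= s <= T -> 0 <= kap s by move=> _; rewrite mulr_ge0.
have E := gronwall T0 K0 th1_initial dE ckap kap0 th1_inequality tT.
have iG : mu.-integrable `[0, t] (EFin \o Gamma_D T r u).
  apply: continuous_compact_integrable; first exact: segment_compact.
  apply: continuous_subspaceW Gamma_continuous.
  by apply: subset_itv; rewrite bnd_simp.
rewrite RintegralZl// in E.
have hth := th_H2 tT; have hrho := rho_H2 tT.
have [h01 _ _] := hth; have [r01 _ _] := hrho.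
have Lth1 := L2_th1 tT; have [_ Lrho1 _] := H2_derivs_L2 hrho.
have he := ACD h01 r01.
have Le1 : L2 (fun x => th1 t x + rho1 t x) by exact: L2D.
have -> : uh t \- u t = (fun x => th t x + rho t x).
  by apply/funext => x; rewrite /= -[LHS](telescope (uh t x) (w t x) (u t x)).
rewrite (AC_Hnorm1 he Le1).
have e0 : th t 0 + rho t 0 = 0.
  by rewrite /th /rho (at0 (Suh tT)) (at0 (Sw tT)) u_at0// !mulr0 !addr0.
have pc := ip_poincare he Le1 e0; have sm := ip_sum_le Lth1 Lrho1.
have [rN _] := rho1_rate tT; rewrite exprMn in rN.
apply: (le_trans (lerD pc (lexx _))).
have -> : expR (K * T) * K * Q ^+ 2 * \int[mu]_(tau in `[0, t]) Gamma_D T r u tau =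
  expR (K * T) * (K * Q ^+ 2 * \int[mu]_(tau in `[0, t]) Gamma_D T r u tau).
  by rewrite !mulrA.
have := lerD E rN => EN.
have := le_trans sm (ler_wpM2l (ler0n R 2) EN) => fin.
by apply: (le_trans (lerD fin fin)); rewrite -mulrDl -natrD.
Qed.

End OneMesh.
End DiscreteError.

(** * Bounds for the data and the theorem *)

Lemma smooth_in_bounded (R : realType) (T : R) (v : R -> R) : smooth_in `[0, T] v ->
  exists2 M, 0 <= M & forall t, 0 <= t <= T -> `|v t| <= M.
Proof.
move=> hv; apply: itv_continuous_bounded; apply: derivable_in_within => t tT.
exact: (hv 0%N).
Qed.

Lemma smooth_in_inv_bounded (R : realType) (T : R) (v : R -> R) : 0 < T ->
  smooth_in `[0, T] v -> (forall t, 0 <= t <= T -> 0 < v t) ->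
  exists2 M, 0 <= M & forall t, 0 <= t <= T -> `|(v t)^-1| <= M.
Proof.
move=> T0 hv v0.
have cv : {within `[0, T], continuous v}.
  by apply: derivable_in_within => t tT; exact: (hv 0%N).
have [c] := EVT_min (ltW T0) cv; rewrite in_itv /= => cT cmin.
have vc := v0 c cT; exists (v c)^-1; first by rewrite invr_ge0 ltW.
move=> t tT; rewrite ger0_norm ?invr_ge0 ?(ltW (v0 t tT))//.
by rewrite lef_pV2 ?posrE ?v0// cmin// in_itv.
Qed.

Lemma smooth_rect_C1 (R : realType) (T : R) (F : R -> R -> R) : smooth_rect T F ->
  [/\ continuous_rect T F, continuous_rect T (dx F)
    & forall t, 0 <= t <= T -> C1_I01 (F t)].
Proof.
move=> /(_ 1%N)[cF [dF _ [cF1 _]]]; split=> // t tT; split.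
  move=> x; rewrite /I01 /= in_itv /= => x01.
  by have [] := dF t x; first exact/rectP.
exact: (continuous_rect_slice cF1 tT).
Qed.

Theorem theorem4p12 (R : realType)
    (r : nat) (hr : (3 <= r)%N)
    (hstar : R) (hstar_gt0 : 0 < hstar)
    (S : R -> set (R -> R))
    (S_fe : forall h, 0 < h <= hstar -> fe_space r h (S h))
    (S_approx : approximation_property r hstar S)
    (T : R) (T_gt0 : 0 < T)
    (beta f : R -> R -> R) (delta g eps a u0 : R -> R)
    (data_smooth : smooth_data T beta f delta g eps a u0)
    (a_gt0 : forall t, 0 <= t <= T -> 0 < a t)
    (inf_a_gt0 : 0 < inf (a @` `[0, T]))
    (eps_gt0 : forall t, 0 <= t <= T -> 0 < eps t)
    (u : R -> R -> R)
    (u_regular : C1n_rect T r.+1 u)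
    (u_solution : solution_P T beta f delta g eps a u0 u)
    (uh : R -> R -> R -> R)
    (uh_semidiscrete : forall h, 0 < h <= hstar ->
       semidiscrete T beta f delta g eps a u0 (S h) (uh h)) :
  exists C : R, forall t h, 0 <= t <= T -> 0 < h <= hstar ->
    Hnorm 1 (uh h t \- u t) <=
      C * h ^+ r *
        (Hnorm r.+1 (u t) +
         Num.sqrt (\int[@lebesgue_measure R]_(tau in `[0, t]) Gamma_D T r u tau)).
Proof.
have [[sbeta sf] [sdelta _] [seps sa] _] := data_smooth.
have [cbeta cbeta1 beta_C1] := smooth_rect_C1 sbeta.
have [_ _ f_C1] := smooth_rect_C1 sf.
have [Ma Ma0 hMa] := smooth_in_bounded sa.
have [Md Md0 hMd] := smooth_in_bounded sdelta.
have [Me Me0 hMe] := smooth_in_inv_bounded T_gt0 seps eps_gt0.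
have [Mb Mb0 hMb] := continuous_rect_bounded cbeta.
have [Mc Mc0 hMc] := continuous_rect_bounded cbeta1.
have MaMe := mulr_ge0 Ma0 Me0; have MdMe := mulr_ge0 Md0 Me0.
pose M := 1 + Ma + Ma * Me + (Md * Me + Mb) + Mc.
have M1 : 1 <= M by rewrite /M; lra.
set a0 := inf _ in inf_a_gt0.
have aM t : 0 <= t <= T -> a0 <= a t <= M.
  move=> tT; apply/andP; split.
    apply: ge_inf; last by exists t => //=; rewrite in_itv.
    by exists 0 => _ [s + <-]; rewrite /= in_itv /= => sT; exact/ltW/a_gt0.
  apply: (le_trans (ler_norm _)); apply: (le_trans (hMa t tT)).
  by rewrite /M; lra.
have alM t : 0 <= t <= T -> `|a t / eps t| <= M.
  move=> tT; rewrite normrM; apply: (@le_trans _ _ (Ma * Me)).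
    by rewrite ler_pM// ?hMa// hMe.
  by rewrite /M; lra.
have I1 : 0 <= (1 : R) <= 1 by rewrite ler01 lexx.
have kaM t : 0 <= t <= T -> `|delta t / eps t + beta t 1| <= M.
  move=> tT; apply: (le_trans (ler_normD _ _)).
  apply: (@le_trans _ _ (Md * Me + Mb)); last by rewrite /M; lra.
  rewrite lerD//; last by apply: hMb; exact/rectP.
  by rewrite normrM ler_pM// ?hMd// hMe.
have bM t x : 0 <= t <= T -> 0 <= x <= 1 -> `|beta t x| <= M.
  move=> tT x01; have := hMb t x ((rectP T t x).2 (conj tT x01)).
  by rewrite /M; lra.
have b1M t x : 0 <= t <= T -> 0 <= x <= 1 -> `|deriv_in (@I01 R) (beta t) x| <= M.
  move=> tT x01; have := hMc t x ((rectP T t x).2 (conj tT x01)).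
  by rewrite /M /dx; lra.
have [C C0 rate] := projection_rate hr S_fe S_approx.
pose A := expR (gronwall_constant a0 M * T) * gronwall_constant a0 M.
have A0 : 0 <= A by rewrite mulr_ge0 ?expR_ge0// gronwall_constant_ge0.
exists (2 * C * Num.sqrt (A + 1)) => t h tT hh; have /andP[h0 _] := hh.
have fe := S_fe h hh; have [_ Sreg _ _] := fe.
have hr0 : 0 <= h ^+ r by rewrite exprn_ge0// ltW.
have Q0 : 0 <= C * h ^+ r by rewrite mulr_ge0.
have rateh d w hd d0 ew := rate h d w hh hd d0 ew.
have := one_mesh_error hr T_gt0 (fe_space_H2 fe) Sreg u_regular u_solution
  (uh_semidiscrete h hh) eps_gt0 beta_C1 f_C1 inf_a_gt0 M1 aM alM kaM bM b1M
  rateh tT.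
rewrite -/A; set N := Hnorm r.+1 (u t); set J := \int[_]_(_ in _) _ => err.
have N0 : 0 <= N by exact: Hnorm_ge0.
have J0 : 0 <= J by exact: Gamma_integral_ge0.
have B0 : 0 <= 2 * C * Num.sqrt (A + 1) * h ^+ r * (N + Num.sqrt J).
  by rewrite mulr_ge0 ?addr_ge0 ?sqrtr_ge0// mulr_ge0// mulr_ge0 ?sqrtr_ge0// mulr_ge0.
rewrite -ler_sqr ?nnegrE ?Hnorm_ge0//; apply: (le_trans err).
have -> : (2 * C * Num.sqrt (A + 1) * h ^+ r * (N + Num.sqrt J)) ^+ 2 =
    4 * ((C * h ^+ r) ^+ 2 * ((A + 1) * (N + Num.sqrt J) ^+ 2)).
  rewrite -[in RHS](@sqr_sqrtr _ (A + 1)) ?addr_ge0//; ring.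
have -> : A * (C * h ^+ r) ^+ 2 * J + (C * h ^+ r) ^+ 2 * N ^+ 2 =
    (C * h ^+ r) ^+ 2 * (A * J + N ^+ 2) by ring.
rewrite ler_wpM2l// ler_wpM2l ?sqr_ge0//.
have sJ : Num.sqrt J ^+ 2 = J by rewrite sqr_sqrtr.
have NJ : 0 <= N * Num.sqrt J by rewrite mulr_ge0 ?sqrtr_ge0.
have -> : (N + Num.sqrt J) ^+ 2 = N ^+ 2 + 2 * (N * Num.sqrt J) + J.
  by rewrite sqrrD sJ mulr_natl.
have h1 : 0 <= A * N ^+ 2 by rewrite mulr_ge0// sqr_ge0.
have h2 : 0 <= A * (N * Num.sqrt J) by rewrite mulr_ge0.
by rewrite mulrDl mul1r !mulrDr; lra.
Qed.
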